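(* Let $f_0,f_1,f_2\in\mathcal{E}_m$ with $f_2=f_0+f_1$ and $f_0,f_1$ relatively prime in $\mathcal{E}_m$. If $\mathbf{F}$ has characteristic zero, assume at least one of $f_0,f_1$ is non-constant; if $\mathbf{F}$ has positive characteristic $p$, assume at least one of $f_0,f_1$ is not a $p$-th power in $\mathcal{E}_m$. Let $r_0>0$. Then for $r\ge r_0$, $$\max_{0\le i\le2}\log|f_i|_r\le\log|R(f_0f_1f_2)|_r-\log r+O(1).$$
   Context: $\mathbf{F}$ is an algebraically closed field of arbitrary characteristic, complete with respect to a non-Archimedean absolute value. $\mathcal{E}_m$ is the ring of entire functions on $\mathbf{F}^m$: power series $f=\sum_\gamma a_\gamma z^\gamma$ with coefficients in $\mathbf{F}$ and $|a_\gamma|r^{|\gamma|}\to0$ as $|\gamma|\to\infty$ for all $r\ge0$; for $r>0$, $|f|_r=\sup_\gamma|a_\gamma|r^{|\gamma|}$. Units are nonzero constants; gcd and lcm exist in $\mathcal{E}_m$ up to constant factors; relatively prime means the gcd is constant. The radical of $f$ is $R(f)=\mathrm{lcm}_{1\le j\le m}\big(f/\gcd(f,\partial f/\partial z_j)\big)$. $O(1)$ denotes a quantity bounded independently of $r$. *)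

(* Defs.v *)
From HB Require Import structures.
From mathcomp Require Import all_boot all_order all_algebra.
(* mpoly is loaded before the analysis files: with the opposite order, Rocq
   rejects it because of incompatible notation levels. *)
From mathcomp.multinomials Require Import mpoly.
From mathcomp Require Import boolp classical_sets functions reals.

Set Implicit Arguments.
Unset Strict Implicit.
Unset Printing Implicit Defensive.

Import Order.TTheory GRing.Theory Num.Theory.
Local Open Scope classical_set_scope.
Local Open Scope ring_scope.

(* The normed structures of MathComp require `|x *+ n| = `|x| *+ n, which fails
   for non-Archimedean absolute values. The trivial absolute value is not
   excluded. *)
Record nonarch_absval (R : realType) (F : fieldType) := NonarchAbsval {
  absval :> F -> R;
  absval_ge0 : forall x, 0 <= absval x;
  absval_eq0 : forall x, absval x = 0 <-> x = 0;
  absvalM : forall x y, absval (x * y) = absval x * absval y;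
  absvalD : forall x y, absval (x + y) <= Num.max (absval x) (absval y) }.

Definition complete_absval (R : realType) (F : fieldType)
    (v : nonarch_absval R F) : Prop :=
  forall u : nat -> F,
    (forall e, 0 < e -> exists N, forall i j, (N <= i)%N -> (N <= j)%N ->
       v (u i - u j) < e) ->
    exists l, forall e, 0 < e -> exists N, forall i, (N <= i)%N ->
      v (u i - l) < e.

Section AbsvalTheory.
Variables (R : realType) (F : fieldType) (v : nonarch_absval R F).

Lemma absval0 : v 0 = 0. Proof. exact/absval_eq0. Qed.

Lemma absval1 : v 1 = 1.
Proof.
have v1 : v 1 != 0 by apply/eqP => /absval_eq0/eqP; rewrite oner_eq0.
by apply: (mulfI v1); rewrite -absvalM !mulr1.
Qed.

Lemma absvalN x : v (- x) = v x.
Proof.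
rewrite -mulN1r absvalM; suff -> : v (-1) = 1 by rewrite mul1r.
apply/eqP; rewrite -(sqrp_eq1 (absval_ge0 v _)).
by rewrite expr2 -absvalM mulrNN mulr1 absval1.
Qed.

Lemma absval_nat n : v n%:R <= 1.
Proof.
elim: n => [|n IHn]; first by rewrite absval0 ler01.
by rewrite -natr1 (le_trans (absvalD _ _ _))// ge_max IHn absval1 lexx.
Qed.

End AbsvalTheory.

Section PowerSeries.
Variables (F : fieldType) (m : nat).
Implicit Types (a b c : 'X_{1..m} -> F) (g : 'X_{1..m}).

Definition cauchy_prod a b g : F :=
  \sum_(k : 'X_{1..m < (mdeg g).+1, (mdeg g).+1} | g == (k.1 + k.2)%MM)
     a k.1 * b k.2.

Definition series_const (x : F) g : F := if g == 0%MM then x else 0.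

Definition series_deriv (j : 'I_m) a g : F := a (g + U_(j))%MM *+ (g j).+1.

(* The ring laws are inherited from those of the multivariate polynomials
   through truncation. *)
Let trunc d a : {mpoly F[m]} := \sum_(k : 'X_{1..m < d}) a k *: 'X_[k].

Let mcoeff_trunc d a g : (mdeg g < d)%N -> (trunc d a)@_g = a g.
Proof.
move=> gd; rewrite /trunc raddf_sum (bigD1 (BMultinom gd))//=.
rewrite mcoeffZ mcoeffX eqxx mulr1 big1 ?addr0// => k kg.
rewrite mcoeffZ mcoeffX; case: eqP => [e|]; rewrite ?mulr0//.
by case/eqP: kg; apply: val_inj.
Qed.

Let eq_cauchy a a' b b' g :
  (forall k, (mdeg k <= mdeg g)%N -> a k = a' k) ->
  (forall k, (mdeg k <= mdeg g)%N -> b k = b' k) ->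
  cauchy_prod a b g = cauchy_prod a' b' g.
Proof.
move=> ea eb; apply: eq_bigr => -[k1 k2]/= _.
by rewrite ea ?eb// -ltnS bmdeg.
Qed.

Let cauchyE p q g :
  cauchy_prod (fun k => p@_k) (fun k => q@_k) g = (p * q : {mpoly F[m]})@_g.
Proof. by rewrite mcoeffM. Qed.

Let cauchy_trunc d a b g : (mdeg g < d)%N ->
  cauchy_prod a b g = (trunc d a * trunc d b)@_g.
Proof.
move=> gd; rewrite -cauchyE; apply: eq_cauchy => k kg.
all: by rewrite mcoeff_trunc// (leq_ltn_trans kg).
Qed.

Lemma cauchyC a b : cauchy_prod a b = cauchy_prod b a.
Proof.
by apply/funext => g; rewrite !(@cauchy_trunc (mdeg g).+1)// mulrC.
Qed.

Lemma cauchyA a b c :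
  cauchy_prod a (cauchy_prod b c) = cauchy_prod (cauchy_prod a b) c.
Proof.
apply/funext => g; set d := (mdeg g).+1.
transitivity ((trunc d a * (trunc d b * trunc d c))@_g).
  rewrite -cauchyE; apply: eq_cauchy => k kg.
    by rewrite mcoeff_trunc.
  by rewrite -cauchy_trunc.
rewrite mulrA -cauchyE; apply: eq_cauchy => k kg.
  by rewrite -cauchy_trunc.
by rewrite mcoeff_trunc.
Qed.

Lemma cauchyDl a b c :
  cauchy_prod (a + b) c = cauchy_prod a c + cauchy_prod b c.
Proof.
apply/funext => g; rewrite [RHS]/GRing.add/= -big_split/=.
by apply: eq_bigr => k _; rewrite -mulrDl.
Qed.

Lemma cauchy1l a : cauchy_prod (series_const 1) a = a.
Proof.
apply/funext => g; set d := (mdeg g).+1.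
transitivity ((1 * trunc d a)@_g); last by rewrite mul1r mcoeff_trunc.
rewrite -cauchyE; apply: eq_cauchy => k kg; last by rewrite mcoeff_trunc.
by rewrite mcoeff1 /series_const; case: eqP.
Qed.

End PowerSeries.

Arguments series_const {F} m x g.

Section Entire.
Variables (R : realType) (F : fieldType) (v : nonarch_absval R F) (m : nat).
Implicit Types (a b : 'X_{1..m} -> F) (g : 'X_{1..m}).

Definition is_entire a : Prop :=
  forall r : R, 0 <= r -> forall e : R, 0 < e ->
    exists N, forall g, (N <= mdeg g)%N -> v (a g) * r ^+ mdeg g < e.

Definition entire_pred : {pred 'X_{1..m} -> F} := fun a => `[< is_entire a >].

Record entire := Entire {
  entire_coef :> 'X_{1..m} -> F;
  _ : entire_pred entire_coef }.

HB.instance Definition _ := [isSub for entire_coef].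
HB.instance Definition _ := [Choice of entire by <:].

Lemma entireP (f : entire) : is_entire f.
Proof. by case: f => a ea; exact/asboolP. Qed.

Lemma is_entire_bounded a (r : R) : is_entire a -> 0 <= r ->
  exists2 M, 0 < M & forall g, v (a g) * r ^+ mdeg g <= M.
Proof.
move=> ea r0; have [N aN] := ea r r0 1 ltr01.
have t0 g : 0 <= v (a g) * r ^+ mdeg g by rewrite mulr_ge0 ?absval_ge0 ?exprn_ge0.
pose S := \sum_(k : 'X_{1..m < N}) v (a k) * r ^+ mdeg k.
have S0 : 0 <= S by apply: sumr_ge0.
exists (1 + S) => [|g]; first by rewrite ltr_pwDl.
have [gN|/aN/ltW gN] := ltnP (mdeg g) N; last by rewrite (le_trans gN)// lerDl.
rewrite /S (bigD1 (BMultinom gN))//= addrCA lerDl addr_ge0 ?ler01 ?sumr_ge0//.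
Qed.

Lemma is_entire_const x : is_entire (series_const m x).
Proof.
move=> r r0 e e0; exists 1%N => g g0; rewrite /series_const.
by case: eqP g0 => [->|_ _]; rewrite ?mdeg0// absval0 mul0r.
Qed.

Let absval_lt_add (t e : R) x y : 0 <= t -> v x * t < e -> v y * t < e ->
  v (x + y) * t < e.
Proof.
move=> t0 xe ye; apply: le_lt_trans (ler_wpM2r t0 (absvalD v x y)) _.
by rewrite maxr_pMl// gt_max xe.
Qed.

Lemma is_entire_prod a b : is_entire a -> is_entire b ->
  is_entire (cauchy_prod a b).
Proof.
move=> ea eb r r0 e e0.
have [Ma Ma0 aM] := is_entire_bounded ea r0.
have [Mb Mb0 bM] := is_entire_bounded eb r0.
have [Na aN] := ea r r0 (e / Mb) (divr_gt0 e0 Mb0).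
have [Nb bN] := eb r r0 (e / Ma) (divr_gt0 e0 Ma0).
exists (Na + Nb)%N => g gN; rewrite /cauchy_prod.
have rg0 : 0 <= r ^+ mdeg g by rewrite exprn_ge0.
apply: (big_ind (fun x => v x * r ^+ mdeg g < e)).
- by rewrite absval0 mul0r.
- by move=> x y; apply: absval_lt_add.
case=> -[k1 _] [k2 _] /= /eqP gk.
rewrite absvalM gk mdegD exprD mulrACA.
have [k1N|k1N] := leqP Na (mdeg k1).
  apply: (@le_lt_trans _ _ (v (a k1) * r ^+ mdeg k1 * Mb)).
    by rewrite ler_wpM2l// mulr_ge0 ?absval_ge0 ?exprn_ge0.
  by rewrite -ltr_pdivlMr// aN.
apply: (@le_lt_trans _ _ (Ma * (v (b k2) * r ^+ mdeg k2))).
  by rewrite ler_wpM2r// mulr_ge0 ?absval_ge0 ?exprn_ge0.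
rewrite mulrC -ltr_pdivlMr// bN// leqNgt; apply/negP => k2N.
by move: gN; rewrite leqNgt gk mdegD -addSn leq_add// ltnW.
Qed.

Lemma is_entire_deriv j a : is_entire a -> is_entire (series_deriv j a).
Proof.
move=> ea r r0 e e0; pose s := Num.max r 1.
have s1 : 1 <= s by rewrite le_max lexx orbT.
have s0 : 0 <= s by rewrite (le_trans _ s1).
have [N aN] := ea s s0 e e0; exists N => g gN.
apply: le_lt_trans (aN (g + U_(j))%MM _); last first.
  by rewrite mdegD (leq_trans gN)// leq_addr.
rewrite /series_deriv -mulr_natr absvalM ler_pM ?exprn_ge0//.
- by rewrite mulr_ge0 ?absval_ge0.
- by rewrite ler_piMr ?absval_ge0// absval_nat.
rewrite mdegD mdeg1 addn1 (@le_trans _ _ (s ^+ mdeg g))//.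
  by rewrite lerXn2r ?nnegrE// le_max lexx.
by rewrite ler_weXn2l.
Qed.

Lemma entire_zmod_closed : zmod_closed entire_pred.
Proof.
split; first by apply/asboolP => r r0 e e0; exists 0%N => g _; rewrite absval0 mul0r.
move=> a b /asboolP ea /asboolP eb; apply/asboolP => r r0 e e0.
have [Na aN] := ea r r0 e e0; have [Nb bN] := eb r r0 e e0.
exists (maxn Na Nb) => g; rewrite geq_max => /andP[ga gb].
apply: (@absval_lt_add _ _ (a g) (- b g) _ (aN g ga)); first exact: exprn_ge0.
by rewrite absvalN bN.
Qed.

HB.instance Definition _ := GRing.isZmodClosed.Build ('X_{1..m} -> F)
  entire_pred entire_zmod_closed.
HB.instance Definition _ := [SubChoice_isSubZmodule of entire by <:].

Definition entire_const (x : F) : entire :=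
  Entire (introT (asboolP _) (is_entire_const x)).

Definition entire_mul (f g : entire) : entire :=
  Entire (introT (asboolP _) (is_entire_prod (entireP f) (entireP g))).

Definition entire_deriv (j : 'I_m) (f : entire) : entire :=
  Entire (introT (asboolP _) (is_entire_deriv j (entireP f))).

Lemma entire_mulA : associative entire_mul.
Proof. by move=> f g h; apply: val_inj; exact: cauchyA. Qed.

Lemma entire_mulC : commutative entire_mul.
Proof. by move=> f g; apply: val_inj; exact: cauchyC. Qed.

Lemma entire_mul1f : left_id (entire_const 1) entire_mul.
Proof. by move=> f; apply: val_inj; exact: cauchy1l. Qed.

Lemma entire_mulDl : left_distributive entire_mul +%R.
Proof. by move=> f g h; apply: val_inj; exact: cauchyDl. Qed.

Lemma entire_const1_neq0 : entire_const 1 != 0.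
Proof.
apply/eqP => /(congr1 (fun f : entire => f 0%MM)).
by rewrite /= /series_const eqxx => /eqP; rewrite oner_eq0.
Qed.

HB.instance Definition _ := GRing.Zmodule_isComNzRing.Build entire
  entire_mulA entire_mulC entire_mul1f entire_mulDl entire_const1_neq0.

(* For r > 0 the set is bounded, since f is entire, so this is an actual
   supremum. *)
Definition entire_norm (f : entire) (r : R) : R :=
  sup [set v (f g) * r ^+ mdeg g | g in [set: 'X_{1..m}]].

Definition is_constant (f : entire) : Prop := exists x, f = entire_const x.

End Entire.

Section Divisibility.
Variable A : comNzRingType.
Implicit Types (x y d l : A).

Definition divides d x : Prop := exists y, x = d * y.

Definition is_gcd x y d : Prop :=
  [/\ divides d x, divides d y &
      forall e, divides e x -> divides e y -> divides e d].

Definition is_lcm (I : Type) (x : I -> A) l : Prop :=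
  (forall i, divides (x i) l) /\
  forall k, (forall i, divides (x i) k) -> divides l k.

End Divisibility.

Section Radical.
Variables (R : realType) (F : fieldType) (v : nonarch_absval R F) (m : nat).
Implicit Types f rad : entire v m.

Definition relatively_prime f g : Prop :=
  exists2 c : F, c != 0 & is_gcd f g (entire_const v m c).

(* gcds and lcms, hence radicals, are only defined up to a nonzero constant
   factor: rad is one of the possible values of the radical of f. For f != 0,
   the quotient q j is determined by d j. *)
Definition is_radical f rad : Prop :=
  exists d q : 'I_m -> entire v m,
    (forall j, is_gcd f (entire_deriv j f) (d j) /\ f = d j * q j) /\
    is_lcm q rad.

End Radical.

(* Main.v *)
(* For f = f0 f1 f2 and a variable z_j such that the Wronskian
   W = f0 D_j f1 - f1 D_j f0 is not zero, d_j = gcd (f, D_j f) divides W, hence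
   |f| / |R(f)| is at most a constant times |W|, while
   |W|_r <= |f_a|_r |f_b|_r / r for any two of the f_i; this bounds the third one.
   Both the existence of j and the divisibility d_j | W rest on Euclid's lemma in
   the ring of entire functions. It is obtained from the factoriality of the Tate
   algebras of the closed polydiscs (Weierstrass division, by induction on the
   number of variables): the gcds on an exhausting sequence of polydiscs, suitably
   normalized, converge to an entire common divisor. *)
From HB Require Import structures.
From mathcomp Require Import all_boot all_order all_algebra.
From mathcomp.multinomials Require Import mpoly.
Require Import Defs.
From mathcomp Require Import boolp classical_sets functions reals exp.
From mathcomp Require Import ring lra.

Set Implicit Arguments.
Unset Strict Implicit.
Unset Printing Implicit Defensive.

Import Order.TTheory GRing.Theory Num.Theory.
Local Open Scope classical_set_scope.
Local Open Scope ring_scope.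

(** An entire function may have infinitely many prime factors, so the ring of entire functions need
    not be factorial and Euclid's lemma has no direct proof there. On a closed polydisc the degree
    of the leading monomial bounds the number of factors. The radii are absolute values [v rho] of
    elements of the field, so that a variable divided by [rho] has norm 1, as Weierstrass division
    requires. Algebraic closedness supplies points with coordinates of absolute value 1 at which a
    polynomial attains its Gauss norm; they give the shears that make a series distinguished. If the
    absolute value is trivial, no sequence of such polydiscs exhausts the space; but then entire
    functions are polynomials, and the polydisc of radius 1 is enough. The identities behind d_j | W
    have integer coefficients and hold in every characteristic. The characteristic matters only for
    the existence of j: if all the Wronskians vanish, so do all the partial derivatives of f0 and
    f1, which are then constants or p-th powers. *)

(** * Power series and Gauss norms *)

(* A copy of the function type, which already carries pointwise operations. *)
Definition series (F : fieldType) (m : nat) := 'X_{1..m} -> F.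

HB.instance Definition _ F m := GRing.Zmodule.copy (series F m) ('X_{1..m} -> F).

Section SeriesRing.
Variables (F : fieldType) (m : nat).

Lemma series_const1_neq0 : (series_const m (1 : F) : series F m) != 0.
Proof.
apply/eqP => /(congr1 (fun f => f 0%MM)).
by rewrite /series_const eqxx => /eqP; rewrite oner_eq0.
Qed.

HB.instance Definition _ := GRing.Zmodule_isComNzRing.Build (series F m)
  (@cauchyA F m) (@cauchyC F m) (@cauchy1l F m) (@cauchyDl F m)
  series_const1_neq0.

Definition trunc d (x : series F m) : {mpoly F[m]} :=
  \sum_(k : 'X_{1..m < d}) x k *: 'X_[k].

Lemma mcoeff_trunc d x g : (trunc d x)@_g = if (mdeg g < d)%N then x g else 0.
Proof.
rewrite /trunc raddf_sum; case: ifP => gd /=.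
  rewrite (bigD1 (BMultinom gd))//= mcoeffZ mcoeffX eqxx mulr1 big1 ?addr0//.
  move=> k kg; rewrite mcoeffZ mcoeffX; case: eqP => [e|]; rewrite ?mulr0//.
  by case/eqP: kg; apply: val_inj.
rewrite big1// => k _; rewrite mcoeffZ mcoeffX; case: eqP => [e|]; rewrite ?mulr0//.
by rewrite -e bmdeg in gd.
Qed.

(** Through this lemma, identities between series are checked on polynomials, one coefficient at a
    time. *)
Lemma seriesM_trunc d (x y : series F m) g : (mdeg g < d)%N ->
  (x * y) g = (trunc d x * trunc d y)@_g.
Proof.
move=> gd; rewrite mcoeffM; apply: eq_bigr => -[k1 k2] /= _.
by rewrite !mcoeff_trunc !(leq_trans (bmdeg _))//.
Qed.

Lemma series_constM c (x : series F m) g :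
  ((series_const m c : series F m) * x) g = c * x g.
Proof.
rewrite (seriesM_trunc _ _ (ltnSn (mdeg g))).
have -> : trunc (mdeg g).+1 (series_const m c) = c%:MP_[m].
  apply/mpolyP => h; rewrite mcoeff_trunc mcoeffC /series_const.
  case: (h =P 0%MM) => [->|_]; last by rewrite mulr0; case: ifP.
  by rewrite mdeg0 mulr1.
by rewrite mcoeffCM mcoeff_trunc ltnSn.
Qed.

Lemma series_constMM c d :
  (series_const m (c * d) : series F m) = (series_const m c : series F m) * series_const m d.
Proof.
apply/funext => g; rewrite series_constM /series_const.
by case: eqP => _; rewrite ?mulr0.
Qed.

End SeriesRing.

Section AbsvalFacts.
Variables (R : realType) (F : fieldType) (v : nonarch_absval R F).

Lemma absval_gt0 x : (0 < v x) = (x != 0).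
Proof.
rewrite lt0r absval_ge0 andbT; have [->|x0] := eqVneq x 0.
  by rewrite absval0 eqxx.
by apply/eqP => /absval_eq0/eqP; rewrite (negbTE x0).
Qed.

Lemma absvalX x n : v (x ^+ n) = v x ^+ n.
Proof. by elim: n => [|n IH]; rewrite ?expr0 ?absval1// !exprS absvalM IH. Qed.

Lemma absvalV x : v x^-1 = (v x)^-1.
Proof.
have [->|x0] := eqVneq x 0; first by rewrite invr0 absval0 invr0.
have vx0 : v x != 0 by rewrite gt_eqF// absval_gt0.
by apply: (mulfI vx0); rewrite -absvalM !divff// absval1.
Qed.

Lemma absvalB x y : v (x - y) <= Num.max (v x) (v y).
Proof. by rewrite -(absvalN v y) absvalD. Qed.

Lemma absval_sum_le (I : Type) (s : seq I) (P : pred I) (a : I -> F) (M : R) :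
  0 <= M -> (forall i, P i -> v (a i) <= M) -> v (\sum_(i <- s | P i) a i) <= M.
Proof.
move=> M0 aM; apply: (big_ind (fun x => v x <= M)) => //; first by rewrite absval0.
by move=> x y xM yM; rewrite (le_trans (absvalD _ _ _))// ge_max xM.
Qed.

Lemma absval_sum_lt (I : Type) (s : seq I) (P : pred I) (a : I -> F) (M : R) :
  0 < M -> (forall i, P i -> v (a i) < M) -> v (\sum_(i <- s | P i) a i) < M.
Proof.
move=> M0 aM; apply: (big_ind (fun x => v x < M)) => //; first by rewrite absval0.
by move=> x y xM yM; rewrite (le_lt_trans (absvalD _ _ _))// gt_max xM.
Qed.

Lemma absvalD_eq x y : v y < v x -> v (x + y) = v x.
Proof.
move=> yx; apply/le_anti/andP; split.
  by rewrite (le_trans (absvalD _ _ _))// ge_max lexx ltW.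
rewrite leNgt; apply/negP => xyx; suff : v x < v x by rewrite ltxx.
by rewrite -{1}(addrK y x) (le_lt_trans (absvalB _ _))// gt_max xyx.
Qed.

End AbsvalFacts.

Section GaussNorm.
Variables (R : realType) (F : fieldType) (v : nonarch_absval R F) (m : nat).
Implicit Types (x y : series F m) (g : 'X_{1..m}) (r : R).

Definition weight r x g := v (x g) * r ^+ mdeg g.

Definition null_at r x := forall e, 0 < e ->
  exists N, forall g, (N <= mdeg g)%N -> weight r x g < e.

Definition gauss r x : R := sup [set weight r x g | g in [set: 'X_{1..m}]].

(* The last index, for the graded lexicographic order, at which the Gauss norm is
   attained. *)
Definition is_lead r x g := [/\ 0 < weight r x g,
  forall h, weight r x h <= weight r x g &
  forall h, (g < h)%O -> weight r x h < weight r x g].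

Lemma weight_ge0 r x g : 0 <= r -> 0 <= weight r x g.
Proof. by move=> r0; rewrite mulr_ge0 ?absval_ge0 ?exprn_ge0. Qed.

Lemma weight_gt0 r x g : 0 < r -> (0 < weight r x g) = (x g != 0).
Proof. by move=> r0; rewrite pmulr_lgt0 ?exprn_gt0// absval_gt0. Qed.

Lemma weightD_le r x y g : 0 <= r ->
  weight r (x + y) g <= Num.max (weight r x g) (weight r y g).
Proof.
by move=> r0; rewrite /weight -maxr_pMl ?exprn_ge0// ler_wpM2r ?exprn_ge0// absvalD.
Qed.

Lemma weightN r x g : weight r (- x) g = weight r x g.
Proof. by rewrite /weight absvalN. Qed.

Lemma weight0 r g : weight r 0 g = 0.
Proof. by rewrite /weight absval0 mul0r. Qed.

Lemma null_at_bounded r x : 0 <= r -> null_at r x ->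
  exists2 M, 0 < M & forall g, weight r x g <= M.
Proof.
move=> r0 /(_ 1 ltr01)[N xN].
exists (1 + \sum_(k : 'X_{1..m < N}) weight r x k) => [|g].
  by rewrite ltr_pwDl// sumr_ge0// => k _; rewrite weight_ge0.
have [gN|/xN/ltW gN] := ltnP (mdeg g) N; last first.
  by rewrite (le_trans gN)// lerDl sumr_ge0// => k _; rewrite weight_ge0.
rewrite (bigD1 (BMultinom gN))//= addrCA lerDl addr_ge0// sumr_ge0// => k _.
by rewrite weight_ge0.
Qed.

Lemma null_atD r x y : 0 <= r -> null_at r x -> null_at r y -> null_at r (x + y).
Proof.
move=> r0 nx ny e e0; have [N xN] := nx e e0; have [N' yN] := ny e e0.
exists (maxn N N') => g; rewrite geq_max => /andP[gN gN'].
by rewrite (le_lt_trans (weightD_le _ _ _ r0))// gt_max xN ?yN.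
Qed.

Lemma null_atN r x : null_at r x -> null_at r (- x).
Proof. by move=> nx e /nx[N xN]; exists N => g /xN; rewrite weightN. Qed.

Lemma null_at0 r : null_at r 0.
Proof. by move=> e e0; exists 0%N => g _; rewrite weight0. Qed.

Lemma weightM_lt r x y g e : 0 <= r -> 0 < e ->
  (forall h k, g = (h + k)%MM -> weight r x h * weight r y k < e) ->
  weight r (x * y) g < e.
Proof.
move=> r0 e0 xy; rewrite /weight.
have [->|rg0] := eqVneq (r ^+ mdeg g) 0; first by rewrite mulr0.
have rg : 0 < r ^+ mdeg g by rewrite lt0r rg0 exprn_ge0.
rewrite -ltr_pdivlMr//; apply: absval_sum_lt => [|-[h k]/= /eqP gE].
  by rewrite divr_gt0.
have rE : r ^+ mdeg g = r ^+ mdeg h * r ^+ mdeg k by rewrite -exprD -mdegD -gE.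
by rewrite ltr_pdivlMr// absvalM rE mulrACA; exact: xy.
Qed.

Lemma weightM_le r x y g e : 0 <= r -> 0 <= e ->
  (forall h k, g = (h + k)%MM -> weight r x h * weight r y k <= e) ->
  weight r (x * y) g <= e.
Proof.
move=> r0 e0 xy; apply/ler_addgt0Pr => d d0; apply/ltW/weightM_lt => //.
  by rewrite ltr_wpDl.
by move=> h k gE; rewrite (le_lt_trans (xy _ _ gE))// ltrDl.
Qed.

Lemma null_atM r x y : 0 <= r -> null_at r x -> null_at r y -> null_at r (x * y).
Proof.
move=> r0 nx ny e e0.
have [Mx Mx0 xM] := null_at_bounded r0 nx.
have [My My0 yM] := null_at_bounded r0 ny.
have [Nx xN] := nx _ (divr_gt0 e0 My0); have [Ny yN] := ny _ (divr_gt0 e0 Mx0).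
exists (Nx + Ny)%N => g gN; apply: weightM_lt => // h k gE.
have [hN|hN] := leqP Nx (mdeg h).
  rewrite (le_lt_trans (ler_wpM2l (weight_ge0 _ _ r0) (yM k)))//.
  by rewrite -ltr_pdivlMr// xN.
rewrite (le_lt_trans (ler_wpM2r (weight_ge0 _ _ r0) (xM h)))//.
rewrite mulrC -ltr_pdivlMr// yN// leqNgt; apply/negP => kN.
by move: gN; rewrite leqNgt gE mdegD -addSn leq_add// ltnW.
Qed.

Lemma null_at_const r c : null_at r (series_const m c).
Proof.
move=> e e0; exists 1%N => g g0; rewrite /weight /series_const.
by case: eqP g0 => [->|_ _]; rewrite ?mdeg0// absval0 mul0r.
Qed.

Lemma le_null_at r s x : 0 <= r -> r <= s -> null_at s x -> null_at r x.
Proof.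
move=> r0 rs nx e /nx[N xN]; exists N => g gN; apply: le_lt_trans (xN g gN).
by rewrite ler_wpM2l ?absval_ge0// lerXn2r ?nnegrE// (le_trans r0).
Qed.

Lemma gauss_ub r x g : 0 <= r -> null_at r x -> weight r x g <= gauss r x.
Proof.
move=> r0 /(null_at_bounded r0)[M _ xM]; apply: ub_le_sup; last by exists g.
by exists M => _ [h _ <-].
Qed.

Lemma gauss_le r x M : (forall g, weight r x g <= M) -> gauss r x <= M.
Proof.
move=> xM; apply: ge_sup; first by exists (weight r x 0%MM), 0%MM.
by move=> _ [g _ <-].
Qed.

Lemma gauss_ge0 r x : 0 <= r -> null_at r x -> 0 <= gauss r x.
Proof.
by move=> r0 nx; rewrite (le_trans (weight_ge0 x 0%MM r0))// gauss_ub.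
Qed.

Lemma gauss0 r : 0 <= r -> gauss r 0 = 0.
Proof.
move=> r0; apply/eqP; rewrite eq_le gauss_ge0//; last exact: null_at0.
by rewrite andbT gauss_le// => g; rewrite weight0.
Qed.

Lemma gauss_lead r x g : 0 <= r -> null_at r x -> is_lead r x g ->
  gauss r x = weight r x g.
Proof.
by move=> r0 nx [_ xg _]; apply/eqP; rewrite eq_le gauss_le// gauss_ub.
Qed.

Lemma is_lead_exists r x : 0 < r -> null_at r x -> x != 0 ->
  exists g, is_lead r x g.
Proof.
move=> r0 nx x0.
have [g0 xg0] : exists g, x g != 0.
  apply: contrapT => xz; case/eqP: x0; apply/funext => g.
  by apply/eqP/negPn/negP => xg; apply: xz; exists g.
have [|N xN] := nx (weight r x g0); first by rewrite weight_gt0.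
have g0N : (mdeg g0 < N.+1)%N.
  by rewrite ltnS leqNgt; apply/negP => /ltnW/xN; rewrite ltxx.
pose i0 : 'X_{1..m < N.+1} := BMultinom g0N.
pose w (i : 'X_{1..m < N.+1}) := weight r x i.
(* Beyond degree [N] all weights are below that of [g0], so the maximum is sought in a finite set:
   [i1] maximizes the weight, and [i2] is the last monomial with that weight. *)
have [i1 _ max1] := @arg_maxP _ _ _ i0 xpredT w isT.
have [i2 /eqP w2 max2] := @arg_maxP _ _ _ i1 (fun i => w i == w i1)
  (fun i => val i) (eqxx _).
have g0w : weight r x g0 <= w i2 by rewrite w2; exact: (max1 i0).
have wout h : (N < mdeg h)%N -> weight r x h < w i2.
  by move=> /ltnW/xN/lt_le_trans; apply.
exists (val i2); split; first by rewrite (lt_le_trans _ g0w)// weight_gt0.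
- move=> h; have [hN|/wout/ltW//] := leqP (mdeg h) N.
  by rewrite -[weight _ _ (val i2)]/(w i2) w2; apply: (max1 (BMultinom (hN : (mdeg h < N.+1)%N))).
- move=> h i2h; have [hN|/wout//] := leqP (mdeg h) N.
  pose i3 : 'X_{1..m < N.+1} := BMultinom (hN : (mdeg h < N.+1)%N).
  rewrite -[weight _ _ (val i2)]/(w i2) -[weight _ _ h]/(w i3) w2 lt_neqAle.
  have -> : w i3 <= w i1 by exact: (max1 i3).
  rewrite andbT.
  by apply/negP => /max2 /=; rewrite leNgt i2h.
Qed.

Lemma is_lead_uniq r x g h : is_lead r x g -> is_lead r x h -> g = h.
Proof.
move=> [_ xg xg'] [_ xh xh']; case: (ltgtP g h) => // [/xg'|/xh'].
  by rewrite ltNge xh.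
by rewrite ltNge xg.
Qed.

(** If g + h = k + l with (k, l) different from (g, h), then k > g or l > h, because the monomial
    order is compatible with addition. The product of the two leading terms therefore strictly
    dominates the coefficient at g + h, where the ultrametric inequality becomes an equality.
    Multiplicativity of the Gauss norm follows. *)
Lemma is_leadM r x y g h : 0 < r -> is_lead r x g -> is_lead r y h ->
  is_lead r (x * y) (g + h)%MM /\
  weight r (x * y) (g + h)%MM = weight r x g * weight r y h.
Proof.
move=> r0 [xg0 xg xg'] [yh0 yh yh']; pose e := weight r x g * weight r y h.
have e0 : 0 < e by rewrite mulr_gt0.
have r0' := ltW r0.
have prod_lt k l : (g < k)%O || (h < l)%O -> weight r x k * weight r y l < e.
  case/orP => [/xg' lt|/yh' lt].
    by rewrite (le_lt_trans (ler_wpM2l (weight_ge0 _ _ r0') (yh l)))// ltr_pM2r.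
  by rewrite (le_lt_trans (ler_wpM2r (weight_ge0 _ _ r0') (xg k)))// ltr_pM2l.
have whE : weight r (x * y) (g + h)%MM = e.
  rewrite /weight /e [(x * y) _]/(cauchy_prod x y (g + h)%MM) /cauchy_prod.
  have gd : (mdeg g < (mdeg (g + h)%MM).+1)%N by rewrite mdegD ltnS leq_addr.
  have hd : (mdeg h < (mdeg (g + h)%MM).+1)%N by rewrite mdegD ltnS leq_addl.
  rewrite (bigD1 (BMultinom gd, BMultinom hd))//=.
  rewrite [X in _ * X](_ : _ = r ^+ mdeg g * r ^+ mdeg h); last by rewrite mdegD exprD.
  rewrite absvalD_eq ?absvalM 1?mulrACA//.
  have rgh : 0 < r ^+ mdeg g * r ^+ mdeg h by rewrite mulr_gt0 ?exprn_gt0.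
  apply: (@lt_le_trans _ _ (e / (r ^+ mdeg g * r ^+ mdeg h))); last first.
    by rewrite ler_pdivrMr// /e /weight mulrACA.
  apply: absval_sum_lt; first by rewrite divr_gt0.
  case=> -[k kd] [l ld] /= /andP[/eqP ghE neq]; rewrite ltr_pdivlMr//.
  have rE : r ^+ mdeg g * r ^+ mdeg h = r ^+ mdeg k * r ^+ mdeg l.
    by rewrite -!exprD -!mdegD ghE.
  rewrite absvalM rE mulrACA; apply: prod_lt.
  case: (ltgtP g k) => //= [kg|gk].
    rewrite ltNge; apply/negP => lh.
    have := ltmc_le_add kg lh; rewrite ghE ltxx //.
  case/eqP: neq; congr pair; apply: val_inj => //=.
  by move: ghE; rewrite -gk => /addmI.
split=> //; split; rewrite ?whE//.
  move=> l; apply: weightM_le; rewrite ?(ltW e0)// => a b _.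
  by rewrite ler_pM ?weight_ge0.
move=> l ghl; apply: weightM_lt => // a b lE; apply: prod_lt.
case: (leP a g) => //= ag; rewrite ltNge; apply/negP => bh.
by move: ghl; rewrite lE ltNge lem_add.
Qed.

Lemma gaussM r x y : 0 < r -> null_at r x -> null_at r y ->
  gauss r (x * y) = gauss r x * gauss r y.
Proof.
move=> r0 nx ny; have r0' := ltW r0.
have [->|x0] := eqVneq x 0; first by rewrite mul0r !gauss0// mul0r.
have [->|y0] := eqVneq y 0; first by rewrite mulr0 !gauss0// mulr0.
have [g xg] := is_lead_exists r0 nx x0; have [h yh] := is_lead_exists r0 ny y0.
have [xy e] := is_leadM r0 xg yh.
by rewrite (gauss_lead _ _ xy)// ?e ?(gauss_lead _ _ xg) ?(gauss_lead _ _ yh)//; exact: null_atM.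
Qed.

Lemma gaussN r x : gauss r (- x) = gauss r x.
Proof.
rewrite /gauss; congr sup; apply/seteqP; split => _ [g _ <-]; exists g => //.
  by rewrite weightN.
by rewrite weightN.
Qed.

Lemma gaussD r x y : 0 <= r -> null_at r x -> null_at r y ->
  gauss r (x + y) <= Num.max (gauss r x) (gauss r y).
Proof.
move=> r0 nx ny; apply: gauss_le => g; rewrite (le_trans (weightD_le _ _ _ r0))//.
by rewrite ge_max !le_max !gauss_ub// orbT.
Qed.

Lemma gauss_eq0 r x : 0 < r -> null_at r x -> gauss r x = 0 -> x = 0.
Proof.
move=> r0 nx x0; apply/eqP/negPn/negP => /(is_lead_exists r0 nx)[g xg].
have := xg => -[+ _ _]; rewrite -gauss_lead// ?x0 ?ltxx//; exact: ltW.
Qed.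

(** The supremum is attained, so the strict inequality survives. *)
Lemma gauss_lt r x M : 0 < r -> null_at r x -> 0 < M ->
  (forall g, weight r x g < M) -> gauss r x < M.
Proof.
move=> r0 nx M0 xM; have [->|x0] := eqVneq x 0; first by rewrite gauss0// ltW.
have [g xg] := is_lead_exists r0 nx x0; rewrite (gauss_lead _ _ xg)//; exact: ltW.
Qed.

Lemma is_lead_const r c : c != 0 -> is_lead r (series_const m c) 0%MM.
Proof.
move=> c0; have w h : weight r (series_const m c) h = if h == 0%MM then v c else 0.
  rewrite /weight /series_const.
  by case: (h =P _) => [->|_]; rewrite ?mdeg0 ?mulr1// absval0 mul0r.
split; first by rewrite w eqxx absval_gt0.
  move=> h; rewrite !w eqxx; by case: ifP => _; rewrite ?lexx ?absval_ge0.
by move=> h h0; rewrite !w eqxx gt_eqF// absval_gt0.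
Qed.

End GaussNorm.

Section Limits.
Variables (R : realType) (F : fieldType) (v : nonarch_absval R F) (m : nat).
Implicit Types (x y l : series F m) (g : 'X_{1..m}) (r : R) (u : nat -> series F m).

(** By the ultrametric inequality, control of consecutive differences already makes a sequence
    Cauchy; the bound is uniform in the multi-index [g]. *)
Definition slow r u := forall e, 0 < e ->
  exists n, forall i, (n <= i)%N -> forall g, weight v r (u i.+1 - u i) g <= e.

Definition unif_lim r u l := forall e, 0 < e ->
  exists n, forall i, (n <= i)%N -> forall g, weight v r (u i - l) g <= e.

Definition coef_lim u l := forall g e, 0 < e ->
  exists n, forall i, (n <= i)%N -> v (u i g - l g) <= e.

Lemma slow_cauchy r u e n : 0 <= r -> 0 <= e ->
  (forall i, (n <= i)%N -> forall g, weight v r (u i.+1 - u i) g <= e) ->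
  forall i j, (n <= i)%N -> (i <= j)%N -> forall g, weight v r (u j - u i) g <= e.
Proof.
move=> r0 e0 un i j ni ij g; rewrite -(subnKC ij); elim: (j - i)%N => [|d IH].
  by rewrite addn0 subrr weight0.
rewrite addnS -(subrKA (u (i + d)%N)) (le_trans (weightD_le _ _ _ _ r0))//.
by rewrite ge_max IH un// (leq_trans ni)// leq_addr.
Qed.

Lemma slow_coef_lim r u : complete_absval v -> 0 < r -> slow r u ->
  exists l, coef_lim u l.
Proof.
move=> vc r0 su.
suff : forall g, exists a, forall e, 0 < e ->
    exists n, forall i, (n <= i)%N -> v (u i g - a) <= e.
  by move/choice => [l lP]; exists l.
move=> g; have [] := vc (fun i => u i g).
  move=> e e0; have rg0 : 0 < r ^+ mdeg g by rewrite exprn_gt0.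
  have e20 : 0 < e / 2 by rewrite divr_gt0.
  have [n un] := su _ (mulr_gt0 e20 rg0).
  have key i j : (n <= i)%N -> (i <= j)%N -> v (u j g - u i g) < e.
    move=> ni ij; have := slow_cauchy (ltW r0) (ltW (mulr_gt0 e20 rg0)) un ni ij g.
    by rewrite /weight ler_pM2r// => /le_lt_trans; apply; rewrite ltr_pdivrMr// mulr2n mulrDr mulr1 ltrDl.
  exists n => i j ni nj; case/orP: (leq_total i j) => [/(key _ _ ni)|/(key _ _ nj)//].
  by rewrite -absvalN opprB.
move=> a aP; exists a => e /aP[n an]; exists n => i /an/ltW//.
Qed.

Lemma slow_unif_lim r u l : 0 <= r -> slow r u -> coef_lim u l -> unif_lim r u l.
Proof.
move=> r0 su ul e e0; have [n un] := su e e0; exists n => i ni g.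
have [r00|rg0] := eqVneq (r ^+ mdeg g) 0; first by rewrite /weight r00 mulr0 ltW.
have rg : 0 < r ^+ mdeg g by rewrite lt0r rg0 exprn_ge0.
have [k uk] := ul g _ (divr_gt0 e0 rg).
(* The intermediate index depends on [g] through [k], but the bound between [u i] and that term does
   not. *)
rewrite -(subrKA (u (maxn i k))) (le_trans (weightD_le _ _ _ _ r0))// ge_max.
rewrite -weightN opprB (slow_cauchy r0 (ltW e0) un ni)//; last by rewrite leq_maxl.
by rewrite -ler_pdivlMr// uk// leq_maxr.
Qed.

Lemma unif_lim_null r u l : 0 <= r -> unif_lim r u l ->
  (exists n, forall i, (n <= i)%N -> null_at v r (u i)) -> null_at v r l.
Proof.
move=> r0 ul [k uk] e e0; have e20 : 0 < e / 2 by rewrite divr_gt0.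
have [n un] := ul _ e20.
have [N uN] := uk _ (leq_maxr n k) _ e0; exists N => g /uN gN.
rewrite -(subKr (u (maxn n k)) l) -[X in weight v r X g]addrC.
rewrite (le_lt_trans (weightD_le _ _ _ _ r0))// gt_max gN andbT weightN.
rewrite (le_lt_trans (un _ (leq_maxl n k) g))//.
by rewrite ltr_pdivrMr// mulr2n mulrDr mulr1 ltrDl.
Qed.

End Limits.

(** * Tate algebras of closed polydiscs *)

Section Tate.
Variables (R : realType) (F : fieldType) (v : nonarch_absval R F) (m : nat).

(** Series in fewer variables stay inside the ring of series in m variables, so that the induction
    on the number of variables renames nothing. *)
Definition uses_first (k : nat) (x : series F m) :=
  forall g, x g != 0 -> forall i : 'I_m, (k <= i)%N -> g i = 0%N.

Variables (k : nat) (rho : F).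

Definition tate_pred : {pred series F m} :=
  fun x => `[< null_at v (v rho) x /\ uses_first k x >].

(* The series in the first k variables converging on the closed polydisc of
   radius |rho|. *)
Record tate := Tate { tate_val :> series F m; _ : tate_pred tate_val }.

HB.instance Definition _ := [isSub for tate_val].
HB.instance Definition _ := [Choice of tate by <:].

Lemma tateP (x : tate) : null_at v (v rho) x /\ uses_first k x.
Proof. by case: x => a /= /asboolP. Qed.

Lemma uses_first1 : uses_first k 1.
Proof.
move=> g; rewrite [(1 : series F m) g]/(series_const m 1 g) /series_const.
by case: (g =P 0%MM) => [-> _ i _|_]; rewrite ?mnm0E ?eqxx.
Qed.

Lemma uses_firstM x y : uses_first k x -> uses_first k y -> uses_first k (x * y).
Proof.
move=> xk yk g xyg i ki.
have [/existsP[[h l] /=]|] := boolP [exists h : 'X_{1..m < (mdeg g).+1, (mdeg g).+1},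
    (g == (h.1 + h.2)%MM) && (x h.1 * y h.2 != 0)].
  case/andP => /eqP gE; rewrite mulf_eq0 negb_or => /andP[xh yl].
  have -> : g i = (h i + l i)%N by rewrite -mnmDE -gE.
  by rewrite (xk _ xh)// (yk _ yl).
rewrite negb_exists => /forallP xy0; case/eqP: xyg.
rewrite [LHS]big1// => h gh; apply/eqP/negPn/negP => hx.
by have := xy0 h; rewrite gh hx.
Qed.

Lemma tate_subring_closed : subring_closed tate_pred.
Proof.
have r0 := absval_ge0 v rho; split.
- by apply/asboolP; split; [exact: null_at_const|exact: uses_first1].
- move=> x y /asboolP[nx xk] /asboolP[ny yk]; apply/asboolP; split.
    by apply: null_atD => //; exact: null_atN.
  move=> g; have [xg0|xg0 _] := eqVneq (x g) 0; last exact: xk.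
  have [yg0|yg0 _] := eqVneq (y g) 0; last exact: yk.
  have -> : (x - y) g = x g - y g by [].
  rewrite xg0 yg0. by rewrite oppr0 addr0 eqxx.
- move=> x y /asboolP[nx xk] /asboolP[ny yk]; apply/asboolP; split.
    exact: null_atM.
  exact: uses_firstM.
Qed.

HB.instance Definition _ := GRing.isSubringClosed.Build (series F m) tate_pred
  tate_subring_closed.
HB.instance Definition _ := [SubChoice_isSubComNzRing of tate by <:].

Definition mk_tate x (nx : null_at v (v rho) x) (xk : uses_first k x) : tate :=
  Tate (introT (asboolP _) (conj nx xk)).

End Tate.

(** * Complete normed rings *)

(** Multiplicativity together with [rnorm_eq0] makes the ring an integral domain: every cancellation
    below comes from the norm. *)
Record ring_norm (R : realType) (A : comNzRingType) := RingNorm {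
  rnorm :> A -> R;
  rnorm_ge0 : forall x, 0 <= rnorm x;
  rnorm_eq0 : forall x, rnorm x = 0 -> x = 0;
  rnorm0 : rnorm 0 = 0;
  rnormM : forall x y, rnorm (x * y) = rnorm x * rnorm y;
  rnormD : forall x y, rnorm (x + y) <= Num.max (rnorm x) (rnorm y) }.

Definition complete_norm (R : realType) (A : comNzRingType) (N : ring_norm R A) :=
  forall u : nat -> A,
    (forall e, 0 < e -> exists n, forall i, (n <= i)%N -> N (u i.+1 - u i) <= e) ->
    exists l, forall e, 0 < e -> exists n, forall i, (n <= i)%N -> N (u i - l) <= e.

Section RingNormTheory.
Variables (R : realType) (A : comNzRingType) (N : ring_norm R A).

Lemma rnorm_gt0 x : (0 < N x) = (x != 0).
Proof.
rewrite lt0r rnorm_ge0 andbT; have [->|x0] := eqVneq x 0; first by rewrite rnorm0 eqxx.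
by apply/eqP => /rnorm_eq0/eqP; rewrite (negbTE x0).
Qed.

Lemma rnorm1 : N 1 = 1.
Proof.
have N1 : N 1 != 0 by rewrite gt_eqF// rnorm_gt0 oner_neq0.
by apply: (mulfI N1); rewrite -rnormM !mulr1.
Qed.

Lemma rnormN x : N (- x) = N x.
Proof.
rewrite -mulN1r rnormM; suff -> : N (-1) = 1 by rewrite mul1r.
by apply/eqP; rewrite -(sqrp_eq1 (rnorm_ge0 N _)) expr2 -rnormM mulrNN mulr1 rnorm1.
Qed.

Lemma rnormB x y : N (x - y) <= Num.max (N x) (N y).
Proof. by rewrite -(rnormN y) rnormD. Qed.

Lemma rnormX x n : N (x ^+ n) = N x ^+ n.
Proof. by elim: n => [|n IH]; rewrite ?expr0 ?rnorm1// !exprS rnormM IH. Qed.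

Lemma rnorm_mul_eq0 (x y : A) : x * y = 0 -> x = 0 \/ y = 0.
Proof.
move/(congr1 N); rewrite rnormM rnorm0 => /eqP; rewrite mulf_eq0.
by case/orP => /eqP/rnorm_eq0; [left|right].
Qed.

Lemma rnorm_mulI (x y z : A) : x != 0 -> x * y = x * z -> y = z.
Proof.
move=> x0 xyz; have [/eqP|/eqP] : x = 0 \/ y - z = 0.
- by apply: rnorm_mul_eq0; rewrite mulrBr xyz subrr.
- by rewrite (negbTE x0).
- by rewrite subr_eq0 => /eqP.
Qed.

Lemma rnorm_small_eq0 x : (forall e, 0 < e -> N x <= e) -> x = 0.
Proof.
move=> xe; apply: (@rnorm_eq0 _ _ N); apply/le_anti/andP; split; last exact: rnorm_ge0.
by apply/ler_addgt0Pr => e e0; rewrite add0r xe.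
Qed.

Lemma rnorm_sum_le (I : Type) (s : seq I) (P : pred I) (a : I -> A) (M : R) :
  0 <= M -> (forall i, P i -> N (a i) <= M) -> N (\sum_(i <- s | P i) a i) <= M.
Proof.
move=> M0 aM; apply: (big_ind (fun x => N x <= M)) => //; first by rewrite rnorm0.
by move=> x y xM yM; rewrite (le_trans (rnormD _ _ _))// ge_max xM.
Qed.

Lemma expr_small (c : R) e : 0 <= c -> c < 1 -> 0 < e ->
  exists n, forall i, (n <= i)%N -> c ^+ i <= e.
Proof.
move=> c0 c1 e0; pose d := c^-1 - 1.
have [->|cn0] := eqVneq c 0.
  by exists 1%N => -[//|i] _; rewrite expr0n/= ltW.
have cp : 0 < c by rewrite lt0r cn0.
have d0 : 0 < d by rewrite subr_gt0 invf_gt1.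
have bern n : 1 + d *+ n <= c^-1 ^+ n.
  elim: n => [|n IH]; first by rewrite mulr0n addr0 expr0.
  have cE : c^-1 = 1 + d by rewrite /d addrC subrK.
  rewrite exprS (le_trans _ (ler_wpM2l _ IH)) ?invr_ge0// cE mulrSr.
  have : 0 <= d * d *+ n by rewrite mulrn_wge0// mulr_ge0// ltW.
  have -> : (1 + d) * (1 + d *+ n) = 1 + (d *+ n + d) + d * d *+ n.
    by rewrite mulrDl mul1r mulrDr mulr1 mulrnAr !addrA.
  by rewrite lerDl.
have [n nP] : exists n, e^-1 <= d *+ n.
  exists (Num.bound (e^-1 / d)); rewrite -mulr_natr mulrC -ler_pdivrMr//.
  by rewrite ltW// archi_boundP// divr_ge0// ?invr_ge0 ltW.
exists n => i ni; rewrite (le_trans (ler_wiXn2l c0 (ltW c1) ni))//.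
rewrite -[leRHS]invrK -[leLHS]invrK lef_pV2 ?posrE ?invr_gt0 ?exprn_gt0//.
by rewrite -exprVn (le_trans nP)// (le_trans _ (bern n))// lerDr.
Qed.

(* [x = 1 - (1 - x)] is inverted by the geometric series. *)
Lemma near1_unit x : complete_norm N -> N (x - 1) < 1 -> exists y, x * y = 1.
Proof.
move=> Nc x1; pose c := 1 - x; pose u n := \sum_(i < n) c ^+ i.
have Nc1 : N c < 1 by rewrite -rnormN opprB.
have [|y yP] := Nc u.
  move=> e e0; have [n nP] := expr_small (rnorm_ge0 N c) Nc1 e0.
  exists n => i ni; rewrite /u big_ord_recr/= addrAC subrr add0r rnormX; exact: nP.
exists y; apply/eqP; rewrite -subr_eq0; apply/eqP/rnorm_small_eq0 => e e0.
have [n nP] := expr_small (rnorm_ge0 N c) Nc1 e0; have [k kP] := yP e e0.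
pose i := maxn n k.
have xu : x * u i = 1 - c ^+ i.
  have -> : x = 1 - c by rewrite /c subKr.
  rewrite -[1 in RHS](expr1n _ i) subrXX; congr (_ * _).
  by apply: eq_bigr => j _; rewrite expr1n mul1r.
have -> : x * y - 1 = x * (y - u i) - c ^+ i by rewrite mulrBr xu; ring.
have Nx : N x <= 1.
  by rewrite -[x](subrK 1) (le_trans (rnormD _ _ _))// ge_max rnorm1 lexx (ltW x1).
rewrite (le_trans (rnormB _ _))// ge_max rnormX nP ?leq_maxl// andbT rnormM.
rewrite -[e]mul1r ler_pM ?rnorm_ge0// -rnormN opprB kP// leq_maxr//.
Qed.

End RingNormTheory.

Section TateNorm.
Variables (R : realType) (F : fieldType) (v : nonarch_absval R F) (m : nat).
Variables (k : nat) (rho : F) (rho0 : rho != 0).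

Let r := v rho.
Let r_gt0 : 0 < r. Proof. by rewrite absval_gt0. Qed.
Let r_ge0 := ltW r_gt0.
Let tnull (x : tate v m k rho) : null_at v r x := (tateP x).1.

Definition tate_norm_fun (x : tate v m k rho) := gauss v r x.

Lemma tate_norm_ge0 x : 0 <= tate_norm_fun x.
Proof. exact: (gauss_ge0 r_ge0 (tnull x)). Qed.

Lemma tate_norm_eq0 x : tate_norm_fun x = 0 -> x = 0.
Proof. by move/(gauss_eq0 r_gt0 (tnull x)) => x0; apply: val_inj. Qed.

Lemma tate_norm0 : tate_norm_fun 0 = 0.
Proof. exact: (gauss0 _ _ r_ge0). Qed.

Lemma tate_normM x y : tate_norm_fun (x * y) = tate_norm_fun x * tate_norm_fun y.
Proof. exact: (gaussM r_gt0 (tnull x) (tnull y)). Qed.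

Lemma tate_normD x y :
  tate_norm_fun (x + y) <= Num.max (tate_norm_fun x) (tate_norm_fun y).
Proof. exact: (gaussD r_ge0 (tnull x) (tnull y)). Qed.

Definition tate_norm := RingNorm tate_norm_ge0 tate_norm_eq0 tate_norm0
  tate_normM tate_normD.

Lemma tate_normE x : tate_norm x = gauss v r x. Proof. by []. Qed.

Lemma tate_norm_complete : complete_absval v -> complete_norm tate_norm.
Proof.
move=> vc u uc; pose w i := val (u i).
have sw : slow v r w.
  move=> e /uc[n un]; exists n => i /un uie g.
  by apply: le_trans uie; exact: (gauss_ub g r_ge0 (tnull (u i.+1 - u i))).
have [l wl] := slow_coef_lim vc r_gt0 sw.
have ul := slow_unif_lim r_ge0 sw wl.
have nl : null_at v r l by apply: (unif_lim_null r_ge0 ul); exists 0%N => i _; exact: tnull.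
have lk : uses_first k l.
  move=> g lg i ki; apply/eqP/negPn/negP => gi.
  have ug n : w n g = 0.
    apply/eqP/negPn/negP => wg; case/eqP: gi; exact: ((tateP (u n)).2 g wg i ki).
  have vl : 0 < v (l g) by rewrite absval_gt0.
  have vl2 : 0 < v (l g) / 2 by rewrite divr_gt0.
  have [n /(_ _ (leqnn n))] := wl g _ vl2.
  rewrite ug sub0r absvalN => vl3; lra.
exists (mk_tate nl lk) => e /ul[n un]; exists n => i ni.
exact: gauss_le (un i ni).
Qed.

(** The constant term strictly dominates all the others; dividing by it brings [x] within distance
    less than 1 of 1, where the geometric series converges. *)
Lemma tate_unit (x : tate v m k rho) : complete_absval v -> is_lead v r x 0%MM ->
  exists y, x * y = 1.
Proof.
move=> vc [x0 xle xlt].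
have nc : null_at v r (series_const m (val x 0%MM)^-1) by exact: null_at_const.
have kc : uses_first k (series_const m (val x 0%MM)^-1 : series F m).
  by move=> g; rewrite /series_const; case: (g =P 0%MM) => [-> _ i _|_]; rewrite ?mnm0E ?eqxx.
pose c := mk_tate nc kc.
have cx g : val (c * x) g = (val x 0%MM)^-1 * val x g.
  have -> : val (c * x) g = ((val c : series F m) * val x) g by [].
  exact: series_constM.
have xn0 : val x 0%MM != 0 by rewrite -(weight_gt0 v _ _ r_gt0).
have [|y] := @near1_unit _ _ tate_norm (c * x) (tate_norm_complete vc).
  apply: (gauss_lt r_gt0 (tnull (c * x - 1)) ltr01) => g; have E : val (c * x - 1) g = val (c * x) g - (if g == 0%MM then 1 else 0) by [].
  rewrite /weight E cx; have [->|g0] := eqVneq g 0%MM.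
    by rewrite mulVf// subrr absval0 mul0r.
  rewrite subr0 absvalM absvalV -mulrA ltr_pdivrMl ?absval_gt0// mulr1.
  have := xlt g; rewrite /weight mdeg0 mulr1; apply.
  by rewrite lt_neqAle eq_sym g0 le0m.
by exists (c * y); rewrite mulrA [x * c]mulrC.
Qed.

End TateNorm.

(** * Weierstrass division *)

Section Factorial.
Variable A : comNzRingType.
Implicit Types d x y z : A.

Definition invertible x := exists y, x * y = 1.

Definition irreducible x := [/\ x != 0, ~ invertible x &
  forall y z, x = y * z -> invertible y \/ invertible z].

Definition prime_elt x := [/\ x != 0, ~ invertible x &
  forall y z, divides x (y * z) -> divides x y \/ divides x z].

(** Asking for prime rather than irreducible factors builds in the uniqueness of the
    factorization. *)
Definition factorial := forall x, x != 0 -> exists u (s : seq A),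
  [/\ invertible u, {in s, forall p, prime_elt p} & x = u * \prod_(p <- s) p].

Lemma divides_mull d x y : divides d x -> divides d (y * x).
Proof. by case=> z ->; exists (y * z); rewrite mulrCA. Qed.

Lemma divides_mulr d x y : divides d x -> divides d (x * y).
Proof. by case=> z ->; exists (z * y); rewrite mulrA. Qed.

Lemma dividesD d x y : divides d x -> divides d y -> divides d (x + y).
Proof. by case=> z -> [t ->]; exists (z + t); rewrite mulrDr. Qed.

Lemma dividesN d x : divides d x -> divides d (- x).
Proof. by case=> z ->; exists (- z); rewrite mulrN. Qed.

Lemma dividesB d x y : divides d x -> divides d y -> divides d (x - y).
Proof. by move=> dx dy; apply: dividesD => //; exact: dividesN. Qed.

Lemma divides_refl d : divides d d.
Proof. by exists 1; rewrite mulr1. Qed.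

Lemma divides0 d : divides d 0.
Proof. by exists 0; rewrite mulr0. Qed.

Lemma divides_sum d (I : Type) (s : seq I) (P : pred I) (a : I -> A) :
  (forall i, P i -> divides d (a i)) -> divides d (\sum_(i <- s | P i) a i).
Proof.
by move=> da; apply: (big_ind (@divides A d)) => //; [exact: divides0|exact: dividesD].
Qed.

End Factorial.

Section Transfer.
Variables (A : comNzRingType) (s s' : A -> A).
Hypotheses (sK : cancel s s') (s'K : cancel s' s) (s0 : s 0 = 0).
Hypotheses (s1 : s 1 = 1) (sM : {morph s : x y / x * y}).

Let s'M : {morph s' : x y / x * y}.
Proof. by move=> x y; rewrite -{1}[x]s'K -{1}[y]s'K -sM sK. Qed.

Let invertible_s x : invertible x -> invertible (s x).
Proof. by case=> y xy; exists (s y); rewrite -sM xy. Qed.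

Let invertible_s' x : invertible (s x) -> invertible x.
Proof. by case=> y xy; exists (s' y); rewrite -[x]sK -s'M xy -s1 sK. Qed.

(** Irreducibility is pushed forward along [s] and primality is pulled back: a change of variables
    turns an irreducible series into one to which Weierstrass theory applies, and its primality is
    then brought back. *)
Lemma irreducible_transfer x : irreducible x -> irreducible (s x).
Proof.
move=> [x0 nx xirr]; split.
- by apply: contra_neq x0 => sx0; rewrite -[x]sK sx0 -s0 sK.
- by move/invertible_s'.
- move=> y z E; have /xirr : x = s' y * s' z by rewrite -s'M -E sK.
  by case=> /invertible_s; rewrite s'K; [left|right].
Qed.

Lemma prime_transfer x : prime_elt (s x) -> prime_elt x.
Proof.
move=> [sx0 nsx sxp]; split.
- by apply: contra_neq sx0 => ->.
- by move/invertible_s.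
- move=> y z [t E]; have /sxp : divides (s x) (s y * s z).
    by exists (s t); rewrite -!sM E.
  by case=> -[w wE]; [left|right]; exists (s' w); rewrite -[x]sK -s'M -wE sK.
Qed.

End Transfer.

Section Associates.
Variables (A : comNzRingType) (u u' : A).
Hypothesis uu' : u * u' = 1.

Let invertible_assoc (x : A) : invertible (u * x) -> invertible x.
Proof. by case=> y xy; exists (u * y); rewrite mulrCA mulrA. Qed.

Let assocK (x : A) : x = u' * (u * x).
Proof. by rewrite mulrA [u' * u]mulrC uu' mul1r. Qed.

Lemma irreducible_assoc (x : A) : irreducible x -> irreducible (u * x).
Proof.
move=> [x0 nx xirr]; split.
- by apply: contra_neq x0 => ux0; rewrite [x]assocK ux0 mulr0.
- by move/invertible_assoc.
- move=> y z E; have /xirr : x = (u' * y) * z by rewrite -mulrA -E -assocK.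
  case=> [[t tE]|]; last by right.
  by left; exists (u' * t); rewrite mulrCA mulrA.
Qed.

Lemma prime_assoc (x : A) : prime_elt (u * x) -> prime_elt x.
Proof.
move=> [x0 nx xp]; split.
- by apply: contra_neq x0 => ->; rewrite mulr0.
- by case=> y xy; apply: nx; exists (u' * y); rewrite mulrACA uu' xy mulr1.
- move=> y z [t E]; have /xp : divides (u * x) (y * z).
    by exists (u' * t); rewrite mulrACA uu' mul1r.
  by case=> -[w wE]; [left|right]; exists (u * w); rewrite wE mulrCA mulrA.
Qed.

End Associates.

(** * Gauss's lemma on contents of polynomials *)

Section Content.
Variables (R : realType) (A : comNzRingType) (N : ring_norm R A).
Implicit Types (c : A) (p q r : {poly A}).

Lemma scale_poly_eq0 c p : c != 0 -> c *: p = 0 -> p = 0.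
Proof.
move=> c0 /polyP cp; apply/polyP => i; have := cp i.
rewrite coefZ coef0 => /(rnorm_mul_eq0 N)[/eqP|//]; by rewrite (negbTE c0).
Qed.

Lemma scale_polyI c p q : c != 0 -> c *: p = c *: q -> p = q.
Proof.
move=> c0 /eqP; rewrite -subr_eq0 -scalerBr => /eqP/(scale_poly_eq0 c0)/eqP.
by rewrite subr_eq0 => /eqP.
Qed.

Lemma divides_coefs c p : (forall i, divides c p`_i) -> exists q, p = c *: q.
Proof.
move/choice => [f fP]; exists (\poly_(i < size p) f i); apply/polyP => i.
rewrite coefZ coef_poly; case: ltnP => [_|pi]; first exact: fP.
by rewrite mulr0 nth_default.
Qed.

(** Otherwise let i and j be the first degrees in which [c] fails to divide the coefficient of [p],
    resp. of [q]. In degree i + j every term of the product but p_i q_j is a multiple of [c], hence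
    so is p_i q_j, against the primality of [c]. *)
Lemma prime_content c p q r : prime_elt c -> c *: r = p * q ->
  (exists p', p = c *: p') \/ (exists q', q = c *: q').
Proof.
move=> [c0 _ cpr] E.
have [/divides_coefs|np] := pselect (forall i, divides c p`_i); first by left.
have [/divides_coefs|nq] := pselect (forall i, divides c q`_i); first by right.
have first_coef (t : {poly A}) : ~ (forall i, divides c t`_i) ->
    exists i, ~ divides c t`_i /\ forall j, (j < i)%N -> divides c t`_j.
  move=> nt; have ex : exists i, `[< ~ divides c t`_i >].
    by apply: contrapT => h; apply: nt => i; apply: contrapT => hi; apply: h; exists i; apply/asboolP.
  have [i /asboolP ni mini] := ex_minnP ex; exists i; split => // j ji.
  by apply: contrapT => /asboolP/mini; rewrite leqNgt ji.
have [i [ni mini]] := first_coef p np; have [j [nj minj]] := first_coef q nq.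
suff : divides c (p`_i * q`_j) by case/cpr.
have := congr1 (fun t : {poly A} => t`_(i + j)) E.
rewrite coefZ coefM; have ile : (i < (i + j).+1)%N by rewrite ltnS leq_addr.
rewrite (bigD1 (Ordinal ile))//= addKn => S.
have -> : p`_i * q`_j = c * r`_(i + j) -
    \sum_(k < (i + j).+1 | k != Ordinal ile) p`_k * q`_(i + j - k) by rewrite S addrK.
apply: dividesB; first by apply: divides_mulr; exact: divides_refl.
apply: divides_sum => k /eqP ki; case: (ltngtP k i) => [/mini kc|ik|e].
- exact: divides_mulr.
- apply: divides_mull; apply: minj.
  have kij : (k <= i + j)%N by rewrite -ltnS ltn_ord.
  by rewrite -(ltn_add2r k) subnK// [(j + k)%N]addnC ltn_add2r.
- by case: ki; apply: val_inj.
Qed.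

(** The prime factors of [c] are moved one at a time into the content of [p] or of [q] by
    [prime_content]; the last equation follows from the other three by cancelling [c]. *)
Lemma factorial_content c p q r : factorial A -> c != 0 -> c *: r = p * q ->
  exists c1 c2 p' q', [/\ c = c1 * c2, p = c1 *: p', q = c2 *: q' & r = p' * q'].
Proof.
move=> fA c0 E.
suff [c1 [c2 [p' [q' [e1 e2 e3]]]]] : exists c1 c2 p' q',
    [/\ c = c1 * c2, p = c1 *: p' & q = c2 *: q'].
  exists c1, c2, p', q'; split => //; apply: (scale_polyI c0).
  by rewrite E e2 e3 -scalerAl -scalerAr scalerA -e1.
have [u [s [[u' uu'] + cE]]] := fA c c0.
elim: s c p q c0 cE E => [|a s IH] c p q c0 cE E sp.
  exists u, 1, (u' *: p), q; rewrite cE big_nil mulr1 scalerA uu' !scale1r.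
  by split.
have ap : prime_elt a by apply: sp; rewrite mem_head.
pose d := u * \prod_(b <- s) b.
have cad : c = a * d by rewrite cE big_cons mulrCA.
have a0 : a != 0 by case: ap.
have d0 : d != 0 by apply: contra_neq c0; rewrite cad => ->; rewrite mulr0.
have sp' : {in s, forall b, prime_elt b} by move=> b bs; apply: sp; rewrite inE bs orbT.
rewrite cad -scalerA in E.
have [[p1 pE]|[q1 qE]] := prime_content ap E.
  have E' : d *: r = p1 * q by apply: (scale_polyI a0); rewrite E pE scalerAl.
  have [c1 [c2 [p' [q' [e1 e2 e3]]]]] := IH d p1 q d0 erefl E' sp'.
  by exists (a * c1), c2, p', q'; rewrite cad pE e1 e2 scalerA mulrA; split.
have E' : d *: r = p * q1 by apply: (scale_polyI a0); rewrite E qE scalerAr.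
have [c1 [c2 [p' [q' [e1 e2 e3]]]]] := IH d p q1 d0 erefl E' sp'.
by exists c1, (a * c2), p', q'; rewrite cad qE e1 e3 scalerA mulrCA; split.
Qed.

End Content.

(* B is the ring of series in zeta over A, and cf i x is the coefficient of
   zeta ^+ i in x. *)
Section Weierstrass.
Import Pdiv.CommonRing Pdiv.ComRing.
Variables (R : realType) (A B : comNzRingType).
Variables (NA : ring_norm R A) (NB : ring_norm R B).
Variables (iota : {rmorphism A -> B}) (zeta : B) (cf : nat -> B -> A).
Hypothesis cfB : forall i x y, cf i (x - y) = cf i x - cf i y.
Hypothesis cf_monom : forall i j a,
  cf i (iota a * zeta ^+ j) = if i == j then a else 0.
Hypothesis cf_le : forall i x, NA (cf i x) <= NB x.
Hypothesis cf_max : forall x, exists i, NB x = NA (cf i x).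
Hypothesis cf_null : forall x e, 0 < e ->
  exists n, forall i, (n <= i)%N -> NA (cf i x) <= e.
Hypothesis NB_complete : complete_norm NB.

Let emb (p : {poly A}) : B := (map_poly iota p).[zeta].

Let embD p q : emb (p + q) = emb p + emb q.
Proof. by rewrite /emb rmorphD hornerD. Qed.

Let embB p q : emb (p - q) = emb p - emb q.
Proof. by rewrite /emb rmorphB hornerD hornerN. Qed.

Let embM p q : emb (p * q) = emb p * emb q.
Proof. by rewrite /emb rmorphM hornerM. Qed.

Let embZ a p : emb (a *: p) = iota a * emb p.
Proof. by rewrite /emb map_polyZ hornerZ. Qed.

Let emb0 : emb 0 = 0. Proof. by rewrite /emb rmorph0 horner0. Qed.

Let embX j : emb 'X^j = zeta ^+ j.
Proof. by rewrite /emb map_polyXn hornerXn. Qed.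

Let cf0 i : cf i 0 = 0.
Proof. by have := cfB i 0 0; rewrite !subrr. Qed.

Let cfD i x y : cf i (x + y) = cf i x + cf i y.
Proof.
have cfN : cf i (0 - y) = - cf i y by rewrite cfB cf0 sub0r.
by have := cfB i x (0 - y); rewrite cfN sub0r !opprK.
Qed.

Let embE p : emb p = \sum_(j < size p) iota p`_j * zeta ^+ j.
Proof.
rewrite /emb (horner_coef_wide _ (size_poly _ _)).
by apply: eq_bigr => j _; rewrite coef_map.
Qed.

Let cf_emb i p : cf i (emb p) = p`_i.
Proof.
rewrite embE (big_morph (cf i) (cfD i) (cf0 i)).
under eq_bigr do rewrite cf_monom.
have [pi|pi] := ltnP i (size p).
  rewrite (bigD1 (Ordinal pi))//= eqxx big1 ?addr0// => j ji.
  by rewrite ifF//; apply: contra_neqF ji => /eqP e; apply: val_inj.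
by rewrite big1 ?nth_default// => j _; rewrite gtn_eqF// (leq_trans _ pi).
Qed.

Let cf_ext x y : (forall i, cf i x = cf i y) -> x = y.
Proof.
move=> xy; apply/eqP; rewrite -subr_eq0; apply/eqP/(@rnorm_eq0 _ _ NB).
by have [i ->] := cf_max (x - y); rewrite cfB xy subrr rnorm0.
Qed.

Let emb_eq0 p : emb p = 0 -> p = 0.
Proof. by move=> p0; apply/polyP => i; rewrite -cf_emb p0 cf0 coef0. Qed.

Let NB_le x M : (forall i, NA (cf i x) <= M) -> NB x <= M.
Proof. by move=> xM; have [i ->] := cf_max x. Qed.

Let emb_poly n x : (forall i, (n <= i)%N -> cf i x = 0) ->
  emb (\poly_(i < n) cf i x) = x.
Proof.
move=> xn; apply: cf_ext => i; rewrite cf_emb coef_poly.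
by case: ltnP => // /xn.
Qed.

Let NB_iota a : NB (iota a) = NA a.
Proof.
have E i : cf i (iota a) = if i == 0%N then a else 0.
  by rewrite -cf_monom expr0 mulr1.
apply/le_anti/andP; split.
  apply: NB_le => i; rewrite E; case: ifP; rewrite ?rnorm0 ?rnorm_ge0//.
by have := cf_le 0 (iota a); rewrite E eqxx.
Qed.

(** On polynomials in [zeta] this follows from [cf_monom]; truncations are dense and [cf i] does not
    increase norms. *)
Lemma cf_scale i a x : cf i (iota a * x) = a * cf i x.
Proof.
apply/eqP; rewrite -subr_eq0; apply/eqP/(@rnorm_small_eq0 _ _ NA) => e e0.
have a1 : 0 < NA a + 1 by rewrite ltr_wpDl ?rnorm_ge0.
have e1 : 0 < e / (NA a + 1) by rewrite divr_gt0.
have [n xn] := cf_null x e1; pose P := \poly_(j < n) cf j x.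
have xP : NA a * NB (x - emb P) <= e.
  apply: (@le_trans _ _ ((NA a + 1) * NB (x - emb P))).
    by rewrite ler_wpM2r ?rnorm_ge0// lerDl.
  rewrite mulrC -ler_pdivlMr//; apply: NB_le => j; rewrite cfB cf_emb coef_poly.
  by case: ltnP => [_|/xn]; rewrite ?subrr ?rnorm0 ?(ltW e1)// subr0.
have -> : cf i (iota a * x) - a * cf i x =
    cf i (iota a * (x - emb P)) - a * cf i (x - emb P).
  by rewrite mulrBr -embZ !cfB !cf_emb coefZ; ring.
rewrite (le_trans (rnormB _ _ _))// ge_max (le_trans (cf_le _ _)) ?rnormM ?NB_iota//=.
by rewrite (le_trans _ xP)// ler_wpM2l ?rnorm_ge0.
Qed.

Let NB_zetaX j : NB (zeta ^+ j) = 1.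
Proof.
have E i : cf i (zeta ^+ j) = if i == j then 1 else 0.
  by rewrite -cf_monom rmorph1 mul1r.
apply/le_anti/andP; split.
  by apply: NB_le => i; rewrite E; case: ifP; rewrite ?rnorm1 ?rnorm0 ?lexx ?ler01.
by rewrite -(rnorm1 NA); have := cf_le j (zeta ^+ j); rewrite E eqxx.
Qed.

(** Euclidean division with control of norms: the multiple of [w] removed at each step has norm at
    most that of the lead coefficient of [p], hence at most that of [p]. *)
Let monic_div (w : {poly A}) s : w \is monic -> size w = s.+1 -> NB (emb w) <= 1 ->
  forall p, exists q r, [/\ p = q * w + r, (size r <= s)%N,
    NB (emb q) <= NB (emb p) & NB (emb r) <= NB (emb p)].
Proof.
move=> wm ws w1 p; have [n] := ubnP (size p); elim: n p => // n IH p pn.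
have [ps|ps] := leqP (size p) s.
  by exists 0, p; rewrite mul0r add0r emb0 rnorm0 rnorm_ge0.
pose a := lead_coef p; pose d := (size p - s.+1)%N.
pose p1 := p - a *: (w * 'X^d).
have wl : w`_s = 1 by move/monicP: wm; rewrite lead_coefE ws.
have p1s : (size p1 < size p)%N.
  have sp : (0 < size p)%N by rewrite (leq_ltn_trans _ ps).
  rewrite -(prednK sp) ltnS; apply/leq_sizeP => j pj.
  rewrite coefB coefZ coefMXn ltnNge (leq_trans _ pj) /d/=; last first.
    by rewrite -(prednK sp) subSS leq_subr.
  have [jE|jp] := eqVneq j (size p).-1.
    have -> : (j - d)%N = s.
      by rewrite jE /d -{2}(prednK sp) subSS subKn// -ltnS prednK.
    by rewrite wl mulr1 jE subrr.
  have pj' : (size p <= j)%N by rewrite -(prednK sp) ltn_neqAle eq_sym jp.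
  rewrite nth_default// [w`_ _]nth_default ?mulr0 ?subrr// ws.
  by rewrite leq_subRL ?(leq_trans _ pj')// ?leq_subr// addnC subnKC.
have a_le : NB (iota a) <= NB (emb p) by rewrite NB_iota /a lead_coefE -cf_emb cf_le.
have mono : emb (a *: (w * 'X^d)) = iota a * zeta ^+ d * emb w.
  by rewrite embZ embM embX mulrAC mulrA.
have Nmono : NB (iota a * zeta ^+ d) <= NB (emb p) by rewrite rnormM NB_zetaX mulr1.
have p1_le : NB (emb p1) <= NB (emb p).
  rewrite embB (le_trans (rnormB _ _ _))// ge_max lexx mono rnormM.
  by rewrite -[NB (emb p)]mulr1 ler_pM ?rnorm_ge0.
have [q [r [E rs qp rp]]] := IH p1 (leq_trans p1s pn).
exists (q + a *: 'X^d), r; split => //; last exact: le_trans rp p1_le.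
  by rewrite mulrDl addrAC -E /p1 -scalerAl [_ * w]mulrC subrK.
rewrite embD embZ embX (le_trans (rnormD _ _ _))// ge_max Nmono andbT.
exact: le_trans qp p1_le.
Qed.

(** Weierstrass's condition of order s, with the unit coefficient in degree s normalized to 1. *)
Definition distinguished s f :=
  [/\ cf s f = 1, NB f <= 1 & forall i, (s < i)%N -> NA (cf i f) < 1].

Section Division.
Variables (s : nat) (f : B).
Hypothesis fs : distinguished s f.

Let f' := \poly_(i < s.+1) cf i f.
Let h := f - emb f'.

Let f's : size f' = s.+1.
Proof. by rewrite size_poly_eq//; case: fs => -> _ _; rewrite oner_neq0. Qed.

Let f'm : f' \is monic.
Proof. by apply/monicP; rewrite lead_coefE f's coef_poly ltnSn; case: fs. Qed.

Let f'1 : NB (emb f') <= 1.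
Proof.
apply: NB_le => i; rewrite cf_emb coef_poly; case: ifP; rewrite ?rnorm0 ?ler01//.
by move=> _; case: fs => _ f1 _; exact: le_trans (cf_le _ _) f1.
Qed.

Let h1 : NB h < 1.
Proof.
have [i ->] := cf_max h; rewrite cfB cf_emb coef_poly.
case: ltnP => [_|si]; first by rewrite subrr rnorm0.
by rewrite subr0; case: fs => _ _; apply.
Qed.

(** The contraction ratio of one division step. It also serves as the relative error of a
    truncation, so the 1/2 keeps it positive when [h] is zero. *)
Let eps := Num.max (NB h) (1 / 2).
Let eps0 : 0 < eps. Proof. by rewrite lt_max divr_gt0 ?orbT. Qed.
Let eps1 : eps < 1.
Proof. by rewrite gt_max h1 ltr_pdivrMr// mul1r ltr1n. Qed.

Let approx_div x : exists qp : B * {poly A}, [/\ (size qp.2 <= s)%N,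
  NB qp.1 <= NB x, NB (emb qp.2) <= NB x &
  NB (x - qp.1 * f - emb qp.2) <= eps * NB x].
Proof.
have [->|x0] := eqVneq x 0.
  by exists (0, 0); rewrite /= size_poly0 mul0r emb0 !subr0 !rnorm0 mulr0.
have [n xn] := cf_null x (mulr_gt0 eps0 (etrans (rnorm_gt0 NB x) x0)).
pose P := \poly_(i < n) cf i x.
have Px : NB (x - emb P) <= eps * NB x.
  apply: NB_le => i; rewrite cfB cf_emb coef_poly; case: ltnP => [_|/xn].
    by rewrite subrr rnorm0 mulr_ge0 ?rnorm_ge0 ?ltW.
  by rewrite subr0.
have P_le : NB (emb P) <= NB x.
  by apply: NB_le => i; rewrite cf_emb coef_poly; case: ifP => _; rewrite ?rnorm0 ?rnorm_ge0 ?cf_le.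
have [q [r [E rs qP rP]]] := monic_div f'm f's f'1 P.
exists (emb q, r); split => //=; [exact: le_trans qP P_le|exact: le_trans rP P_le|].
have -> : x - emb q * f - emb r = (x - emb P) - emb q * h.
  by rewrite E embD embM /h; ring.
rewrite (le_trans (rnormB _ _ _))// ge_max Px rnormM mulrC.
by rewrite ler_pM ?rnorm_ge0 ?le_max ?lexx// (le_trans qP).
Qed.

(* Dividing a truncation of x by the monic polynomial f' instead of f leaves an
   error eps |x| with eps < 1: iterate. *)
Lemma weierstrass_div x : exists q r,
  [/\ x = q * f + emb r, (size r <= s)%N & NB q <= NB x].
Proof.
have /choice[g gP] := approx_div.
pose xs n := iter n (fun y => y - (g y).1 * f - emb (g y).2) x.
pose Q n := \sum_(i < n) (g (xs i)).1; pose P n := \sum_(i < n) (g (xs i)).2.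
have f1 : NB f <= 1 by case: fs.
have xsE n : x = Q n * f + emb (P n) + xs n.
  elim: n => [|n IH]; first by rewrite /Q /P !big_ord0 mul0r emb0 !add0r.
  rewrite {1}IH /Q /P !big_ord_recr/= embD; ring.
have xs_le n : NB (xs n) <= eps ^+ n * NB x.
  elim: n => [|n IH]; first by rewrite expr0 mul1r.
  have [_ _ _ le] := gP (xs n); rewrite (le_trans le)// exprS -mulrA.
  by rewrite ler_wpM2l// ltW.
have xs_small e : 0 < e -> exists n, forall i, (n <= i)%N -> NB (xs i) <= e.
  move=> e0; have x10 : 0 < NB x + 1 by rewrite ltr_wpDl ?rnorm_ge0.
  have [n nP] := expr_small (ltW eps0) eps1 (divr_gt0 e0 x10).
  exists n => i /nP; rewrite ler_pdivlMr// => le.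
  rewrite (le_trans (xs_le i))// (le_trans _ le)// ler_wpM2l ?exprn_ge0 ?ltW//.
  by rewrite ltrDl.
have xs_lex n : NB (xs n) <= NB x.
  rewrite (le_trans (xs_le n))// ler_piMl ?rnorm_ge0// exprn_ile1// ltW//.
have [|q qP] := NB_complete (u := Q).
  move=> e e0; have [n nP] := xs_small e e0; exists n => i ni.
  rewrite /Q big_ord_recr/= addrAC subrr add0r.
  by have [_ le _ _] := gP (xs i); rewrite (le_trans le)// nP.
(* The sums [P n] of remainders are not shown to converge: it is enough that [x - q * f] has no
   coefficient from degree s on, which makes it a polynomial. *)
have rho0 i : (s <= i)%N -> cf i (x - q * f) = 0.
  move=> si; apply: (@rnorm_small_eq0 _ _ NA) => e e0.
  have [n nP] := xs_small e e0; have [k kP] := qP e e0; pose j := maxn n k.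
  have -> : x - q * f = emb (P j) + (xs j - (q - Q j) * f).
    by rewrite {1}(xsE j); ring.
  rewrite cfD cf_emb nth_default ?add0r.
    rewrite (le_trans (cf_le _ _))// (le_trans (rnormB _ _ _))// ge_max nP ?leq_maxl//=.
    by rewrite rnormM -[e]mulr1 ler_pM ?rnorm_ge0// -rnormN opprB kP// leq_maxr.
  apply: leq_trans si; apply: (big_ind (fun p : {poly A} => (size p <= s)%N)).
  - by rewrite size_poly0.
  - by move=> p1 p2 p1s p2s; rewrite (leq_trans (size_polyD _ _))// geq_max p1s.
  - by move=> l _; have [] := gP (xs l).
exists q, (\poly_(i < s) cf i (x - q * f)); rewrite (emb_poly rho0); split.
- by rewrite addrC subrK.
- exact: size_poly.
- apply/ler_addgt0Pr => e e0; have [k kP] := qP e e0.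
  rewrite -[q](subKr (Q k)) (le_trans (rnormB _ _ _))// ge_max; apply/andP; split.
    apply: rnorm_sum_le => [|i _]; first by rewrite addr_ge0 ?rnorm_ge0 ?ltW.
    have [_ le _ _] := gP (xs i); rewrite (le_trans le)// (le_trans (xs_lex i))//.
    by rewrite lerDl ltW.
  by rewrite (le_trans (kP k (leqnn k)))// lerDr rnorm_ge0.
Qed.

(** If q is not zero, let p be a truncation with |q - p| < |q| = |p|. Dividing r - p f' by f' must
    give the quotient -p, so |p| is at most |r - p f'|. As r = q f, this difference equals q h + (q
    - p) f', of norm less than |q|. *)
Lemma weierstrass_uniq q r : q * f = emb r -> (size r <= s)%N -> q = 0.
Proof.
move=> E rs; apply/eqP/negPn/negP => q0; have q_gt0 : 0 < NB q by rewrite rnorm_gt0.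
have d0 : 0 < NB q / 2 by rewrite divr_gt0.
have [n qn] := cf_null q d0; pose p := \poly_(i < n) cf i q.
have qp : NB (q - emb p) < NB q.
  apply: le_lt_trans (_ : NB q / 2 < NB q); last by lra.
  apply: NB_le => i; rewrite cfB cf_emb coef_poly.
  by case: ltnP => [_|/qn]; rewrite ?subrr ?rnorm0 ?(ltW d0)// subr0.
have pq : NB (emb p) = NB q.
  apply/le_anti/andP; split.
    by apply: NB_le => i; rewrite cf_emb coef_poly; case: ifP; rewrite ?rnorm0 ?rnorm_ge0.
  rewrite leNgt; apply/negP => pq; suff : NB q < NB q by rewrite ltxx.
  by rewrite -{1}(subrK (emb p) q) (le_lt_trans (rnormD _ _ _))// gt_max qp.
have [q1 [r1 [E1 r1s q1le _]]] := monic_div f'm f's f'1 (r - p * f').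
have pq1 : p = - q1.
  have E2 : (p + q1) * f' = r - r1.
    have -> : r = q1 * f' + r1 + p * f' by rewrite -E1 subrK.
    by ring.
  apply/eqP; rewrite -[_ == _]subr_eq0 opprK; apply/negPn/negP => pq10.
  have : (size ((p + q1) * f' : {poly A})%R <= s)%N.
    by rewrite E2 (leq_trans (size_polyD _ _))// size_polyN geq_max rs.
  rewrite size_Mmonic// f's addnS/= leqNgt addnC -{1}[s]addn0 ltn_add2l.
  by rewrite size_poly_gt0 pq10.
suff : NB q < NB q by rewrite ltxx.
rewrite -{1}pq pq1 -[emb (- q1)](_ : - emb q1 = _); last first.
  by rewrite -[- q1]sub0r embB emb0 sub0r.
rewrite rnormN (le_lt_trans q1le)// embB embM -E.
have -> : q * f - emb p * emb f' = q * h + (q - emb p) * emb f' by rewrite /h; ring.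
rewrite (le_lt_trans (rnormD _ _ _))// gt_max !rnormM; apply/andP; split.
  by rewrite -[ltRHS]mulr1 ltr_pM2l.
by rewrite (le_lt_trans _ qp)// -[leRHS]mulr1 ler_wpM2l ?rnorm_ge0.
Qed.

End Division.

(** Dividing [zeta ^+ s] by [f] gives w = q f. Dividing [f] back by [w] gives f = q' w + r', so that
    (1 - q q') f = r', and uniqueness forces q q' = 1. *)
Lemma weierstrass_prep s f : distinguished s f -> exists w u,
  [/\ w \is monic, size w = s.+1, distinguished s (emb w), emb w = u * f & invertible u].
Proof.
move=> fs; have [q [r [E rs q1]]] := weierstrass_div fs (emb 'X^s).
pose w := 'X^s - r.
have ws : size w = s.+1 by rewrite size_polyDl size_polyXn// size_polyN.
have wc : w`_s = 1 by rewrite coefB coefXn eqxx nth_default// subr0.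
have wm : w \is monic by apply/monicP; rewrite lead_coefE ws.
have wE : emb w = q * f by rewrite embB E addrK.
have w1 : NB (emb w) <= 1.
  rewrite wE rnormM mulr_ile1 ?rnorm_ge0//; last by case: fs.
  by rewrite (le_trans q1)// embX NB_zetaX.
have wd : distinguished s (emb w).
  by split; rewrite ?cf_emb// => i si; rewrite cf_emb nth_default ?ws// rnorm0.
exists w, q; split => //; have [q' [r' [E' r's _]]] := weierstrass_div wd f.
exists q'; apply/eqP; rewrite eq_sym -subr_eq0; apply/eqP.
apply: (weierstrass_uniq fs _ r's); rewrite mulrBl mul1r {1}E' wE; ring.
Qed.

(* f may be replaced with a monic polynomial w. Let p be the remainder of x modulo
   w, and k an element of minimal size of the ideal (w, p): up to constants k is
   gcd (w, p), so that w | p or k is a constant, according to which factor of w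
   is invertible. *)
Lemma distinguished_prime s f : factorial A -> distinguished s f -> irreducible f ->
  prime_elt f.
Proof.
move=> fA fs [f0 fnu firr]; have [w [u [wm ws wd wE [u' uu']]]] := weierstrass_prep fs.
have fw x : divides f x <-> divides (emb w) x.
  split=> [|[y ->]]; last by rewrite wE; exists (u * y); rewrite mulrA [f * u]mulrC.
  case=> y ->; exists (u' * y); rewrite wE.
  by rewrite [u * f]mulrC mulrA -[f * u * u']mulrA uu' mulr1.
(* Nonzero constants cancel modulo [w]: if r is the remainder of y, then a r is a multiple of [w] of
   size at most s, hence zero. *)
have cancel a y : a != 0 -> divides (emb w) (iota a * y) -> divides (emb w) y.
  move=> a0 [t tE]; have [q [r [E rs _]]] := weierstrass_div wd y.
  have E2 : (t - iota a * q) * emb w = emb (a *: r).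
    by rewrite embZ mulrBl [t * _]mulrC -tE E; ring.
  have q0 := weierstrass_uniq wd E2 (leq_trans (size_scale_leq _ _) rs).
  have /emb_eq0/(scale_poly_eq0 NA a0) r0 : emb (a *: r) = 0 by rewrite -E2 q0 mul0r.
  by exists q; rewrite E r0 emb0 addr0 mulrC.
split=> // x y /fw wxy; rewrite !fw.
have [q [p [xE ps _]]] := weierstrass_div wd x.
have [p0|p0] := eqVneq p 0.
  by left; exists q; rewrite xE p0 emb0 addr0 mulrC.
pose I (k : {poly A}) := exists t1 t2, k = t1 * w + t2 * p.
have exk : exists n, `[< exists k, [/\ k != 0, I k & size k = n] >].
  exists (size p); apply/asboolP; exists p; split => //.
  by exists 0, 1; rewrite mul0r mul1r add0r.
have [n /asboolP[k [k0 kI kn]] nmin] := ex_minnP exk.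
(* The ring of constants is not a field, so only pseudo-division by [k] is available. The
   pseudo-remainder lies in the ideal, and the minimality of the size of [k] makes it zero. *)
have pseudo t : I t -> exists a t', a != 0 /\ a *: t = t' * k.
  move=> tI; exists (lead_coef k ^+ rscalp t k), (rdivp t k); split.
    rewrite -(rnorm_gt0 NA) rnormX exprn_gt0// rnorm_gt0 lead_coef_eq0//.
  have E := rdivp_eq k t; rewrite E.
  suff -> : rmodp t k = 0 by rewrite addr0.
  apply/eqP/negPn/negP => r0.
  have : (n <= size (rmodp t k))%N.
    apply: nmin; apply/asboolP; exists (rmodp t k); split => //.
    have : rmodp t k = lead_coef k ^+ rscalp t k *: t - rdivp t k * k.
      by rewrite E addrAC subrr add0r.
    move: (rdivp t k) (lead_coef k ^+ _) => dv lc ->.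
    case: tI kI => [t1 [t2 ->]] [t3 [t4 ->]].
    exists (lc *: t1 - dv * t3), (lc *: t2 - dv * t4).
    by rewrite -!mul_polyC; ring.
  by rewrite -kn leqNgt ltn_rmodpN0.
have wI : I w by exists 1, 0; rewrite mul0r mul1r addr0.
have pI : I p by exists 0, 1; rewrite mul0r mul1r add0r.
have [a [t [a0 aE]]] := pseudo w wI.
have [a1 [a2 [t' [k' [aa tE kE wtk]]]]] := factorial_content NA fA a0 aE.
have a20 : a2 != 0 by apply: contra_neq a0 => a20; rewrite aa a20 mulr0.
have embtk : emb w = emb t' * emb k' by rewrite wtk embM.
have [[t1 t1E]|[k1 k1E]] : invertible (emb t') \/ invertible (emb k').
  have /firr : f = (u' * emb t') * emb k'.
    by rewrite -mulrA -embtk wE mulrA [u' * u]mulrC uu' mul1r.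
  case=> [[z zE]|]; last by right.
  by left; exists (u' * z); rewrite mulrCA mulrA.
- left; have [b [k2 [b0 bE]]] := pseudo p pI.
  have wk' : divides (emb w) (emb k').
    by exists t1; rewrite embtk mulrAC t1E mul1r.
  have wp : divides (emb w) (emb p).
    apply: (cancel b) => //; rewrite -embZ bE embM kE embZ.
    by do 2!apply: divides_mull.
  by rewrite xE; apply: dividesD => //; exists q; rewrite mulrC.
- right.
  (* Here [t'] is an associate of [w], hence has size greater than s by uniqueness of division; this
     leaves only a constant for [k'], and so for [k]. Since [k] is in the ideal (w, p) and [w]
     divides p y, a nonzero constant times y is a multiple of [w]. *)
  have t'k1 : emb t' = k1 * emb w by rewrite embtk mulrC -mulrA k1E mulr1.
  have st' : (s < size t')%N.
    rewrite ltnNge; apply/negP => t's.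
    have k10 := weierstrass_uniq wd (esym t'k1) t's.
    by move: k1E; rewrite k10 mulr0 => /eqP; rewrite eq_sym oner_eq0.
  have k'0 : k' != 0 by apply: contra_neq k0; rewrite kE => ->; rewrite scaler0.
  have t'0 : t' != 0 by rewrite -size_poly_gt0 (leq_ltn_trans _ st').
  have sk' : (size k' <= 1)%N.
    have : size w = (size t' + size k').-1.
      rewrite wtk size_proper_mul//.
      by apply/negP => /eqP/(rnorm_mul_eq0 NA)[]/eqP; rewrite lead_coef_eq0 ?(negbTE k'0) ?(negbTE t'0).
    rewrite ws; case: (size k') => [//|l]; rewrite addnS /= => e.
    by rewrite -(leq_add2l (size t')) addnS -e addn1.
  have kC : k = (a2 * k'`_0)%:P by rewrite kE [in LHS](size1_polyC sk') scale_polyC.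
  have c0 : a2 * k'`_0 != 0 by apply: contra_neq k0; rewrite kC => ->.
  apply: (cancel _ _ c0); case: kI => t3 [t4 kI].
  have <- : emb k = iota (a2 * k'`_0) by rewrite kC /emb map_polyC hornerC.
  rewrite kI embD !embM mulrDl; apply: dividesD.
    by apply: divides_mulr; apply: divides_mull; exact: divides_refl.
  rewrite -mulrA; apply: divides_mull.
  have -> : emb p * y = x * y - q * emb w * y by rewrite xE; ring.
  apply: dividesB => //; apply: divides_mulr; apply: divides_mull; exact: divides_refl.
Qed.

End Weierstrass.

(** * Linear changes of variables *)

Lemma base_expansion_inj d n (a b : 'I_n -> nat) :
  (forall i, a i < d)%N -> (forall i, b i < d)%N ->
  (\sum_i a i * d ^ i = \sum_i b i * d ^ i)%N -> a =1 b.
Proof.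
elim: n a b => [|n IH] a b ad bd E; first by case.
have split_sum (c : 'I_n.+1 -> nat) : (\sum_i c i * d ^ i =
    (\sum_(i < n) c (lift ord0 i) * d ^ i) * d + c ord0)%N.
  rewrite big_ord_recl expn0 muln1 addnC; congr addn; rewrite big_distrl/=.
  by apply: eq_bigr => i _; rewrite /bump /= add1n expnSr mulnA.
have d0 : (0 < d)%N by rewrite (leq_ltn_trans _ (ad ord0)).
have e0 : a ord0 = b ord0.
  by have := congr1 (modn^~ d) E; rewrite !split_sum !modnMDl !modn_small.
have E' : (\sum_(i < n) a (lift ord0 i) * d ^ i = \sum_(i < n) b (lift ord0 i) * d ^ i)%N.
  by have := congr1 (divn^~ d) E; rewrite !split_sum !divnMDl// !divn_small// !addn0.
move=> i; have [j ->|->//] := unliftP ord0 i.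
exact: (IH (fun j => a (lift ord0 j)) (fun j => b (lift ord0 j))).
Qed.

Section UnitPoints.
Variables (R : realType) (F : closedFieldType) (v : nonarch_absval R F).

Lemma absval_prod (I : Type) (s : seq I) (f : I -> F) :
  v (\prod_(i <- s) f i) = \prod_(i <- s) v (f i).
Proof. exact: (big_morph v (absvalM v) (absval1 v)). Qed.

(* A root of X * prod (X - a) - 1, the product ranging over the integral a in s. *)
Lemma exists_generic_unit (s : seq F) : exists t, v t = 1 /\
  forall a, a \in s -> v (t - a) = Num.max 1 (v a).
Proof.
pose s1 := [seq a <- s | v a <= 1].
pose h := 'X * \prod_(a <- s1) ('X - a%:P) - 1.
have [t /rootP] : exists t, root h t.
  apply/closed_rootP.
  have := size_prod_XsubC s1 id; set P := \prod_(a <- s1) _ => Ps.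
  have P0 : P != 0 by rewrite -size_poly_gt0 Ps.
  have XP : size ('X * P) = (size s1).+2 by rewrite mulrC size_mulX// Ps.
  by rewrite /h -/P size_polyDl XP// size_polyN size_poly1.
rewrite /h hornerD hornerN hornerM hornerX hornerC => /eqP; rewrite subr_eq0 => /eqP.
rewrite horner_prod; under eq_bigr do rewrite hornerXsubC.
move/(congr1 v); rewrite absvalM absval_prod absval1 => E.
have t1 : v t <= 1.
  rewrite leNgt; apply/negP => t1; suff : 1 < v t * \prod_(a <- s1) v (t - a).
    by rewrite E ltxx.
  rewrite (lt_le_trans t1)// ler_peMr ?absval_ge0// big_seq.
  apply: (big_ind (fun x => 1 <= x)) => // [|a]; first exact: mulr_ege1.
  rewrite mem_filter => /andP[a1 _].
  by rewrite absvalD_eq ?ltW// absvalN (le_lt_trans a1).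
have ta1 a : a \in s1 -> v (t - a) <= 1.
  by rewrite mem_filter => /andP[a1 _]; rewrite (le_trans (absvalB _ _ _))// ge_max t1.
have prod1 : \prod_(a <- s1) v (t - a) <= 1.
  by rewrite big_seq; apply: Num.Theory.prodr_ile1 => a /ta1; rewrite absval_ge0.
have P0 : 0 <= \prod_(a <- s1) v (t - a) by apply: prodr_ge0 => a _; exact: absval_ge0.
(* In a product of absolute value 1 all of whose factors are at most 1, every factor is 1: this is
   applied to [t] here and to each [t - a] below. *)
have vt : v t = 1.
  apply/le_anti; rewrite t1 -{1}E; by rewrite ler_piMr ?absval_ge0.
exists t; split=> // a asn; have [a1|a1] := leP (v a) 1; last first.
  by rewrite addrC absvalD_eq absvalN ?vt.
have as1 : a \in s1 by rewrite mem_filter a1.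
apply/le_anti; rewrite ta1//= -{1}E vt mul1r (big_rem a)//= ler_piMr ?absval_ge0//.
by rewrite big_seq; apply: Num.Theory.prodr_ile1 => b /mem_rem/ta1; rewrite absval_ge0.
Qed.

(** At a generic unit t, a linear factor X - a takes the absolute value max(1, |a|), its own Gauss
    norm. Multiplying over the roots bounds every coefficient of [q]. *)
Lemma poly_unit_point (q : {poly F}) : exists t, v t = 1 /\ forall j, v q`_j <= v q.[t].
Proof.
have [s qE] := closed_field_poly_normal q.
have [t [t1 ts]] := exists_generic_unit s; exists t; split => // j.
rewrite qE coefZ hornerZ !absvalM ler_wpM2l ?absval_ge0//.
rewrite horner_prod absval_prod {qE}; elim: s ts j => [|a s IH] ts j.
  by rewrite !big_nil coef1; case: eqP => _; rewrite ?absval1 ?absval0 ?ler01.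
rewrite !big_cons hornerXsubC ts ?mem_head//.
have {}IH i : v (\prod_(z <- s) ('X - z%:P))`_i <= \prod_(z <- s) v ('X - z%:P).[t].
  by apply: IH => b bs; apply: ts; rewrite inE bs orbT.
have P0 : 0 <= \prod_(z <- s) v ('X - z%:P).[t] by apply: prodr_ge0 => z _; exact: absval_ge0.
rewrite mulrBl coefB coefXM coefCM (le_trans (absvalB _ _ _))// ge_max.
apply/andP; split; last first.
  by rewrite absvalM ler_pM ?absval_ge0// le_max lexx orbT.
apply: (@le_trans _ _ (\prod_(z <- s) v ('X - z%:P).[t])).
  by case: eqP => _; rewrite ?absval0.
by rewrite ler_peMl// le_max lexx.
Qed.

(* Kronecker substitution reduces to one variable. *)
Lemma mpoly_unit_point m (p : {mpoly F[m]}) :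
  exists c : 'I_m -> F, (forall i, v (c i) = 1) /\ forall g, v p@_g <= v p.@[c].
Proof.
pose d := msize p; pose w (g : 'X_{1..m}) := (\sum_i g i * d ^ i)%N.
pose q : {poly F} := \sum_(g <- msupp p) p@_g *: 'X^(w g).
have gd g i : g \in msupp p -> (g i < d)%N.
  move/msize_mdeg_lt; apply: leq_ltn_trans.
  by rewrite mdegE (bigD1 i)//= leq_addr.
have qw g : g \in msupp p -> q`_(w g) = p@_g.
  move=> gp; rewrite /q coef_sum (bigD1_seq g) ?msupp_uniq//=.
  rewrite coefZ coefXn eqxx mulr1 big_seq_cond big1 ?addr0// => h /andP[hp hg].
  rewrite coefZ coefXn; case: eqP => [E|_]; last by rewrite mulr0.
  case/eqP: hg; apply/mnmP; apply: (base_expansion_inj (d := d)) => [i|i|//]; exact: gd.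
have [t [t1 tq]] := poly_unit_point q.
exists (fun i => t ^+ (d ^ i)); split => [i|g]; first by rewrite absvalX t1 expr1n.
have -> : p.@[fun i => t ^+ (d ^ i)] = q.[t].
  rewrite mevalE /q horner_sum; apply: eq_bigr => h _.
  rewrite hornerZ hornerXn /w expr_sum; congr (_ * _).
  by apply: eq_bigr => i _; rewrite -exprM mulnC.
have [gp|/memN_msupp_eq0->] := boolP (g \in msupp p); last by rewrite absval0 absval_ge0.
by rewrite -qw.
Qed.

End UnitPoints.

Section Substitution.
Variables (F : fieldType) (m : nat).
Implicit Types (x y : series F m) (p q : {mpoly F[m]}) (L : m.-tuple {mpoly F[m]}).

(* As the components of L are linear forms, the substitution preserves total
   degrees: no convergence is involved. *)
Definition subst L x : series F m :=
  fun g => (trunc (mdeg g).+1 x \mPo L)@_g.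

Definition linear_forms L := forall i, tnth L i \is 1.-homog.

Lemma dhomog_big (s : seq 'I_m) (f : 'I_m -> {mpoly F[m]}) (d : 'I_m -> nat) :
  (forall i, f i \is (d i).-homog) ->
  \prod_(i <- s) f i \is (\sum_(i <- s) d i)%N.-homog.
Proof.
move=> fd; elim: s => [|i s IH]; first by rewrite !big_nil dhomog1.
by rewrite !big_cons dhomogM.
Qed.

Lemma dhomog_compX L d : linear_forms L -> 'X_[d] \mPo L \is (mdeg d).-homog.
Proof.
move=> Lh; rewrite comp_mpolyX mdegE; apply: dhomog_big => i.
by have := dhomogMn (d i) (Lh i); rewrite mul1n.
Qed.

(** Linear substitution sends a monomial to a form of the same degree, so the coefficient at [g]
    only sees the coefficients of degree [mdeg g]. *)
Lemma comp_coef_eq L p q g : linear_forms L ->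
  (forall d, mdeg d = mdeg g -> p@_d = q@_d) -> (p \mPo L)@_g = (q \mPo L)@_g.
Proof.
move=> Lh pq; apply/eqP; rewrite -subr_eq0 -mcoeffB -comp_mpolyB; apply/eqP.
rewrite comp_mpolyEX (raddf_sum (mcoeff g)) /= big1_seq// => d _.
rewrite mcoeffZ; have [E|dg] := eqVneq (mdeg d) (mdeg g).
  by rewrite mcoeffB pq// subrr mul0r.
by rewrite (dhomog_nemf_coeff (dhomog_compX d Lh)) ?mulr0 1?eq_sym.
Qed.

Lemma substE L d x g : linear_forms L -> (mdeg g < d)%N ->
  subst L x g = (trunc d x \mPo L)@_g.
Proof.
by move=> Lh gd; apply: comp_coef_eq => // h hg; rewrite !mcoeff_trunc hg ltnSn gd.
Qed.

Lemma substD L x y : subst L (x + y) = subst L x + subst L y.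
Proof.
apply/funext => g; transitivity (subst L x g + subst L y g); last by [].
rewrite /subst -mcoeffD -comp_mpolyD.
congr (_@__); congr (_ \mPo _); apply/mpolyP => h; rewrite mcoeffD !mcoeff_trunc.
by case: ifP => //; rewrite addr0.
Qed.

Lemma mcoeffM_eq p p' q q' g :
  (forall h, (mdeg h <= mdeg g)%N -> p@_h = p'@_h) ->
  (forall h, (mdeg h <= mdeg g)%N -> q@_h = q'@_h) ->
  (p * q)@_g = (p' * q')@_g.
Proof.
move=> pp qq; rewrite !mcoeffM; apply: eq_bigr => -[h k] /= _.
by rewrite pp ?qq// -ltnS bmdeg.
Qed.

Lemma substM L x y : linear_forms L -> subst L (x * y) = subst L x * subst L y.
Proof.
move=> Lh; apply/funext => g; rewrite (seriesM_trunc _ _ (ltnSn (mdeg g))).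
transitivity ((trunc (mdeg g).+1 x * trunc (mdeg g).+1 y \mPo L)@_g).
  apply: comp_coef_eq => // h hg; rewrite mcoeff_trunc hg ltnSn.
  by rewrite (@seriesM_trunc _ _ (mdeg g).+1)// hg.
rewrite rmorphM /=; apply: mcoeffM_eq => h hg; by rewrite mcoeff_trunc ltnS hg -substE.
Qed.

Lemma subst_comp L L' x : linear_forms L -> linear_forms L' ->
  (forall i, tnth L i \mPo L' = 'X_i) -> subst L' (subst L x) = x.
Proof.
move=> Lh Lh' LL; apply/funext => g.
transitivity ((trunc (mdeg g).+1 x \mPo L \mPo L')@_g).
  apply: comp_coef_eq => // h hg; rewrite mcoeff_trunc hg ltnSn.
  by rewrite (@substE L (mdeg g).+1)// hg.
suff -> : trunc (mdeg g).+1 x \mPo L \mPo L' = trunc (mdeg g).+1 x.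
  by rewrite mcoeff_trunc ltnSn.
rewrite (comp_mpolyEX (trunc _ _)) (raddf_sum (comp_mpoly L')) [RHS]mpolyE /=.
apply: eq_bigr => d _; rewrite comp_mpolyZ; congr (_ *: _).
rewrite comp_mpolyX rmorph_prod /= mpolyXE_id; apply: eq_bigr => i _.
by rewrite rmorphXn /= LL.
Qed.

Lemma subst_const L c : subst L (series_const m c) = series_const m c.
Proof.
apply/funext => g; rewrite /subst; have -> : trunc (mdeg g).+1 (series_const m c) = c%:MP.
  apply/mpolyP => h; rewrite mcoeff_trunc mcoeffC /series_const.
  case: (h =P 0%MM) => [->|_]; last by rewrite mulr0; case: ifP.
  by rewrite mdeg0 mulr1.
rewrite comp_mpolyC mcoeffC /series_const; case: eqP => _; by rewrite ?mulr1 ?mulr0.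
Qed.

Lemma subst_coef L x g : subst L x g =
  \sum_(k : 'X_{1..m < (mdeg g).+1}) x k * ('X_[k] \mPo L)@_g.
Proof.
rewrite /subst /trunc (raddf_sum (comp_mpoly L)) (raddf_sum (mcoeff g)) /=; apply: eq_bigr => k _.
by rewrite comp_mpolyZ mcoeffZ.
Qed.

Definition coefs p : series F m := fun g => p@_g.

Lemma coefsM p q : coefs (p * q) = coefs p * coefs q.
Proof. by apply/funext => g; rewrite /coefs mcoeffM. Qed.

Lemma coefs1 : coefs 1 = 1.
Proof.
apply/funext => g; rewrite /coefs mcoeff1.
by rewrite [RHS]/(series_const m 1 g) /series_const; case: eqP.
Qed.

Lemma uses_first_subst k L x :
  (forall i : 'I_m, (i < k)%N -> uses_first k (coefs (tnth L i))) ->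
  uses_first k x -> uses_first k (subst L x).
Proof.
move=> Lk xk g; rewrite subst_coef => xg.
have [/existsP[d]|] := boolP [exists d : 'X_{1..m < (mdeg g).+1},
    x d * ('X_[d] \mPo L)@_g != 0]; last first.
  rewrite negb_exists => /forallP x0; case/eqP: xg; apply: big1 => d _.
  by apply/eqP/negPn; exact: x0.
rewrite mulf_eq0 negb_or => /andP[xd dg].
suff : uses_first k (coefs ('X_[d] \mPo L)) by apply.
rewrite comp_mpolyX; apply: (big_ind (fun p => uses_first k (coefs p))).
- by rewrite coefs1; exact: uses_first1.
- by move=> p q; rewrite coefsM; exact: uses_firstM.
move=> i _; have [ik|ki] := ltnP i k; last by rewrite (xk d)// expr0 coefs1; exact: uses_first1.
elim: (d i : nat) => [|n IH]; first by rewrite expr0 coefs1; exact: uses_first1.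
by rewrite exprS coefsM; apply: uses_firstM => //; exact: Lk.
Qed.

End Substitution.

Section SubstWeight.
Variables (R : realType) (F : fieldType) (v : nonarch_absval R F) (m : nat).
Implicit Types (x y : series F m) (p q : {mpoly F[m]}) (L : m.-tuple {mpoly F[m]}).

(** Integral forms produce integral coefficients, and the multi-indices that contribute all have the
    degree of [g], so the factor r ^+ mdeg g is common to them. *)
Lemma subst_weight_lt L r x g M : linear_forms L ->
  (forall i h, v (tnth L i)@_h <= 1) -> 0 <= r -> 0 < M ->
  (forall h, mdeg h = mdeg g -> weight v r x h < M) -> weight v r (subst L x) g < M.
Proof.
move=> Lh L1 r0 M0 xM.
have X1 d h : v ('X_[d] \mPo L)@_h <= 1.
  have int1 : forall h, v (1 : {mpoly F[m]})@_h <= 1.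
    by move=> h'; rewrite mcoeff1; case: eqP => _; rewrite ?absval1 ?absval0 ?ler01.
  have intM p q : (forall h, v p@_h <= 1) -> (forall h, v q@_h <= 1) ->
      forall h, v (p * q)@_h <= 1.
    move=> p1 q1 h'; rewrite mcoeffM; apply: absval_sum_le; first exact: ler01.
    by move=> k _; rewrite absvalM mulr_ile1 ?absval_ge0.
  rewrite comp_mpolyX; move: h; apply: (big_ind (fun p => forall h, v p@_h <= 1)) => //.
  move=> i _; elim: (d i : nat) => [|n IH]; first by rewrite expr0.
  by rewrite exprS; apply: intM.
have [r00|rg0] := eqVneq (r ^+ mdeg g) 0; first by rewrite /weight r00 mulr0.
have rg : 0 < r ^+ mdeg g by rewrite lt0r rg0 exprn_ge0.
rewrite /weight -ltr_pdivlMr// subst_coef; apply: absval_sum_lt => [|d _].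
  by rewrite divr_gt0.
have [E|dg] := eqVneq (mdeg d) (mdeg g).
  have := xM _ E; rewrite /weight E => xdM.
  rewrite ltr_pdivlMr// absvalM mulrAC (le_lt_trans _ xdM)//.
  by rewrite ler_piMr// mulr_ge0 ?absval_ge0 ?exprn_ge0.
rewrite (dhomog_nemf_coeff (dhomog_compX d Lh)) 1?eq_sym//.
by rewrite mulr0 absval0 divr_gt0.
Qed.

Lemma subst_weight_le L r x g M : linear_forms L ->
  (forall i h, v (tnth L i)@_h <= 1) -> 0 <= r -> 0 <= M ->
  (forall h, mdeg h = mdeg g -> weight v r x h <= M) -> weight v r (subst L x) g <= M.
Proof.
move=> Lh L1 r0 M0 xM; apply/ler_addgt0Pr => e e0; apply/ltW/subst_weight_lt => //.
  by rewrite ltr_wpDl.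
by move=> h /xM/le_lt_trans; apply; rewrite ltrDl.
Qed.

Lemma null_at_subst L r x : linear_forms L -> (forall i h, v (tnth L i)@_h <= 1) ->
  0 <= r -> null_at v r x -> null_at v r (subst L x).
Proof.
move=> Lh L1 r0 nx e e0; have e20 : 0 < e / 2 by rewrite divr_gt0.
have [N xN] := nx _ e20; exists N => g gN.
apply: (@le_lt_trans _ _ (e / 2)); last by lra.
apply: subst_weight_le => //; first exact: ltW.
by move=> h hg; rewrite ltW// xN// hg.
Qed.

End SubstWeight.

(** * Factoriality of Tate algebras *)

Lemma mul_coefsX (F : fieldType) m (x : series F m) (c : F) (M g : 'X_{1..m}) :
  (x * coefs (c *: 'X_[M])) g = if (M <= g)%MM then x (g - M)%MM * c else 0.
Proof.
rewrite (seriesM_trunc _ _ (ltnSn (mdeg g))).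
transitivity ((trunc (mdeg g).+1 x * (c *: 'X_[M]))@_g).
  by apply: mcoeffM_eq => h hg //; rewrite mcoeff_trunc ltnS hg.
rewrite -scalerAr mcoeffZ; case: ifPn => [Mg|Mg].
  rewrite -{1}(submK Mg) addmC mcoeffMX mcoeff_trunc ltnS.
  by rewrite mdegB mulrC.
rewrite mcoeffM big1 ?mulr0// => -[h k] /= /eqP gE; rewrite mcoeffX.
case: (M =P k) => [Mk|_]; last by rewrite mulr0.
by case/negP: Mg; rewrite gE Mk lem_addl.
Qed.

Section AdjoinVariable.
Variables (R : realType) (F : closedFieldType) (v : nonarch_absval R F).
Variables (m : nat) (i0 : 'I_m) (rho : F) (rho0 : rho != 0).

Implicit Types g h : 'X_{1..m}.

Let r := v rho.
Let r_gt0 : 0 < r. Proof. by rewrite absval_gt0. Qed.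
Let r_ge0 := ltW r_gt0.

Local Notation A := (tate v m i0 rho).
Local Notation B := (tate v m i0.+1 rho).
Local Notation NA := (tate_norm v m i0 rho0).
Local Notation NB := (tate_norm v m i0.+1 rho0).

Let uses_firstS (x : series F m) : uses_first i0 x -> uses_first i0.+1 x.
Proof. by move=> xk g xg i /ltnW; exact: xk. Qed.

Definition widen (x : A) : B := mk_tate (tateP x).1 (uses_firstS (tateP x).2).

Let widen_zmod_morphism : zmod_morphism widen.
Proof. by move=> x y; apply: val_inj. Qed.

Let widen_monoid_morphism : monoid_morphism widen.
Proof. by split=> [|x y]; apply: val_inj. Qed.

HB.instance Definition _ := GRing.isZmodMorphism.Build A B widen widen_zmod_morphism.
HB.instance Definition _ := GRing.isMonoidMorphism.Build A B widen widen_monoid_morphism.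

Let zeta_coef : series F m := coefs (rho^-1 *: 'X_i0).

Let zeta_coefX j : zeta_coef ^+ j = coefs (rho ^- j *: 'X_[U_(i0) *+ j]).
Proof.
elim: j => [|j IH].
  by rewrite expr0 invr1 scale1r mpolyX0 coefs1.
rewrite exprS IH -coefsM -scalerAl -scalerAr scalerA -mpolyXD -mulmS.
by rewrite exprS invfM.
Qed.

Let zeta_null : null_at v r zeta_coef.
Proof.
move=> e e0; exists 2%N => g g2; rewrite /weight /zeta_coef /coefs mcoeffZ mcoeffX.
case: eqP g2 => [<-|_ _]; first by rewrite mdeg1.
by rewrite mulr0 absval0 mul0r.
Qed.

Let zeta_uses : uses_first i0.+1 zeta_coef.
Proof.
move=> g; rewrite /zeta_coef /coefs mcoeffZ mcoeffX.
case: (U_(i0)%MM =P g) => [<- _ i ik|_]; last by rewrite mulr0 eqxx.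
by rewrite mnm1E; apply/eqP; rewrite eqb0; apply: contraTneq ik => <-; rewrite ltnn.
Qed.

(* The last variable divided by rho, of norm 1. *)
Definition zeta : B := mk_tate zeta_null zeta_uses.

(** The coefficient of [zeta ^+ j], not of the j-th power of the variable itself: the factor
    [rho ^+ j] makes weights agree exactly. *)
Let shift (j : nat) (x : series F m) : series F m :=
  fun g => if g i0 == 0%N then x (g + U_(i0) *+ j)%MM * rho ^+ j else 0.

Let mdeg_shift g j : mdeg (g + U_(i0) *+ j)%MM = (mdeg g + j)%N.
Proof. by rewrite mdegD mdegMn mdeg1 mul1n. Qed.

Let weight_shift j x g : g i0 = 0%N ->
  weight v r (shift j x) g = weight v r x (g + U_(i0) *+ j)%MM.
Proof.
move=> g0; rewrite /weight /shift g0 eqxx absvalM absvalX mdeg_shift exprD.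
by rewrite mulrAC mulrA.
Qed.

Let weight_shift0 j x g : g i0 != 0%N -> weight v r (shift j x) g = 0.
Proof. by move=> g0; rewrite /weight /shift (negbTE g0) absval0 mul0r. Qed.

Let shift_null j x : null_at v r x -> null_at v r (shift j x).
Proof.
move=> nx e e0; have [N xN] := nx e e0; exists N => g gN.
have [g0|g0] := eqVneq (g i0) 0%N; last by rewrite weight_shift0.
by rewrite weight_shift// xN// mdeg_shift (leq_trans gN)// leq_addr.
Qed.

Let shift_uses j x : uses_first i0.+1 x -> uses_first i0 (shift j x).
Proof.
move=> xk g; rewrite /shift; case: (g i0 =P 0%N) => [g0|_]; last by rewrite eqxx.
rewrite mulf_eq0 negb_or => /andP[xg _] i; rewrite leq_eqVlt => /orP[/eqP e|ik].
  by rewrite -(val_inj e).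
by have := xk _ xg i ik; rewrite mnmDE => /eqP; rewrite addn_eq0 => /andP[/eqP].
Qed.

Definition slice j (x : B) : A :=
  mk_tate (@shift_null j _ (tateP x).1) (@shift_uses j _ (tateP x).2).

Lemma sliceB j x y : slice j (x - y) = slice j x - slice j y.
Proof.
apply: val_inj; apply/funext => g; pose h := (g + U_(i0) *+ j)%MM.
transitivity (if g i0 == 0%N then (val x h - val y h) * rho ^+ j else 0); first by [].
transitivity (shift j (val x) g - shift j (val y) g); last by [].
by rewrite /shift; case: ifP => _; rewrite ?mulrBl// subr0.
Qed.

Lemma slice_monom i j a : slice i (widen a * zeta ^+ j) = if i == j then a else 0.
Proof.
have E : val (widen a * zeta ^+ j) = (val a : series F m) * zeta_coef ^+ j.
  by rewrite rmorphM rmorphXn.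
apply: val_inj; apply/funext => g.
transitivity (shift i (val (widen a * zeta ^+ j)) g); first exact: erefl.
rewrite E /shift.
have a0 h : h i0 != 0%N -> val a h = 0.
  move=> hi; apply/eqP/negPn/negP => ah; case/eqP: hi.
  exact: (tateP a).2 ah i0 (leqnn i0).
case: (g i0 =P 0%N) => [g0|/eqP g0]; last by case: ifP => // _; rewrite a0.
rewrite zeta_coefX mul_coefsX; have [<-|ij] := eqVneq i j.
  rewrite lem_addl -[(g + _ - _)%MM]/(g + U_(i0) *+ i - U_(i0) *+ i)%MM addmK.
  by rewrite -mulrA mulVf ?mulr1// expf_neq0.
case: ifP => [le|_]; last by rewrite mul0r.
have ji : (j < i)%N.
  move/mnm_lepP: le => /(_ i0); rewrite mnmDE !mulmnE mnm1E eqxx g0 !mul1n add0n.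
  by rewrite leq_eqVlt eq_sym (negbTE ij).
rewrite a0 ?mul0r//; rewrite mnmBE mnmDE !mulmnE mnm1E eqxx g0 !mul1n add0n.
by rewrite -lt0n subn_gt0.
Qed.

Lemma slice_le i x : NA (slice i x) <= NB x.
Proof.
apply: gauss_le => g; have [g0|g0] := eqVneq (g i0) 0%N.
  by rewrite weight_shift//; apply: gauss_ub => //; exact: (tateP x).1.
by rewrite weight_shift0// rnorm_ge0.
Qed.

Lemma slice_max x : exists i, NB x = NA (slice i x).
Proof.
have [->|x0] := eqVneq x 0.
  exists 0%N; rewrite rnorm0; apply/eqP; rewrite eq_le rnorm_ge0 andTb.
  by have := slice_le 0 0; rewrite rnorm0.
have [g xg] := is_lead_exists r_gt0 (tateP x).1 x0.
exists (g i0); apply/eqP; rewrite eq_le slice_le andbT.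
rewrite tate_normE (gauss_lead r_ge0 (tateP x).1 xg).
pose h := (g - U_(i0) *+ g i0)%MM.
have h0 : h i0 = 0%N by rewrite mnmBE mulmnE mnm1E eqxx mul1n subnn.
have -> : weight v r x g = weight v r (shift (g i0) x) h.
  rewrite weight_shift// submK//; apply/mnm_lepP => i; rewrite mulmnE mnm1E.
  by case: (i0 =P i) => [<-|_]; rewrite ?mul1n// mul0n.
by apply: gauss_ub => //; exact: (tateP (slice (g i0) x)).1.
Qed.

Lemma slice_null x e : 0 < e -> exists n, forall i, (n <= i)%N -> NA (slice i x) <= e.
Proof.
move=> e0; have [N xN] := (tateP x).1 e e0; exists N => i Ni.
apply: gauss_le => g; have [g0|g0] := eqVneq (g i0) 0%N; last by rewrite weight_shift0// ltW.
by rewrite weight_shift// ltW// xN// mdeg_shift (leq_trans Ni)// leq_addl.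
Qed.

Lemma weight_slice j (x : B) g : g i0 = 0%N ->
  weight v r (slice j x) g = weight v r x (g + U_(i0) *+ j)%MM.
Proof. exact: weight_shift. Qed.

Lemma weight_slice0 j (x : B) g : g i0 != 0%N -> weight v r (slice j x) g = 0.
Proof. exact: weight_shift0. Qed.

Section Shear.
Variable c : 'I_m -> F.
Hypothesis c1 : forall i, v (c i) <= 1.

(** Only the variables before [i0] are moved, along [i0]. This preserves the series in the first i0
    + 1 variables, and the opposite vector gives the inverse. *)
Definition shear_forms : m.-tuple {mpoly F[m]} :=
  [tuple 'X_i + (if (i < i0)%N then c i else 0) *: 'X_i0 | i < m].

Lemma shear_linear : linear_forms shear_forms.
Proof.
move=> i; rewrite tnth_mktuple; apply: dhomogD; first by rewrite dhomogX; apply/eqP/mdeg1.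
by apply: dhomogZ; rewrite dhomogX; apply/eqP/mdeg1.
Qed.

Lemma shear_coef_le1 i h : v (tnth shear_forms i)@_h <= 1.
Proof.
rewrite tnth_mktuple mcoeffD mcoeffZ !mcoeffX (le_trans (absvalD _ _ _))// ge_max.
have b1 (b : bool) : v b%:R <= 1 by exact: absval_nat.
by rewrite b1 absvalM mulr_ile1 ?absval_ge0//; case: ifP; rewrite ?absval0 ?ler01.
Qed.

Lemma shear_uses (i : 'I_m) : (i < i0.+1)%N -> uses_first i0.+1 (coefs (tnth shear_forms i)).
Proof.
move=> ii0 g gn j ij; apply/eqP/negPn/negP => gj; move: gn; rewrite /coefs.
have Xg (l : 'I_m) : (l < i0.+1)%N -> (U_(l)%MM == g) = false.
  move=> li; apply: contra_neqF gj => /eqP <-; rewrite mnm1E.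
  by apply/eqP; rewrite eqb0; apply: contraTneq ij => <-; rewrite -ltnNge.
by rewrite tnth_mktuple mcoeffD mcoeffZ !mcoeffX !Xg// mulr0 addr0 eqxx.
Qed.

Definition shear (x : B) : B := mk_tate
  (null_at_subst shear_linear shear_coef_le1 r_ge0 (tateP x).1)
  (uses_first_subst shear_uses (tateP x).2).

Lemma shearM : {morph shear : x y / x * y}.
Proof. by move=> x y; apply: val_inj; exact: (substM (val x) (val y) shear_linear). Qed.

Lemma shear1 : shear 1 = 1.
Proof. by apply: val_inj; exact: subst_const. Qed.

Lemma shear0 : shear 0 = 0.
Proof.
apply: val_inj; rewrite /=; have := substD shear_forms 0 0.
by rewrite addr0 => /eqP; rewrite eq_sym -subr_eq0 addrK => /eqP.
Qed.

End Shear.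

Lemma shearK c c1 nc1 : cancel (@shear c c1) (@shear (fun i => - c i) nc1).
Proof.
move=> x; apply: val_inj; apply: subst_comp; try exact: shear_linear.
move=> i; rewrite tnth_mktuple comp_mpolyD comp_mpolyZ !comp_mpolyXU -!tnth_nth.
by rewrite !tnth_mktuple ltnn scale0r addr0; case: ifP => _; rewrite ?scaleNr ?subrK ?scale0r ?addr0.
Qed.

Lemma shearNK c c1 nc1 : cancel (@shear (fun i => - c i) nc1) (@shear c c1).
Proof.
have nnc1 i : v (- - c i) <= 1 by rewrite opprK.
have E : shear_forms c = shear_forms (fun i => - - c i).
  by apply: eq_from_tnth => i; rewrite !tnth_mktuple opprK.
move=> x; rewrite -[RHS](shearK nc1 nnc1 x); apply: val_inj.
exact: (congr1 (fun L => subst L (val (shear nc1 x))) E).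
Qed.

End AdjoinVariable.

(** At a unit vector every other monomial of degree D vanishes. This turns the coefficient wanted
    after a shear into a value of the form, which can be chosen large. *)
Lemma dhomog_coef_eval (F : fieldType) m (i0 : 'I_m) D (p : {mpoly F[m]}) :
  p \is D.-homog -> p@_(U_(i0) *+ D) = p.@[fun i => (i == i0)%:R].
Proof.
move=> ph; rewrite mevalE.
have prodE d : d \in msupp p ->
    \prod_i ((i == i0)%:R : F) ^+ d i = (d == (U_(i0) *+ D)%MM)%:R.
  move=> dp; have dD : mdeg d = D by exact: dhomog_mf ph d dp.
  case: (d =P _) => [->|dn].
    apply: big1 => i _; rewrite mulmnE mnm1E eq_sym.
    by case: eqP => _; rewrite ?expr1n// mul0n expr0.
  have [i [ii0 di]] : exists i, i != i0 /\ d i != 0%N.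
    apply: contrapT => h; apply: dn.
    have d0 i : i != i0 -> d i = 0%N.
      by move=> ii; apply/eqP/negPn/negP => di; apply: h; exists i.
    have di0 : d i0 = D.
      by rewrite -dD mdegE (bigD1 i0)//= big1 ?addn0.
    apply/mnmP => i; rewrite mulmnE mnm1E eq_sym.
    by case: (i =P i0) => [->|/eqP/d0->]; rewrite ?mul1n.
  by rewrite (bigD1 i)//= (negbTE ii0) expr0n (negbTE di) mul0r.
rewrite (eq_big_seq _ (fun d dp => congr1 (fun z => p@_d * z) (prodE d dp))).
have [Dp|Dp] := boolP ((U_(i0) *+ D)%MM \in msupp p).
  rewrite (bigD1_seq _ Dp) ?msupp_uniq//= eqxx mulr1 big1 ?addr0// => d dn.
  by rewrite (negbTE dn) mulr0.
rewrite memN_msupp_eq0// big1_seq// => d /= dp.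
by case: eqP => [E|_]; rewrite ?mulr0//; rewrite -E dp in Dp.
Qed.

Section Factoriality.
Variables (R : realType) (F : closedFieldType) (v : nonarch_absval R F).
Hypothesis vc : complete_absval v.
Variables (m : nat) (rho : F) (rho0 : rho != 0).

Let r := v rho.
Let r_gt0 : 0 < r. Proof. by rewrite absval_gt0. Qed.
Let r_ge0 := ltW r_gt0.

(* A generic shear makes the leading homogeneous part of x contain the pure
   power of the last variable with a coefficient of maximal absolute value. *)
Lemma shear_dominant (i0 : 'I_m) (x : tate v m i0.+1 rho) g : is_lead v r x g ->
  exists (c : 'I_m -> F) (c1 : forall i, v (c i) <= 1),
    weight v r (shear rho0 c1 x) (U_(i0) *+ mdeg g)%MM = weight v r x g /\
    forall h, weight v r (shear rho0 c1 x) h <= weight v r x g /\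
      ((mdeg g < mdeg h)%N -> weight v r (shear rho0 c1 x) h < weight v r x g).
Proof.
move=> [xg0 xg xg']; set W := weight v r x g in xg0 xg xg' *; set D := mdeg g.
pose H : {mpoly F[m]} := \sum_(d : 'X_{1..m < D.+1} | mdeg d == D) val x d *: 'X_[d].
have HE d : H@_d = if mdeg d == D then val x d else 0.
  rewrite /H raddf_sum /=; case: ifP => dD.
    have dD' : (mdeg d < D.+1)%N by rewrite (eqP dD).
    rewrite (bigD1 (BMultinom dD'))//= mcoeffZ mcoeffX eqxx mulr1 big1 ?addr0//.
    move=> k /andP[_ kd]; rewrite mcoeffZ mcoeffX.
    by case: (_ =P d) => [e|_]; rewrite ?mulr0//; case/eqP: kd; apply: val_inj.
  rewrite big1// => k kD; rewrite mcoeffZ mcoeffX.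
  by case: (_ =P d) => [e|_]; rewrite ?mulr0//; rewrite -e kD in dD.
have [c' [c'1 cH]] := mpoly_unit_point v H.
have c'0 i : c' i != 0 by rewrite -(absval_gt0 v) c'1.
(* A shear fixes the coordinate [i0] to 1. By homogeneity, dividing the point [c'] by its coordinate
   [i0], of absolute value 1, does not change the absolute value of [H] there. *)
pose c i := c' i / c' i0.
have c1 i : v (c i) <= 1 by rewrite absvalM absvalV !c'1 invr1 mulr1.
exists c, c1.
have Lh := shear_linear i0 c; have L1 := shear_coef_le1 i0 c1.
have y_le h : weight v r (shear rho0 c1 x) h <= W.
  by apply: subst_weight_le => //; exact: ltW.
split; last first.
  (* The order is graded, so monomials of degree above that of the leading one come after it and
     have strictly smaller weight. *)
  move=> h; split=> // gh; apply: subst_weight_lt => // k kh.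
  by apply: xg'; apply: lt_mdeg_ltmc; rewrite kh.
apply/eqP; rewrite eq_le y_le /=.
have Hh : H \is D.-homog.
  by apply/dhomogP => d; rewrite mcoeff_msupp HE; case: (mdeg d =P D) => //; rewrite eqxx.
have dHD d : d \in msupp H -> mdeg d = D by exact: dhomog_mf.
have HLh : H \mPo shear_forms i0 c \is D.-homog.
  rewrite comp_mpolyEX big_seq; apply: rpred_sum => d dH.
  by apply: dhomogZ; rewrite -(dHD _ dH); exact: dhomog_compX.
have DU : mdeg (U_(i0) *+ D)%MM = D by rewrite mdegMn mdeg1 mul1n.
have yE : val (shear rho0 c1 x) (U_(i0) *+ D)%MM = H.@[c'] / c' i0 ^+ D.
  rewrite [LHS](_ : _ = (H \mPo shear_forms i0 c)@_(U_(i0) *+ D)); last first.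
    apply: comp_coef_eq => // d; rewrite DU => dD.
    by rewrite mcoeff_trunc HE dD ltnSn eqxx.
  rewrite dhomog_coef_eval// comp_mpoly_meval !mevalE mulr_suml.
  apply: eq_big_seq => d dH; rewrite -mulrA; congr (_ * _).
  have xd : val x d != 0.
    by move: dH; rewrite mcoeff_msupp HE; case: ifP => //; rewrite eqxx.
  have -> : c' i0 ^+ D = \prod_i c' i0 ^+ d i.
    by rewrite -(dHD _ dH) mdegE expr_sum.
  rewrite -prodfV -big_split /=; apply: eq_bigr => i _.
  have [ii0|i0i] := leqP i i0; last by rewrite ((tateP x).2 _ xd i i0i) !expr0 invr1 mulr1.
  rewrite -expr_div_n; congr (_ ^+ _).
  rewrite tnth_mktuple mevalD mevalZ !mevalXU eqxx mulr1.
  have [->|ni] := eqVneq i i0; first by rewrite ltnn addr0 divff.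
  by rewrite ltn_neqAle ii0 andbT; rewrite ifT ?add0r.
have -> : weight v r (shear rho0 c1 x) (U_(i0) *+ D)%MM = v (H.@[c'] / c' i0 ^+ D) * r ^+ D.
  by rewrite -yE /weight DU.
rewrite absvalM absvalV absvalX c'1 expr1n invr1 mulr1 /W /weight.
rewrite ler_wpM2r ?exprn_ge0//.
by have := cH g; rewrite HE eqxx.
Qed.

(** After a shear, the coefficient of the D-th power of [zeta] is a unit and dominates; dividing by
    it gives a distinguished series, to which [distinguished_prime] applies. Primality then returns
    through the unit and the shear. *)
Lemma irreducible_prime (i0 : 'I_m) (x : tate v m i0.+1 rho) :
  factorial (tate v m i0 rho) -> irreducible x -> prime_elt x.
Proof.
move=> fA xirr; have x0 : x != 0 by case: xirr.
have [g xg] := is_lead_exists r_gt0 (tateP x).1 x0.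
have [c [c1 [yD yle]]] := shear_dominant xg.
have nc1 i : v (- c i) <= 1 by rewrite absvalN.
pose y := shear rho0 c1 x; pose D := mdeg g; pose W := weight v r x g.
have W0 : 0 < W by case: xg.
pose NA := tate_norm v m i0 rho0; pose NB := tate_norm v m i0.+1 rho0.
pose a := slice D y.
have a0 : weight v r a 0%MM = W by rewrite weight_slice ?mnm0E// add0m yD.
(* A nonconstant monomial of the slice comes from a monomial of degree above D, hence has smaller
   weight; so [a] is a unit. *)
have a_lt h : (0%MM < h)%O -> weight v r a h < W.
  move=> h0; have hd : (0 < mdeg h)%N.
    by rewrite lt0n mdeg_eq0; apply: contraTneq h0 => ->; rewrite ltxx.
  have [hi|hi] := eqVneq (h i0) 0%N; last by rewrite weight_slice0.
  rewrite weight_slice//; apply: (yle _).2.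
  by rewrite mdegD mdegMn mdeg1 mul1n -[ltnLHS]add0n ltn_add2r.
have alead : is_lead v r a 0%MM.
  split; rewrite ?a0// => h; have [->|h0] := eqVneq h 0%MM; rewrite ?a0//.
  by apply/ltW/a_lt; rewrite lt_neqAle eq_sym h0 le0m.
have [b ab] := tate_unit rho0 vc alead.
have NAa : NA a = W by rewrite /NA tate_normE (gauss_lead r_ge0 (tateP a).1 alead).
have NAb : NA b = W^-1.
  have := congr1 NA ab; rewrite rnormM rnorm1 NAa => E.
  by apply: (mulfI (lt0r_neq0 W0)); rewrite E divff ?gt_eqF.
pose f := widen b * y.
have fD : distinguished NA NB (@slice _ _ v m i0 rho) D f.
  have sl i : slice i f = b * slice i y.
    exact: (cf_scale (@sliceB _ _ v m i0 rho) (slice_monom rho0) (slice_le rho0)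
      (slice_max rho0) (slice_null rho0)).
  have NBf : NB f <= 1.
    rewrite rnormM; have -> : NB (widen b) = NA b by [].
    rewrite NAb ler_pdivrMl// mulr1; apply: gauss_le => h; exact: (yle h).1.
  split=> //; first by rewrite sl mulrC.
  move=> i Di; rewrite sl rnormM NAb ltr_pdivrMl// mulr1.
  apply: (gauss_lt r_gt0 (tateP _).1 W0) => h.
  have [hi|hi] := eqVneq (h i0) 0%N; last by rewrite weight_slice0.
  rewrite weight_slice//; apply: (yle _).2.
  by rewrite mdegD mdegMn mdeg1 mul1n (leq_trans Di)// leq_addl.
have wb : widen b * widen a = 1 by rewrite -rmorphM mulrC ab rmorph1.
have yirr : irreducible y.
  apply: (irreducible_transfer (s' := shear rho0 nc1)) => //.
  - exact: shearK.
  - exact: shearNK.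
  - exact: shear0.
  - exact: shear1.
  - exact: shearM.
have fp : prime_elt f.
  apply: (distinguished_prime (@sliceB _ _ v m i0 rho) (slice_monom rho0)
    (slice_le rho0) (slice_max rho0) (slice_null rho0) _ fA fD).
    exact: tate_norm_complete.
  exact: (irreducible_assoc wb yirr).
have yp : prime_elt y by exact: (prime_assoc wb fp).
apply: (prime_transfer (s := shear rho0 c1) (s' := shear rho0 nc1)) => //.
- exact: shearK.
- exact: shearNK.
- exact: shear0.
- exact: shear1.
- exact: shearM.
Qed.

(** With no variable, nonzero series are constants. Otherwise a second induction, on the degree of
    the leading monomial, splits a series into irreducible factors: the degree is additive and is
    positive on noninvertible elements. *)
Lemma tate_factorial k : (k <= m)%N -> factorial (tate v m k rho).
Proof.
elim: k => [_|k IH km].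
  move=> x x0; have [g xg] := is_lead_exists r_gt0 (tateP x).1 x0.
  have g0 : g = 0%MM.
    apply/mnmP => i; rewrite mnm0E; apply: ((tateP x).2 g _ i (leq0n _)).
    by rewrite -(weight_gt0 v _ _ r_gt0); case: xg.
  rewrite g0 in xg; have [y xy] := tate_unit rho0 vc xg.
  by exists x, [::]; rewrite big_nil mulr1; split => //; exists y.
move=> x x0; have [g xg] := is_lead_exists r_gt0 (tateP x).1 x0.
have [n] := ubnP (mdeg g); elim: n x x0 g xg => // n IHn x x0 g xg gn.
have [|nx] := pselect (invertible x).
  by exists x, [::]; rewrite big_nil mulr1.
have [xirr|nirr] := pselect (irreducible x).
  exists 1, [:: x]; rewrite big_seq1 mul1r; split => //; first by exists 1; rewrite mulr1.
  move=> p; rewrite inE => /eqP->.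
  exact: (@irreducible_prime (Ordinal km) x (IH (ltnW km)) xirr).
have [y [z [E ny nz]]] : exists y z, [/\ x = y * z, ~ invertible y & ~ invertible z].
  apply: contrapT => h; apply: nirr; split => // y z E.
  have [|ny] := pselect (invertible y); first by left.
  have [|nz] := pselect (invertible z); first by right.
  by case: h; exists y, z.
have y0 : y != 0 by apply: contra_neq x0; rewrite E => ->; rewrite mul0r.
have z0 : z != 0 by apply: contra_neq x0; rewrite E => ->; rewrite mulr0.
have [gy ygy] := is_lead_exists r_gt0 (tateP y).1 y0.
have [gz zgz] := is_lead_exists r_gt0 (tateP z).1 z0.
have gE : g = (gy + gz)%MM.
  apply: (is_lead_uniq xg); rewrite E; exact: (is_leadM r_gt0 ygy zgz).1.
have pos (w : tate v m k.+1 rho) h : is_lead v r w h -> ~ invertible w -> (0 < mdeg h)%N.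
  move=> wh nw; rewrite lt0n mdeg_eq0; apply/eqP => h0; apply: nw.
  by rewrite h0 in wh; have [u wu] := tate_unit rho0 vc wh; exists u.
move: gn; rewrite gE mdegD ltnS => gn.
have gyn : (mdeg gy < n)%N.
  by apply: leq_trans gn; rewrite -[ltnLHS]addn0 ltn_add2l (pos _ _ zgz).
have gzn : (mdeg gz < n)%N.
  by apply: leq_trans gn; rewrite -[ltnLHS]add0n ltn_add2r (pos _ _ ygy).
have [uy [sy [[uy' uyE] sy_p yE]]] := IHn y y0 gy ygy gyn.
have [uz [sz [[uz' uzE] sz_p zE]]] := IHn z z0 gz zgz gzn.
exists (uy * uz), (sy ++ sz); split.
- by exists (uy' * uz'); rewrite mulrACA uyE uzE mulr1.
- by move=> p; rewrite mem_cat => /orP[/sy_p|/sz_p].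
- by rewrite big_cat /= mulrACA -yE -zE.
Qed.

End Factoriality.

(** * Euclid's lemma for entire functions *)

(** Coprimality of [h] and [l] is stated as Euclid's property, the form used later. The prime
    factors p of [a] are treated one by one: p goes into [k] if it divides the current [l], and into
    [h] otherwise. *)
Lemma factorial_gcd (R : realType) (A : comNzRingType) (N : ring_norm R A) (a b : A) :
  factorial A -> a != 0 -> exists k h l, [/\ a = k * h, b = k * l &
    forall x y, h * y = l * x -> divides h x].
Proof.
move=> fA a0; have [u [s [[u' uu'] sp aE]]] := fA a a0.
elim: s a a0 aE sp => [|p s IH] a a0 aE sp.
  exists 1, u, b; rewrite !mul1r {1}aE big_nil mulr1; split => // x y _.
  by exists (u' * x); rewrite mulrA uu' mul1r.
pose a1 := u * \prod_(q <- s) q.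
have apE : a = p * a1 by rewrite aE big_cons mulrCA.
have a10 : a1 != 0 by apply: contra_neq a0; rewrite apE => ->; rewrite mulr0.
have sp' : {in s, forall q, prime_elt q} by move=> q qs; apply: sp; rewrite inE qs orbT.
have [p0 _ pp] : prime_elt p by apply: sp; rewrite mem_head.
have [k [h [l [khE klE hl]]]] := IH a1 a10 erefl sp'.
have h0 : h != 0 by apply: contra_neq a10; rewrite khE => ->; rewrite mulr0.
have [[l1 l1E]|npl] := pselect (divides p l).
  exists (k * p), h, l1; split.
  - by rewrite apE khE; ring.
  - by rewrite klE l1E mulrA.
  - move=> x y hy; apply: (hl x (p * y)).
    by rewrite l1E mulrCA hy mulrA.
exists k, (p * h), l; split => //; first by rewrite apE khE; ring.
move=> x y hy; have [|z xE] := hl x (p * y); first by rewrite -hy mulrA [p * h]mulrC.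
have : divides p (l * z).
  exists y; apply: (rnorm_mulI N h0).
  by rewrite mulrCA -xE -hy; ring.
case/pp => // -[t zE]; exists t; rewrite xE zE; ring.
Qed.

Lemma eventually_constant (d : nat -> nat) : (forall n, (d n.+1 <= d n)%N) ->
  exists N, forall n, (N <= n)%N -> d n = d N.
Proof.
move=> dn; have ex : exists k, `[< exists n, d n = k >] by exists (d 0%N); apply/asboolP; exists 0%N.
have [k /asboolP[N dN] kmin] := ex_minnP ex; exists N => n Nn.
have mono i : (d (N + i) <= d N)%N.
  by elim: i => [|i IH]; rewrite ?addn0// addnS (leq_trans (dn _)).
apply/eqP; rewrite eqn_leq -{1}(subnKC Nn) mono dN kmin//.
by apply/asboolP; exists n.
Qed.

Section NullSeries.
Variables (R : realType) (F : closedFieldType) (v : nonarch_absval R F).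
Hypothesis vc : complete_absval v.
Variable m : nat.
Implicit Types (x y z : series F m) (g : 'X_{1..m}) (r : R).

Lemma null_mulI r x y z : 0 < r -> null_at v r x -> null_at v r y -> null_at v r z ->
  x != 0 -> x * y = x * z -> y = z.
Proof.
move=> r0 nx ny nz x0 E; have nyz : null_at v r (y - z).
  by apply: null_atD; rewrite ?ltW//; exact: null_atN.
have : gauss v r x * gauss v r (y - z) = 0.
  by rewrite -gaussM// mulrBr E subrr gauss0// ltW.
move/eqP; rewrite mulf_eq0 => /orP[/eqP/(gauss_eq0 r0 nx)/eqP|/eqP/(gauss_eq0 r0 nyz)/eqP].
  by rewrite (negbTE x0).
by rewrite subr_eq0 => /eqP.
Qed.

Let full x : uses_first m x.
Proof. by move=> g _ i; rewrite leqNgt ltn_ord. Qed.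

Lemma null_gcd (rho : F) x y : rho != 0 ->
  null_at v (v rho) x -> null_at v (v rho) y -> x != 0 ->
  exists k h l, [/\ null_at v (v rho) k, null_at v (v rho) h,
    null_at v (v rho) l, x = k * h & y = k * l] /\
    forall a b, null_at v (v rho) a -> null_at v (v rho) b -> h * b = l * a ->
    exists2 z, null_at v (v rho) z & a = h * z.
Proof.
move=> rho0 nx ny x0; pose X := mk_tate nx (@full x); pose Y := mk_tate ny (@full y).
have X0 : X != 0 by apply: contra_neq x0 => /(congr1 val).
have [k [h [l [E1 E2 hl]]]] := factorial_gcd (tate_norm v m m rho0) Y
  (tate_factorial vc rho0 (leqnn m)) X0.
exists (val k), (val h), (val l); split.
  split; try exact: (tateP _).1.
    exact: (congr1 val E1).
  exact: (congr1 val E2).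
move=> a b na nb E; have [|z zE] := hl (mk_tate na (@full a)) (mk_tate nb (@full b)).
  exact: val_inj.
by exists (val z); [exact: (tateP z).1|exact: (congr1 val zE)].
Qed.

Lemma null_unit (rho : F) x : rho != 0 -> null_at v (v rho) x ->
  is_lead v (v rho) x 0%MM -> exists2 y, null_at v (v rho) y & x * y = 1.
Proof.
move=> rho0 nx xl; have [y xy] := tate_unit (x := mk_tate nx (@full x)) rho0 vc xl.
by exists (val y); [exact: (tateP y).1|exact: (congr1 val xy)].
Qed.

Lemma unif_lim_mul r u w x y : 0 < r ->
  (exists n, forall i, (n <= i)%N -> null_at v r (u i)) ->
  (exists n, forall i, (n <= i)%N -> null_at v r (w i)) ->
  unif_lim v r u x -> unif_lim v r w y ->
  unif_lim v r (fun n => u n * w n) (x * y).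
Proof.
move=> r0 nu nw ux wy e e0; have r0' := ltW r0.
have nx := unif_lim_null r0' ux nu; have ny := unif_lim_null r0' wy nw.
have X1 : 0 < gauss v r x + 1 by rewrite ltr_wpDl ?gauss_ge0.
have Y1 : 0 < gauss v r y + e by rewrite ltr_wpDl ?gauss_ge0.
have [n1 un] := ux _ (divr_gt0 e0 Y1); have [n2 wn] := wy _ (divr_gt0 e0 X1).
have [n3 wn'] := wy _ e0.
have [n4 nu'] := nu; have [n5 nw'] := nw.
exists (maxn (maxn n1 n2) (maxn n3 (maxn n4 n5))) => i.
rewrite !geq_max => /andP[/andP[i1 i2] /andP[i3 /andP[i4 i5]]] g.
have ni := nu' i i4; have nwi := nw' i i5.
have -> : u i * w i - x * y = (u i - x) * w i + x * (w i - y) by ring.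
have nuB : null_at v r (u i - x) by apply: null_atD => //; exact: null_atN.
have nwB : null_at v r (w i - y) by apply: null_atD => //; exact: null_atN.
rewrite (le_trans (weightD_le _ _ _ _ r0'))// ge_max; apply/andP; split.
  rewrite (le_trans (gauss_ub _ r0' (null_atM r0' nuB nwi)))// gaussM//.
  apply: (@le_trans _ _ (e / (gauss v r y + e) * (gauss v r y + e))); last first.
    by rewrite divfK ?gt_eqF.
  apply: ler_pM; rewrite ?gauss_ge0//; first exact: gauss_le (un i i1).
  rewrite -[w i](subrK y) (le_trans (gaussD r0' nwB ny))// ge_max.
  rewrite lerDl (ltW e0) andbT (le_trans (gauss_le (wn' i i3)))// lerDr gauss_ge0//.
rewrite (le_trans (gauss_ub _ r0' (null_atM r0' nx nwB)))// gaussM//.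
apply: (@le_trans _ _ ((gauss v r x + 1) * (e / (gauss v r x + 1)))); last first.
  by rewrite mulrC divfK ?gt_eqF.
apply: ler_pM; rewrite ?gauss_ge0//; last exact: gauss_le (wn i i2).
by rewrite lerDl ler01.
Qed.

Lemma unif_lim_uniq r u x y : 0 < r -> unif_lim v r u x -> unif_lim v r u y -> x = y.
Proof.
move=> r0 ux uy; apply/eqP; rewrite -subr_eq0; apply/eqP/funext => g.
apply/(absval_eq0 v); apply/le_anti; rewrite absval_ge0 andbT.
rewrite -(pmulr_lle0 _ (exprn_gt0 (mdeg g) r0)).
apply/ler_addgt0Pr => e e0; rewrite add0r.
have [n un] := ux e e0; have [k uk] := uy e e0; pose i := maxn n k.
rewrite -[_ * _]/(weight v r (x - y) g).
have -> : x - y = - (u i - x) + (u i - y) by ring.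
rewrite (le_trans (weightD_le _ _ _ _ (ltW r0)))// weightN ge_max.
by rewrite un ?uk// ?leq_maxl ?leq_maxr.
Qed.

Lemma unif_lim_const r x : unif_lim v r (fun=> x) x.
Proof. by move=> e e0; exists 0%N => i _ g; rewrite subrr weight0 ltW. Qed.

Lemma is_lead0_near r (c : F) x : 0 < r -> c != 0 -> null_at v r x ->
  gauss v r (x - series_const m c) < v c -> is_lead v r x 0%MM.
Proof.
move=> r0 c0 nx xc; have nc : null_at v r (series_const m c) by exact: null_at_const.
have nxc : null_at v r (x - series_const m c).
  by apply: null_atD; rewrite ?ltW//; exact: null_atN.
have wx g : g != 0%MM -> weight v r x g < v c.
  move=> g0; apply: le_lt_trans xc; have <- : weight v r (x - series_const m c) g = weight v r x g.
    rewrite /weight; congr (v _ * _); rewrite -[RHS]subr0.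
    by transitivity (x g - series_const m c g) => //; rewrite /series_const (negbTE g0).
  exact: gauss_ub (ltW r0) nxc.
have x0 : weight v r x 0%MM = v c.
  rewrite /weight mdeg0 mulr1; have -> : x 0%MM = c + (x - series_const m c) 0%MM.
    by transitivity (c + (x 0%MM - series_const m c 0%MM)) => //; rewrite /series_const eqxx addrC subrK.
  apply: absvalD_eq; apply: le_lt_trans xc.
  by have := gauss_ub 0%MM (ltW r0) nxc; rewrite /weight mdeg0 mulr1.
split; rewrite ?x0 ?absval_gt0// => g.
  by have [->|/wx/ltW//] := eqVneq g 0%MM; rewrite x0.
by move=> g0; apply: wx; apply: contraTneq g0 => ->; rewrite ltxx.
Qed.

(** On radius s the terms are bounded by the constant term 1. Passing to radius r multiplies a term
    of degree n >= 1 by (r / s)^n, at most r / s: units on large polydiscs are close to 1 on small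
    ones. *)
Lemma near1_of_lead r s x g : 0 <= r -> r <= s -> 0 < s ->
  x 0%MM = 1 -> is_lead v s x 0%MM -> weight v r (x - 1) g <= r / s.
Proof.
move=> r0 rs s0 x1 [_ xs _].
have E : (x - 1) g = x g - series_const m 1 g by [].
rewrite /weight E /series_const; have [->|g0] := eqVneq g 0%MM.
  by rewrite x1 subrr absval0 mul0r divr_ge0// ltW.
rewrite subr0; have := xs g; rewrite /weight mdeg0 mulr1 x1 absval1 => xg.
have rE : r ^+ mdeg g = s ^+ mdeg g * (r / s) ^+ mdeg g.
  by rewrite -exprMn mulrC divfK ?gt_eqF.
have rs1 : r / s <= 1 by rewrite ler_pdivrMr// mul1r.
rewrite rE mulrA (@le_trans _ _ ((r / s) ^+ mdeg g))//.
  by rewrite ler_piMl// exprn_ge0// divr_ge0// ltW.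
rewrite -[leRHS]expr1 ler_wiXn2l ?divr_ge0 ?(ltW s0)//.
by rewrite lt0n mdeg_eq0.
Qed.

End NullSeries.

(** * Gluing the gcds of an exhausting sequence of polydiscs *)

Section Gluing.
Variables (R : realType) (F : closedFieldType) (v : nonarch_absval R F).
Hypothesis vc : complete_absval v.
Variables (m : nat) (rho : F) (rho1 : 1 < v rho).
Implicit Types (x y z : series F m).

Let r n := v (rho ^+ n).
Let rE n : r n = v rho ^+ n. Proof. exact: absvalX. Qed.
Let rho_neq0 n : rho ^+ n != 0.
Proof. by rewrite expf_neq0// -(absval_gt0 v) (lt_trans ltr01). Qed.
Let r_gt0 n : 0 < r n. Proof. by rewrite absval_gt0. Qed.
Let r_ge0 n := ltW (r_gt0 n).
Let r_le i j : (i <= j)%N -> r i <= r j.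
Proof. by move=> ij; rewrite !rE ler_weXn2l// ltW. Qed.

Let null_le i j x : (i <= j)%N -> null_at v (r j) x -> null_at v (r i) x.
Proof. by move=> /r_le; apply: le_null_at. Qed.

Let inv_rho_small e : 0 < e -> exists n, (v rho)^-1 ^+ n <= e.
Proof.
move=> e0; have rho0 := lt_trans ltr01 rho1.
have [||n nP] := @expr_small _ (v rho)^-1 e _ _ e0.
- by rewrite invr_ge0 ltW.
- by rewrite invf_lt1.
by exists n; apply: nP.
Qed.

Definition null_all x := forall n, null_at v (r n) x.

Lemma null_all_entire x : null_all x -> is_entire v x.
Proof.
move=> nx s s0; have s1 : 0 < s + 1 by rewrite ltr_wpDl.
have [|n nP] := @inv_rho_small (s + 1)^-1; first by rewrite invr_gt0.
apply: le_null_at (nx n) => //; rewrite rE.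
move: nP; rewrite exprVn lef_pV2 ?posrE ?exprn_gt0// ?(lt_trans ltr01)//.
by apply: le_trans; rewrite lerDl ler01.
Qed.

Local Notation C c := (series_const m c : series F m).

Let C_neq0 c : c != 0 -> C c * C c^-1 = 1.
Proof. by move=> c0; rewrite -series_constMM divff. Qed.

Let null_C s c : null_at v s (C c). Proof. exact: null_at_const. Qed.

Section Approximation.
Variables z : nat -> series F m.
Hypothesis z0 : exists N, forall n, (N <= n)%N -> z n 0%MM = 1.
Hypothesis zl : forall i, exists N, forall n, (N <= n)%N ->
  is_lead v (r i) (z n) 0%MM /\ null_at v (r i) (z n).

Let z_near1 i e : 0 < e -> exists N, forall n, (N <= n)%N ->
  [/\ null_at v (r i) (z n), gauss v (r i) (z n) = 1 & gauss v (r i) (z n - 1) <= e].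
Proof.
move=> e0; have [t te] := inv_rho_small e0; have [N0 zN0] := z0.
have [N1 zN1] := zl i; have [N2 zN2] := zl (i + t).
exists (maxn N0 (maxn N1 N2)) => n; rewrite !geq_max => /andP[n0 /andP[n1 n2]].
have [zi nzi] := zN1 n n1; split => //.
  by rewrite (gauss_lead (r_ge0 i) nzi zi) /weight zN0// absval1 mdeg0 mulr1.
apply: gauss_le => g; apply: le_trans te.
have -> : (v rho)^-1 ^+ t = r i / r (i + t).
  have rho0 : v rho != 0 by rewrite gt_eqF// (lt_trans ltr01).
  by rewrite !rE exprD invfM mulrA divff ?mul1r ?exprVn// expf_neq0.
apply: near1_of_lead; rewrite ?r_ge0 ?r_gt0 ?r_le ?leq_addr ?zN0//.
by case: (zN2 n n2).
Qed.

(** Eventually [z n] has norm 1, so the norm of [u n] becomes constant, and the differences are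
    bounded by this constant times |z n - 1|. The two forms of the recurrence are those of the
    cofactors and of the gcds. *)
Lemma telescoping_slow (u : nat -> series F m) i :
  (exists N, forall n, (N <= n)%N -> null_at v (r i) (u n)) ->
  (forall n, u n.+1 = u n * z n) \/ (forall n, u n = u n.+1 * z n) ->
  slow v (r i) u.
Proof.
move=> [N0 nu] uz; have [N1 zN1] := z_near1 i ltr01; pose N := maxn N0 N1.
have uc n : (N <= n)%N -> gauss v (r i) (u n.+1) = gauss v (r i) (u n).
  rewrite geq_max => /andP[n0 n1]; have [nz z1 _] := zN1 n n1.
  case: uz => E; first by rewrite E (gaussM (r_gt0 i) (nu n n0) nz) z1 mulr1.
  by rewrite [in RHS]E (gaussM (r_gt0 i) (nu _ (leqW n0)) nz) z1 mulr1.
have uM n : (N <= n)%N -> gauss v (r i) (u n) = gauss v (r i) (u N).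
  move=> Nn; rewrite -(subnKC Nn); elim: (n - N)%N => [|t IH]; first by rewrite addn0.
  by rewrite addnS uc ?leq_addr.
move=> e e0; set M := gauss v (r i) (u N) in uM.
have M0 : 0 <= M by apply: gauss_ge0 => //; apply: nu; rewrite leq_maxl.
have M1 : 0 < M + 1 by rewrite ltr_wpDl.
have [N2 zN2] := z_near1 i (divr_gt0 e0 M1).
exists (maxn N N2) => n; rewrite geq_max => /andP[Nn n2] g.
have [nz _ ze] := zN2 n n2.
have nu' k : (N <= k)%N -> null_at v (r i) (u k).
  by move=> Nk; apply: nu; rewrite (leq_trans _ Nk)// leq_maxl.
have nz1 : null_at v (r i) (z n - 1) by apply: null_atD => //; apply/null_atN/null_C.
have key k : (N <= k)%N -> weight v (r i) (u k * (z n - 1)) g <= e.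
  move=> Nk; rewrite (le_trans (gauss_ub _ (r_ge0 i) (null_atM (r_ge0 i) (nu' k Nk) nz1)))//.
  rewrite (gaussM (r_gt0 i) (nu' k Nk) nz1) uM// (@le_trans _ _ ((M + 1) * (e / (M + 1))))//.
    apply: ler_pM => //; first exact: gauss_ge0.
    by rewrite lerDl ler01.
  by rewrite mulrC divfK ?gt_eqF.
case: uz => E.
  by rewrite E -[X in _ - X]mulr1 -mulrBr key.
have -> : u n.+1 - u n = - (u n.+1 * (z n - 1)) by rewrite (E n); ring.
by rewrite weightN key// leqW.
Qed.

Lemma telescoping_limit (u : nat -> series F m) :
  (forall i n, (i <= n)%N -> null_at v (r i) (u n)) ->
  (forall n, u n.+1 = u n * z n) \/ (forall n, u n = u n.+1 * z n) ->
  exists x, null_all x /\ forall i, unif_lim v (r i) u x.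
Proof.
move=> nu uz; have su i : slow v (r i) u.
  by apply: telescoping_slow uz; exists i; exact: nu.
have [x ux] := slow_coef_lim vc (r_gt0 0) (su 0%N); exists x.
have ul i := slow_unif_lim (r_ge0 i) (su i) ux; split => // i.
by apply: unif_lim_null (ul i) _ => //; exists i; exact: nu.
Qed.

End Approximation.

(* The gcd K n of f0 and f1 on the disc of radius r n divides the restriction
   of K (n + 1) up to z n: on a fixed disc the degree of the leading monomial of
   K n can only decrease finitely often, so that z n is eventually a unit there.
   Normalized by z n 0 = 1 it then tends to 1, and K n converges. *)
Lemma glued_gcd f0 f1 : null_all f0 -> null_all f1 -> f0 != 0 ->
  exists k h l, [/\ null_all k, null_all h, null_all l, f0 = k * h & f1 = k * l] /\
  forall c k', c != 0 -> null_all k' -> k * k' = C c ->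
  forall x y, null_all x -> null_all y -> f0 * y = f1 * x ->
  forall i, exists2 t, null_at v (r i) t & x = f0 * t.
Proof.
move=> nf0 nf1 f0n0.
have /choice[T TP] : forall n, exists t : series F m * series F m * series F m,
    [/\ null_at v (r n) t.1.1, null_at v (r n) t.1.2, null_at v (r n) t.2,
        f0 = t.1.1 * t.1.2 & f1 = t.1.1 * t.2] /\
    forall a b, null_at v (r n) a -> null_at v (r n) b -> t.1.2 * b = t.2 * a ->
      exists2 z, null_at v (r n) z & a = t.1.2 * z.
  move=> n; have [k [h [l P]]] := null_gcd vc (rho_neq0 n) (nf0 n) (nf1 n) f0n0.
  by exists (k, h, l).
pose K n := (T n).1.1; pose H n := (T n).1.2; pose L n := (T n).2.
have nK i n : (i <= n)%N -> null_at v (r i) (K n).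
  by move=> jn; apply: null_le jn _; case: (TP n) => -[].
have nH i n : (i <= n)%N -> null_at v (r i) (H n).
  by move=> jn; apply: null_le jn _; case: (TP n) => -[].
have nL i n : (i <= n)%N -> null_at v (r i) (L n).
  by move=> jn; apply: null_le jn _; case: (TP n) => -[].
have f0E n : f0 = K n * H n by case: (TP n) => -[].
have f1E n : f1 = K n * L n by case: (TP n) => -[].
have euclid n a b : null_at v (r n) a -> null_at v (r n) b -> H n * b = L n * a ->
    exists2 z, null_at v (r n) z & a = H n * z by case: (TP n) => _; apply.
have K0 n : K n != 0 by apply: contra_neq f0n0; rewrite (f0E n) => ->; rewrite mul0r.
have H0 n : H n != 0 by apply: contra_neq f0n0; rewrite (f0E n) => ->; rewrite mulr0.
have /choice[z zP] : forall n, exists z, [/\ null_at v (r n) z,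
    H n.+1 = H n * z, K n = K n.+1 * z & L n.+1 = L n * z].
  move=> n; have [nn nn1] := (leqnn n, leqnSn n).
  (* Times [K n], both sides equal [K n.+1 * H n.+1 * L n.+1]; the coprimality of [H n] and [L n]
     then provides the transition factor. *)
  have E : H n * L n.+1 = L n * H n.+1.
    apply: (null_mulI (r_gt0 n) (nK n n nn)) => //.
    - by apply: null_atM => //; [exact: nH|exact: nL].
    - by apply: null_atM => //; [exact: nL|exact: nH].
    by rewrite !mulrA -f0E -f1E {1}(f0E n.+1) (f1E n.+1); ring.
  have [|z nz zE] := euclid n (H n.+1) (L n.+1) (nH _ _ nn1) _ E; first exact: nL.
  have KE : K n = K n.+1 * z.
    apply: (null_mulI (r_gt0 n) (nH n n nn)) => //; first exact: nK.
      by apply: null_atM => //; exact: nK.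
    by rewrite mulrC -f0E (f0E n.+1) zE; ring.
  exists z; split => //; apply: (null_mulI (r_gt0 n) (nK n n.+1 nn1)) => //.
  - exact: nL.
  - by apply: null_atM => //; exact: nL.
  by rewrite -f1E (f1E n) {1}KE; ring.
have nz i n : (i <= n)%N -> null_at v (r i) (z n).
  by move=> jn; apply: null_le jn _; case: (zP n).
have HE n : H n.+1 = H n * z n by case: (zP n).
have KE n : K n = K n.+1 * z n by case: (zP n).
have LE n : L n.+1 = L n * z n by case: (zP n).
have zn0 n : z n != 0 by apply: contra_neq (H0 n.+1); rewrite HE => ->; rewrite mulr0.
have zlead i : exists N, forall n, (N <= n)%N -> is_lead v (r i) (z n) 0%MM.
  have /choice[G GP] : forall n, exists g, is_lead v (r i) (K (n + i)%N) g.
    by move=> n; apply: is_lead_exists => //; apply: nK; rewrite leq_addl.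
  have GE n : exists g, is_lead v (r i) (z (n + i)%N) g /\ G n = (G n.+1 + g)%MM.
    have [g gl] := is_lead_exists (r_gt0 i) (nz i _ (leq_addl n i)) (zn0 (n + i)%N).
    exists g; split => //; apply: is_lead_uniq (GP n) _.
    by rewrite KE; case: (is_leadM (r_gt0 i) (GP n.+1) gl).
  have [|N NP] := @eventually_constant (fun n => mdeg (G n)).
    by move=> n; have [g [_ ->]] := GE n; rewrite mdegD leq_addr.
  exists (N + i)%N => n Nn; have iN : (i <= n)%N by rewrite (leq_trans _ Nn)// leq_addl.
  have Nni : (N <= n - i)%N by rewrite leq_subRL// addnC.
  have [g [gl gE]] := GE (n - i)%N; rewrite subnK// in gl.
  have : mdeg g == 0%N.
    have := congr1 (@mdeg m) gE; rewrite mdegD !NP// ?leqW// => /eqP.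
    by rewrite -{1}[mdeg (G N)]addn0 eqn_add2l eq_sym.
  by rewrite mdeg_eq0 => /eqP <-.
(* The constant term of [z n] may vanish for finitely many n; the default value 1 keeps every [b n]
   invertible. *)
pose w n := if z n 0%MM == 0 then 1 else z n 0%MM.
have w0 n : w n != 0 by rewrite /w; case: ifPn => // _; rewrite oner_neq0.
pose b n := \prod_(i < n) w i.
have b0 n : b n != 0 by apply/prodf_neq0 => i _.
have bS n : b n.+1 = b n * w n by rewrite /b big_ord_recr.
pose z' n := C (w n)^-1 * z n.
(* Opposite scalings keep the products K' H' = f0 and K' L' = f1 fixed while the transition factor
   becomes [z' n]. *)
pose K' n := C (b n) * K n; pose H' n := C (b n)^-1 * H n; pose L' n := C (b n)^-1 * L n.
have z'0 : exists N, forall n, (N <= n)%N -> z' n 0%MM = 1.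
  have [N NP] := zlead 0%N; exists N => n /NP[z00 _ _].
  rewrite /z' series_constM /w; move: z00; rewrite weight_gt0// => z00.
  by rewrite (negbTE z00) mulVf.
have z'l i : exists N, forall n, (N <= n)%N ->
    is_lead v (r i) (z' n) 0%MM /\ null_at v (r i) (z' n).
  have [N NP] := zlead i; exists (maxn N i) => n; rewrite geq_max => /andP[Nn jn].
  split; last by apply: null_atM => //; exact: nz.
  have wl : is_lead v (r i) (C (w n)^-1) 0%MM by apply: is_lead_const; rewrite invr_eq0.
  by have [] := is_leadM (r_gt0 i) wl (NP n Nn); rewrite addm0.
have K'E n : K' n = K' n.+1 * z' n.
  have E : C (b n) = C (b n.+1) * C (w n)^-1 by rewrite -series_constMM bS mulfK.
  by rewrite /K' /z' E {1}KE; ring.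
have binv n : C (b n.+1)^-1 = C (b n)^-1 * C (w n)^-1.
  by rewrite -series_constMM bS invfM.
have H'E n : H' n.+1 = H' n * z' n by rewrite /H' /z' binv HE; ring.
have L'E n : L' n.+1 = L' n * z' n by rewrite /L' /z' binv LE; ring.
have nK' i n : (i <= n)%N -> null_at v (r i) (K' n).
  by move=> jn; apply: null_atM => //; exact: nK.
have nH' i n : (i <= n)%N -> null_at v (r i) (H' n).
  by move=> jn; apply: null_atM => //; exact: nH.
have nL' i n : (i <= n)%N -> null_at v (r i) (L' n).
  by move=> jn; apply: null_atM => //; exact: nL.
have [k [nk kl]] := telescoping_limit z'0 z'l nK' (or_intror K'E).
have [h [nh hl]] := telescoping_limit z'0 z'l nH' (or_introl H'E).
have [l [nl ll]] := telescoping_limit z'0 z'l nL' (or_introl L'E).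
have Cb n : C (b n) * C (b n)^-1 = 1 by exact: C_neq0.
have f0E' n : K' n * H' n = f0.
  by rewrite /K' /H' mulrACA Cb mul1r -f0E.
have f1E' n : K' n * L' n = f1.
  by rewrite /K' /L' mulrACA Cb mul1r -f1E.
exists k, h, l; split.
  split => //.
    apply: (unif_lim_uniq (r_gt0 0) (unif_lim_const v (r 0) f0)).
    have -> : (fun=> f0) = fun n => K' n * H' n by apply/funext => n; rewrite f0E'.
    by apply: unif_lim_mul => //; exists 0%N => n; [exact: nK'|exact: nH'].
  apply: (unif_lim_uniq (r_gt0 0) (unif_lim_const v (r 0) f1)).
  have -> : (fun=> f1) = fun n => K' n * L' n by apply/funext => n; rewrite f1E'.
  by apply: unif_lim_mul => //; exists 0%N => n; [exact: nK'|exact: nL'].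
(* For large n, K' n k' is close to the nonzero constant c, hence a unit on the polydisc of radius
   [r i]. Thus [K' n] is invertible there, and the divisibility of [x] by [H n] becomes divisibility
   by [f0]. *)
move=> c k' c0 nk' kk' x y nx ny xy i.
have vc0 : 0 < v c / 2 by rewrite divr_gt0// absval_gt0.
have [||N NP] := unif_lim_mul (r_gt0 i) _ _ (kl i) (unif_lim_const v (r i) k') vc0.
- by exists i; exact: nK'.
- by exists 0%N => n _; exact: nk'.
pose n := maxn N i; have jn : (i <= n)%N by rewrite leq_maxr.
have Nn : (N <= n)%N by rewrite leq_maxl.
have nKk : null_at v (r i) (K' n * k') by apply: null_atM => //; exact: nK'.
have Kk_lead : is_lead v (r i) (K' n * k') 0%MM.
  apply: (is_lead0_near (c := c)) => //; rewrite -kk'.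
  apply: (@le_lt_trans _ _ (v c / 2)); first by apply: gauss_le; exact: NP.
  have : 0 < v c by rewrite absval_gt0.
  by move=> ?; lra.
have [s ns sE] := null_unit vc (rho_neq0 i) nKk Kk_lead.
have E : H n * y = L n * x.
  apply: (null_mulI (r_gt0 n) (nK n n (leqnn n))) => //.
  - by apply: null_atM => //; exact: nH.
  - by apply: null_atM => //; exact: nL.
  by rewrite !mulrA -f0E -f1E.
have [t nt tE] := euclid n x y (nx n) (ny n) E.
exists (t * C (b n) * k' * s).
  by do 3!(apply: null_atM => //); exact: null_le nt.
by rewrite (f0E n) -[LHS]mulr1 -sE tE /K'; ring.
Qed.

End Gluing.

Section EntireEuclid.
Variables (R : realType) (F : closedFieldType) (v : nonarch_absval R F).
Hypothesis vc : complete_absval v.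
Variable m : nat.
Implicit Types f g h : entire v m.

Local Notation C c := (series_const m c : series F m).

Definition mk_entire (x : series F m) (ex : is_entire v x) : entire v m :=
  Entire (introT (asboolP _) ex).

Lemma entire_null f r : 0 <= r -> null_at v r (val f).
Proof. exact: entireP. Qed.

(** Applied to inverses, the bound makes every nonzero element of absolute value 1, so a null series
    has finitely many terms. *)
Lemma trivial_null_entire (x : series F m) : (forall c, v c <= 1) ->
  null_at v 1 x -> is_entire v x.
Proof.
move=> vt nx r r0 e e0; have [N xN] := nx 1 ltr01; exists N => g /xN.
rewrite /weight expr1n mulr1 => xg.
suff -> : x g = 0 by rewrite absval0 mul0r.
apply/eqP/negPn/negP => xg0; have := vt (x g)^-1.
by rewrite absvalV invf_le1 ?absval_gt0// leNgt xg.
Qed.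

(** The common divisor built from the polydiscs is entire, so relative primality makes it divide a
    constant, which is what the local form of Euclid's lemma asks for. *)
Lemma entire_euclid f0 f1 g : f0 != 0 -> relatively_prime f0 f1 ->
  divides f0 (f1 * g) -> divides f0 g.
Proof.
move=> f0n0 [c c0 [_ _ gcdP]] [q qE].
have f0n0' : val f0 != 0 :> series F m by apply: contra_neq f0n0 => E; exact: val_inj.
have CE : C c^-1 * C c = 1.
  by rewrite -series_constMM mulVf.
have common (k h l : series F m) : is_entire v k -> is_entire v h ->
    is_entire v l -> val f0 = k * h -> val f1 = k * l ->
    exists2 k' : series F m, is_entire v k' & k * k' = C c.
  move=> ek eh el E0 E1; have [||k' k'E] := gcdP (mk_entire ek).
  - by exists (mk_entire eh); exact: val_inj.
  - by exists (mk_entire el); exact: val_inj.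
  by exists (val k'); [exact: entireP|exact: (esym (congr1 val k'E))].
have valE : (val f0 : series F m) * val q = (val f1 : series F m) * val g.
  exact: (esym (congr1 val qE)).
have [[rho rho1]|vt] := pselect (exists rho, 1 < v rho).
  have na f : null_all v rho (val f) by move=> n; apply: entire_null; exact: absval_ge0.
  have [k [h [l [[nk nh nl E0 E1] P]]]] := glued_gcd vc rho1 (na f0) (na f1) f0n0'.
  have [k' ek' kk'] := common k h l (null_all_entire rho1 nk) (null_all_entire rho1 nh)
    (null_all_entire rho1 nl) E0 E1.
  have nk' : null_all v rho k' by move=> n; apply: ek'; exact: absval_ge0.
  have divl := P c k' c0 nk' kk' _ _ (na g) (na q) valE.
  have [t nt tE] := divl 0%N.
  (* The quotients on the various polydiscs agree by cancellation of [f0], so the one on the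
     smallest converges on all of them. *)
  have nt' : null_all v rho t.
    move=> i; have [t' nt' t'E] := divl i; suff -> : t = t' by [].
    have r0 : 0 < v (rho ^+ 0) by rewrite absval1.
    apply: (null_mulI r0 (na f0 0%N) nt) => //; last by rewrite -tE t'E.
    apply: le_null_at nt'; rewrite ?absval_ge0// !absvalX.
    by rewrite ler_weXn2l// ltW.
  by exists (mk_entire (null_all_entire rho1 nt')); exact: val_inj.
have vt1 x : v x <= 1 by rewrite leNgt; apply/negP => x1; apply: vt; exists x.
have n1 f : null_at v (v 1) (val f) by apply: entire_null; exact: absval_ge0.
have ent (x : series F m) : null_at v (v 1) x -> is_entire v x.
  by rewrite absval1; exact: trivial_null_entire.
have [k [h [l [[nk nh nl E0 E1] P]]]] := null_gcd vc (oner_neq0 F) (n1 f0) (n1 f1) f0n0'.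
have [k' ek' kk'] := common k h l (ent _ nk) (ent _ nh) (ent _ nl) E0 E1.
have k0 : k != 0 by apply: contra_neq f0n0'; rewrite E0 => ->; rewrite mul0r.
have r1 : 0 < v 1 by rewrite absval1.
have [|z nz zE] := P (val g) (val q) (n1 g) (n1 q).
  apply: (null_mulI r1 nk) => //.
  - by apply: null_atM => //; exact: absval_ge0.
  - by apply: null_atM => //; exact: absval_ge0.
  by rewrite !mulrA -E0 -E1.
(* Since k k' = c, the quotient by f0 = k h of the multiple h z is c^-1 k' z. *)
have et : is_entire v (C c^-1 * (k' : series F m) * z).
  by apply: is_entire_prod; [apply: is_entire_prod => //; exact: is_entire_const|exact: ent].
have E : (val g : series F m) = (val f0 : series F m) * (C c^-1 * (k' : series F m) * z).
  rewrite E0 zE; transitivity (C c^-1 * C c * (h * z)); first by rewrite CE mul1r.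
  by rewrite -kk'; ring.
by exists (mk_entire et); exact: val_inj.
Qed.

End EntireEuclid.

(** * Derivatives and Wronskians *)

Section EntireNorm.
Variables (R : realType) (F : closedFieldType) (v : nonarch_absval R F) (m : nat).
Implicit Types f g h : entire v m.

Lemma entire_normM f g r : 0 < r ->
  entire_norm (f * g) r = entire_norm f r * entire_norm g r.
Proof. by move=> r0; apply: gaussM => //; apply: entire_null; exact: ltW. Qed.

Lemma entire_norm_gt0 f r : 0 < r -> f != 0 -> 0 < entire_norm f r.
Proof.
move=> r0 f0; have nf := entire_null f (ltW r0).
rewrite lt0r gauss_ge0 ?andbT ?ltW//; apply/eqP => /(gauss_eq0 r0 nf) E.
by case/eqP: f0; exact: val_inj.
Qed.

Lemma entire_mul_neq0 f g : f != 0 -> g != 0 -> f * g != 0.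
Proof.
move=> f0 g0; apply/eqP => fg.
have := mulr_gt0 (entire_norm_gt0 ltr01 f0) (entire_norm_gt0 ltr01 g0).
rewrite -entire_normM ?ltr01// fg.
by rewrite [X in 0 < X](_ : _ = 0) ?ltxx//; exact: (gauss0 v m ler01).
Qed.

Lemma entire_mulfI f g h : f != 0 -> f * g = f * h -> g = h.
Proof.
move=> f0 /eqP; rewrite -subr_eq0 -mulrBr => E; apply/eqP; rewrite -subr_eq0.
by apply: contraTT E => gh; exact: entire_mul_neq0.
Qed.

Lemma entire_norm_le f r s : 0 < r -> r <= s -> entire_norm f r <= entire_norm f s.
Proof.
move=> r0 rs; have s0 := lt_le_trans r0 rs; apply: gauss_le => g.
apply: le_trans (gauss_ub g (ltW s0) (entire_null f (ltW s0))).
by rewrite /weight ler_wpM2l ?absval_ge0// lerXn2r// nnegrE ltW.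
Qed.

Lemma entire_normB_le f g r M : 0 < r -> entire_norm f r <= M -> entire_norm g r <= M ->
  entire_norm (f - g) r <= M.
Proof.
move=> r0 fM gM; have nf h := entire_null h (ltW r0).
apply: le_trans (gaussD (ltW r0) (nf f) (null_atN (nf g))) _.
by rewrite ge_max fM gaussN.
Qed.

(** Integer factors have absolute value at most 1; only the drop of the degree by one remains. *)
Lemma entire_norm_deriv j f r : 0 < r ->
  entire_norm (entire_deriv j f) r <= entire_norm f r / r.
Proof.
move=> r0; apply: gauss_le => g; rewrite ler_pdivlMr//.
apply: le_trans (gauss_ub (g + U_(j))%MM (ltW r0) (entire_null f (ltW r0))).
rewrite /weight mdegD mdeg1 addn1 exprSr mulrA ler_pM2r// ler_pM2r ?exprn_gt0//.
change (v (val f (g + U_(j))%MM *+ (g j).+1) <= v (val f (g + U_(j))%MM)).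
rewrite -mulr_natr absvalM.
by rewrite ler_piMr ?absval_ge0// absval_nat.
Qed.

Lemma entire_derivD j f g :
  entire_deriv j (f + g) = entire_deriv j f + entire_deriv j g.
Proof. by apply: val_inj; apply/funext => k; exact: mulrnDl. Qed.

Lemma entire_derivM j f g :
  entire_deriv j (f * g) = entire_deriv j f * g + f * entire_deriv j g.
Proof.
apply: val_inj; apply/funext => k.
pose t (x : series F m) := trunc (mdeg k).+2 x.
have kU : (mdeg (k + U_(j))%MM < (mdeg k).+2)%N by rewrite mdegD mdeg1 addn1.
have D (x : series F m) (h : 'X_{1..m}) : (mdeg h <= mdeg k)%N -> ((t x)^`M(j))@_h = series_deriv j x h.
  by move=> hk; rewrite mcoeff_deriv mcoeff_trunc mdegD mdeg1 addn1 !ltnS hk.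
have T (x : series F m) (h : 'X_{1..m}) : (mdeg h <= mdeg k)%N -> (t x)@_h = x h.
  by move=> hk; rewrite mcoeff_trunc ltnS (leq_trans hk).
have M (x y : series F m) p q : (forall h : 'X_{1..m}, (mdeg h <= mdeg k)%N -> p@_h = x h) ->
    (forall h : 'X_{1..m}, (mdeg h <= mdeg k)%N -> q@_h = y h) -> (p * q)@_k = (x * y) k.
  move=> px qy; rewrite mcoeffM; apply: eq_bigr => -[a b] /= _.
  by rewrite px ?qy// -ltnS bmdeg.
transitivity (((val f : series F m) * val g) (k + U_(j))%MM *+ (k j).+1); first by [].
rewrite (seriesM_trunc _ _ kU) -mcoeff_deriv mderivM mcoeffD.
transitivity (((series_deriv j (val f) : series F m) * val g) k +
  ((val f : series F m) * series_deriv j (val g)) k); last by [].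
by congr (_ + _); apply: M => h hk; rewrite ?D ?T.
Qed.

Lemma entire_deriv0 j : entire_deriv j (0 : entire v m) = 0.
Proof. by apply: val_inj; apply/funext => k; exact: mul0rn. Qed.

(* |f'|_r <= |f|_r / r for all r excludes f' = f t with t <> 0. *)
Lemma deriv_not_multiple j f : divides f (entire_deriv j f) -> entire_deriv j f = 0.
Proof.
case=> t E; have [f0|f0] := eqVneq f 0; first by rewrite f0 entire_deriv0.
have [t0|t0] := eqVneq t 0; first by rewrite E t0 mulr0.
have t1 := entire_norm_gt0 ltr01 t0.
(* At this radius |t|_1 <= |t|_s <= 1 / s, while |t|_1 s >= 2. *)
pose s := Num.max 1 (2 / entire_norm t 1).
have s1 : 1 <= s by rewrite le_max lexx.
have s0 : 0 < s by rewrite (lt_le_trans ltr01).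
have := entire_norm_deriv j f s0; rewrite E entire_normM// ler_pM2l ?entire_norm_gt0//.
move=> ts; have := le_trans (entire_norm_le t ltr01 s1) ts.
rewrite -[s^-1]mul1r ler_pdivlMr// => t1s.
have : 2 <= entire_norm t 1 * s by rewrite -ler_pdivrMl// mulrC le_max lexx orbT.
by move=> /le_trans/(_ t1s); rewrite lern1.
Qed.

Lemma wronskian_norm_le j f g r : 0 < r ->
  entire_norm (f * entire_deriv j g - g * entire_deriv j f) r <=
  entire_norm f r * entire_norm g r / r.
Proof.
move=> r0; have n0 h : 0 <= entire_norm h r.
  by apply: gauss_ge0; rewrite ?ltW//; apply: entire_null; exact: ltW.
apply: entire_normB_le => //; rewrite entire_normM//.
  by rewrite -mulrA ler_wpM2l// entire_norm_deriv.
by rewrite [X in _ <= X / _]mulrC -mulrA ler_wpM2l// entire_norm_deriv.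
Qed.

Lemma deriv_zero_support f (g : 'X_{1..m}) j : entire_deriv j f = 0 -> val f g *+ g j = 0.
Proof.
case: (posnP (g j)) => [->|gj] E; first by rewrite mulr0n.
have gE : (g - U_(j) + U_(j))%MM = g by rewrite submK// lep1mP -lt0n.
have := congr1 (fun h : entire v m => val h (g - U_(j))%MM) E.
rewrite [X in X = _ -> _]/(val f (g - U_(j) + U_(j))%MM *+ ((g - U_(j))%MM j).+1) gE.
by rewrite mnmBE mnm1E eqxx subn1 prednK.
Qed.

Lemma deriv_zero_constant f : [pchar F] =i pred0 ->
  (forall j, entire_deriv j f = 0) -> is_constant f.
Proof.
move=> ch0 D0; exists (val f 0%MM); apply: val_inj; apply/funext => g.
rewrite [RHS]/(series_const m (val f 0%MM) g) /series_const.
case: (g =P 0%MM) => [->//|/eqP g0].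
have [j gj] : exists j, g j != 0%N.
  apply: contrapT => h; case/eqP: g0; apply/mnmP => j; rewrite mnm0E.
  by apply/eqP/negPn/negP => gj; apply: h; exists j.
have /eqP := deriv_zero_support g (D0 j).
by rewrite -mulr_natr mulf_eq0 ((pcharf0P F).1 ch0) (negbTE gj) orbF => /eqP.
Qed.

Lemma seriesX_trunc d (x : series F m) n (g : 'X_{1..m}) : (mdeg g < d)%N ->
  (x ^+ n) g = (trunc d x ^+ n)@_g.
Proof.
elim: n g => [|n IH] g gd.
  by rewrite !expr0 mcoeff1 [LHS]/(series_const m 1 g) /series_const; case: eqP.
rewrite !exprS mcoeffM; apply: eq_bigr => -[h k] /= _.
have lt (l : 'X_{1..m < (mdeg g).+1}) : (mdeg l < d)%N by rewrite (leq_ltn_trans _ gd)// -ltnS bmdeg.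
by rewrite mcoeff_trunc lt IH ?lt.
Qed.

Lemma series_frobenius (p : nat) (x : series F m) (g : 'X_{1..m}) : p \in [pchar F] ->
  (x ^+ p) (g *+ p)%MM = x g ^+ p /\
  forall h : 'X_{1..m}, (forall k, h <> (k *+ p)%MM) -> (x ^+ p) h = 0.
Proof.
move=> pF; have p_gt0 : (0 < p)%N by rewrite prime_gt0// (pcharf_prime pF).
have pM : p \in [pchar {mpoly F[m]}].
  by rewrite inE (pcharf_prime pF) -mpolyC_nat (pcharf0 pF) mpolyC0 eqxx.
have frob d : trunc d x ^+ p = \sum_(k : 'X_{1..m < d}) x k ^+ p *: 'X_[k *+ p].
  rewrite -(pFrobenius_autE pM) /trunc rmorph_sum; apply: eq_bigr => k _.
  by rewrite /= pFrobenius_autE exprZn mpolyXn.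
split=> [|h hp]; last first.
  rewrite (seriesX_trunc _ _ (ltnSn (mdeg h))) frob (raddf_sum (mcoeff h)) big1//= => k _.
  rewrite mcoeffZ mcoeffX; case: eqP => [E|_]; rewrite ?mulr0//.
  by case: (hp k).
have gd : (mdeg g < (mdeg (g *+ p)%MM).+1)%N by rewrite ltnS mdegMn leq_pmulr.
rewrite (seriesX_trunc _ _ (ltnSn _)) frob (raddf_sum (mcoeff _)) /=.
rewrite (bigD1 (BMultinom gd))//= mcoeffZ mcoeffX eqxx mulr1 big1 ?addr0// => k kg.
rewrite mcoeffZ mcoeffX; case: eqP => [E|_]; rewrite ?mulr0//.
case/eqP: kg; apply: val_inj; apply/mnmP => i.
by have /mnmP/(_ i) := E; rewrite !mulmnE => /eqP; rewrite eqn_pmul2r// => /eqP.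
Qed.

(** Only exponents divisible by p survive, and the coefficients have p-th roots because the field is
    algebraically closed. *)
Lemma deriv_zero_pth_power p f : p \in [pchar F] ->
  (forall j, entire_deriv j f = 0) -> exists h, f = h ^+ p.
Proof.
move=> pF D0; have p_gt0 : (0 < p)%N by rewrite prime_gt0// (pcharf_prime pF).
have /choice[rt rtP] : forall a : F, exists b, b ^+ p = a.
  move=> a; have /closed_rootP[b /rootP] : size ('X^p - a%:P) != 1%N.
    by rewrite size_XnsubC//; case: p p_gt0 {pF}.
  by rewrite hornerD hornerN hornerXn hornerC => /eqP; rewrite subr_eq0 => /eqP; exists b.
pose x : series F m := fun k => rt (val f (k *+ p)%MM).
have ex : is_entire v x.
  (* The p-th power of the weight of [x] at g is the weight of [f] at p g, whence the threshold e ^+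
     p. *)
  move=> r r0 e e0; have [N fN] := entireP f r0 (exprn_gt0 p e0).
  exists N => g gN; rewrite -(@ltr_pXn2r _ p) ?nnegrE ?(ltW e0)//; last first.
    by rewrite mulr_ge0 ?absval_ge0 ?exprn_ge0.
  rewrite exprMn -absvalX rtP -exprM -mdegMn fN// mdegMn.
  by rewrite (leq_trans gN)// leq_pmulr.
exists (mk_entire ex); apply: val_inj; apply/funext => g.
have valX n : val (mk_entire ex ^+ n) = x ^+ n :> series F m.
  by elim: n => [//|n IH]; rewrite !exprS -IH.
rewrite valX; have [[k ->]|gp] := pselect (exists k, g = (k *+ p)%MM).
  by rewrite (series_frobenius x k pF).1 /x rtP.
rewrite (series_frobenius x 0%MM pF).2 => [|k E]; last by apply: gp; exists k.
have [j gj] : exists j, ~~ (p %| g j)%N.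
  apply: contrapT => h; apply: gp; exists [multinom (g i %/ p)%N | i < m].
  apply/mnmP => i; rewrite mulmnE mnmE divnK//.
  by apply/negPn/negP => gi; apply: h; exists i.
have /eqP := deriv_zero_support g (D0 j).
by rewrite -mulr_natr mulf_eq0 -(dvdn_pcharf pF) (negbTE gj) orbF => /eqP.
Qed.

End EntireNorm.

Section CoprimePowers.
Variables (A : comNzRingType) (a b : A).
Hypothesis a_reg : forall x y : A, a * x = a * y -> x = y.
Hypothesis euclid : forall x : A, divides a (b * x) -> divides a x.

(** Stripping the factors b one by one gives x = a y; cancelling a lowers k. *)
Lemma euclid_exp n k x : divides (a ^+ k) (b ^+ n * x) -> divides (a ^+ k) x.
Proof.
have step y i : divides a (b ^+ i * y) -> divides a y.
  by elim: i => [|i IH]; rewrite ?expr0 ?mul1r// exprS -mulrA => /euclid.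
elim: k x => [|k IH] x; first by rewrite expr0 => _; exists x; rewrite mul1r.
case=> t E; have [|y xE] := step x n.
  by exists (a ^+ k * t); rewrite E exprS mulrA.
have [|z yE] := IH y.
  by exists t; apply: a_reg; rewrite mulrCA -xE E exprS mulrA.
by exists z; rewrite xE yE exprS mulrA.
Qed.

End CoprimePowers.

Lemma relatively_primeC (R : realType) (F : fieldType) (v : nonarch_absval R F) m
  (f g : entire v m) : relatively_prime f g -> relatively_prime g f.
Proof. by case=> c c0 [cf cg cP]; exists c => //; split=> // e eg ef; exact: cP. Qed.

Section Wronskian.
Variables (R : realType) (F : closedFieldType) (v : nonarch_absval R F).
Hypothesis vc : complete_absval v.
Variable m : nat.
Implicit Types f g d : entire v m.

(** If W = 0 then f divides g f', hence f' by coprimality, which the norm estimate allows only for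
    f' = 0. *)
Lemma wronskian_zero_deriv f g j : relatively_prime f g ->
  f * entire_deriv j g - g * entire_deriv j f = 0 -> entire_deriv j f = 0.
Proof.
move=> fg W0; have [->|f0] := eqVneq f 0; first exact: entire_deriv0.
apply/deriv_not_multiple/(entire_euclid vc f0 fg).
by exists (entire_deriv j g); apply/eqP; rewrite eq_sym -subr_eq0 W0.
Qed.

(* Writing x' for the derivative of x and W = x y' - y x', the combinations
   x (xy(x+y))' - 3 x' xy(x+y) = W (x^2 + 2xy) and
   y (xy(x+y))' - 3 y' xy(x+y) = - W (y^2 + 2xy), together with W xy(x+y),
   generate W x^3 and W y^3. *)
Lemma gcd_divides_wronskian f g d j : f != 0 -> d != 0 -> relatively_prime f g ->
  divides d (f * g * (f + g)) -> divides d (entire_deriv j (f * g * (f + g))) ->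
  divides d (f * entire_deriv j g - g * entire_deriv j f).
Proof.
move=> f0 d0 fg dP; rewrite !entire_derivM entire_derivD.
set f' := entire_deriv j f; set g' := entire_deriv j g; set P' := (X in divides d X).
move=> dP'; pose W := f * g' - g * f'; pose P := f * g * (f + g).
have dW1 : divides d (W * (f ^+ 2 + 2 * (f * g))).
  have -> : W * (f ^+ 2 + 2 * (f * g)) = f * P' - 3 * f' * P by rewrite /W /P /P'; ring.
  by apply: dividesB; exact: divides_mull.
have dW2 : divides d (W * (g ^+ 2 + 2 * (f * g))).
  have -> : W * (g ^+ 2 + 2 * (f * g)) = 3 * g' * P - g * P' by rewrite /W /P /P'; ring.
  by apply: dividesB; exact: divides_mull.
have dW3 : divides d (W * P) by exact: divides_mull.
have [a aE] : divides d (W * f ^+ 3).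
  have -> : W * f ^+ 3 = f * (W * (f ^+ 2 + 2 * (f * g))) +
      2 * (g * (W * (f ^+ 2 + 2 * (f * g))) - 2 * (W * P)) by rewrite /P; ring.
  apply: dividesD; first exact: divides_mull.
  by apply: divides_mull; apply: dividesB; exact: divides_mull.
have [b bE] : divides d (W * g ^+ 3).
  have -> : W * g ^+ 3 = g * (W * (g ^+ 2 + 2 * (f * g))) +
      2 * (f * (W * (g ^+ 2 + 2 * (f * g))) - 2 * (W * P)) by rewrite /P; ring.
  apply: dividesD; first exact: divides_mull.
  by apply: divides_mull; apply: dividesB; exact: divides_mull.
have freg x y : f * x = f * y -> x = y by exact: entire_mulfI.
have feuclid x : divides f (g * x) -> divides f x by exact: entire_euclid.
(* From d a = W f^3 and d b = W g^3 comes g^3 a = f^3 b; so f^3 divides a, and cancelling f^3 shows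
   that d divides W. *)
have [|c cE] := euclid_exp freg feuclid (n := 3) (k := 3) (x := a).
  by exists b; apply: (entire_mulfI d0); rewrite mulrCA -aE [d * (_ * b)]mulrCA -bE; ring.
exists c; apply: (@entire_mulfI _ _ _ _ (f ^+ 3)).
  by rewrite !exprS expr0 !entire_mul_neq0// oner_neq0.
by rewrite mulrC aE cE; ring.
Qed.

End Wronskian.

(** * The final inequality *)

Theorem theorem2p6 (R : realType) (F : closedFieldType)
    (v : nonarch_absval R F) (Fcomplete : complete_absval v)
    (m : nat) (f0 f1 f2 : entire v m)
    (f2E : f2 = f0 + f1)
    (f01_coprime : relatively_prime f0 f1)
    (char0 : [pchar F] =i pred0 -> ~ is_constant f0 \/ ~ is_constant f1)
    (charp : forall p : nat, p \in [pchar F] ->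
       ~ (exists h : entire v m, f0 = h ^+ p) \/
       ~ (exists h : entire v m, f1 = h ^+ p))
    (rad : entire v m) (rad_f : is_radical (f0 * f1 * f2) rad)
    (r0 : R) (r0_gt0 : 0 < r0) :
  exists C : R, forall r : R, r0 <= r ->
    Num.max (ln (entire_norm f0 r))
      (Num.max (ln (entire_norm f1 r)) (ln (entire_norm f2 r)))
    <= ln (entire_norm rad r) - ln r + C.
Proof.
pose W j := f0 * entire_deriv j f1 - f1 * entire_deriv j f0.
(* If all of them vanished, coprimality would kill every partial derivative of both functions,
   making both constant or both p-th powers. *)
have [j Wj] : exists j, W j != 0.
  apply: contrapT => noj.
  have W0 j : W j = 0 by apply/eqP/negPn/negP => Wj; apply: noj; exists j.
  have D0 j : entire_deriv j f0 = 0 by exact: wronskian_zero_deriv f01_coprime (W0 j).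
  have D1 j : entire_deriv j f1 = 0.
    apply: (wronskian_zero_deriv Fcomplete (relatively_primeC f01_coprime)).
    by rewrite -opprB -/(W j) W0 oppr0.
  have [[p pF]|ch0] := pselect (exists p, p \in [pchar F]).
    by case: (charp p pF); apply; exact: deriv_zero_pth_power.
  have {}ch0 : [pchar F] =i pred0.
    by move=> p; apply/negP => pF; apply: ch0; exists p.
  by case: (char0 ch0); apply; exact: deriv_zero_constant.
(* Replacing one of the two functions by their sum does not change the Wronskian, so its norm is
   bounded through any two of the three. *)
have W2 : W j = f0 * entire_deriv j f2 - f2 * entire_deriv j f0.
  by rewrite f2E entire_derivD /W; ring.
have W12 : W j = f2 * entire_deriv j f1 - f1 * entire_deriv j f2.
  by rewrite f2E entire_derivD /W; ring.
have f0n0 : f0 != 0.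
  by apply: contra_neq Wj => E; rewrite /W E entire_deriv0 mulr0 mul0r subrr.
have f1n0 : f1 != 0.
  by apply: contra_neq Wj => E; rewrite /W E entire_deriv0 mulr0 mul0r subrr.
have f2n0 : f2 != 0.
  by apply: contra_neq Wj => E; rewrite W2 E entire_deriv0 mulr0 mul0r subrr.
have fn0 : f0 * f1 * f2 != 0 by rewrite !entire_mul_neq0.
have [d [q [dq [q_rad rad_min]]]] := rad_f.
have qn0 i : q i != 0 by apply: contra_neq fn0 => qi; rewrite (dq i).2 qi mulr0.
have [[d_f d_f' _] fE] := dq j.
have dn0 : d j != 0 by apply: contra_neq fn0 => dj; rewrite fE dj mul0r.
have radn0 : rad != 0.
  (* The lcm divides this product, hence cannot be zero. *)
  have prodn0 : \prod_i q i != 0.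
    apply: (big_ind (fun x : entire v m => x != 0)) => //; first exact: oner_neq0.
    by move=> x y; exact: entire_mul_neq0.
  have [|t tE] := rad_min (\prod_i q i).
    by move=> i; rewrite (bigD1 i)//=; exists (\prod_(l | l != i) q l).
  by apply: contra_neq prodn0 => rad0; rewrite tE rad0 mul0r.
have [a WE] : divides (d j) (W j).
  by apply: gcd_divides_wronskian; rewrite -?f2E.
have [s radE] := q_rad j.
have an0 : a != 0 by apply: contra_neq Wj => a0; rewrite WE a0 mulr0.
have sn0 : s != 0 by apply: contra_neq radn0 => s0; rewrite radE s0 mulr0.
(* The cofactors a of d_j in W and s of q_j in the radical have norms nondecreasing in r, hence
   bounded below by their values at [r0]: this is the origin of O(1). *)
pose kappa := entire_norm a r0 * entire_norm s r0.
have kappa0 : 0 < kappa by rewrite mulr_gt0// entire_norm_gt0.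
exists (- ln kappa) => r r0r; have r_gt0 : 0 < r by exact: lt_le_trans r0r.
have N0 (f : entire v m) : f != 0 -> 0 < entire_norm f r by exact: entire_norm_gt0.
(* From |z| |x| |y| = |d_j| |q_j| and |d_j| |a| r <= |x| |y| comes |z| |a| r <= |q_j|; multiplying
   by |s| brings in the radical. *)
have bound (x y z : entire v m) : x != 0 -> y != 0 -> z != 0 ->
    f0 * f1 * f2 = z * (x * y) ->
    entire_norm (W j) r <= entire_norm x r * entire_norm y r / r ->
    ln (entire_norm z r) <= ln (entire_norm rad r) - ln r - ln kappa.
  move=> x0 y0 z0 xyz Wxy.
  rewrite -ln_div ?posrE ?N0// -ln_div ?posrE ?divr_gt0 ?N0//.
  rewrite ler_ln ?posrE ?N0 ?divr_gt0 ?N0//.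
  have xy0 : 0 < entire_norm x r * entire_norm y r by rewrite mulr_gt0 ?N0.
  have E : entire_norm z r * (entire_norm x r * entire_norm y r) =
      entire_norm (d j) r * entire_norm (q j) r.
    by rewrite -!entire_normM// -xyz fE.
  move: Wxy; rewrite WE entire_normM// ler_pdivlMr// => Wxy.
  have ar := entire_norm_le a r0_gt0 r0r; have sr := entire_norm_le s r0_gt0 r0r.
  rewrite ler_pdivlMr// ler_pdivlMr// radE entire_normM// /kappa.
  apply: (@le_trans _ _ (entire_norm z r * entire_norm a r * r * entire_norm s r)).
    rewrite mulrA [leLHS]mulrAC; apply: ler_pM => //.
    - by rewrite !mulr_ge0// ltW ?N0// entire_norm_gt0.
    - by rewrite ltW// entire_norm_gt0.
    - by rewrite ler_wpM2r ?(ltW r_gt0)// ler_wpM2l// ltW// N0.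
  rewrite ler_pM2r ?N0// -(ler_pM2l (N0 _ dn0)) -E.
  have -> : entire_norm (d j) r * (entire_norm z r * entire_norm a r * r) =
    entire_norm z r * (entire_norm (d j) r * entire_norm a r * r) by ring.
  by rewrite ler_wpM2l// ltW// N0.
rewrite !ge_max; apply/and3P; split.
- apply: (bound f2 f1) => //; first by ring.
  by rewrite W12; exact: wronskian_norm_le.
- apply: (bound f0 f2) => //; first by ring.
  by rewrite W2; exact: wronskian_norm_le.
- apply: (bound f0 f1) => //; first by ring.
  exact: wronskian_norm_le.
Qed.
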